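(* Let $T>0$, $d\in\mathbb{N}$, $0<\alpha<1$ and $1\le p\le+\infty$ be such that $\alpha>\frac1p$ and $\frac1\alpha\notin\mathbb{N}\setminus\{1\}$. Then every $\mathbb{R}^d$-valued path $X\in W^\alpha_p([0,T];\mathbb{R}^d)$ can be lifted to a weakly geometric Sobolev rough path: there exists $\mathbf{X}\in W^\alpha_p([0,T];G^{[1/\alpha]}(\mathbb{R}^d))$ with $\pi_1(\mathbf{X}_t)=X_t$ for all $t\in[0,T]$.
   Context: $[r]$ denotes the largest integer $\le r$. For $N\in\mathbb{N}$, $T^N(\mathbb{R}^d)=\bigoplus_{k=0}^N(\mathbb{R}^d)^{\otimes k}$ is the truncated tensor algebra with product $\otimes$ and bracket $[a,b]=a\otimes b-b\otimes a$; $\mathcal{G}^N(\mathbb{R}^d)=W_1\oplus\dots\oplus W_N$ with $W_1=\mathbb{R}^d$, $W_{i+1}=[\mathbb{R}^d,W_i]$, and $G^N(\mathbb{R}^d)=\exp(\mathcal{G}^N(\mathbb{R}^d))$ is the step-$N$ free nilpotent group (product $\otimes$). $\pi_1$ is the projection of $T^N(\mathbb{R}^d)$ onto the first level $\mathbb{R}^d$. Every $g\in G^N(\mathbb{R}^d)$ is the step-$N$ signature $S_N(\gamma)_{0,1}$ of some path $\gamma:[0,1]\to\mathbb{R}^d$ of bounded variation, and the Carnot–Carathéodory norm $\|g\|$ is the infimum of the lengths of such $\gamma$. $G^N(\mathbb{R}^d)$ is equipped with the metric $d_{cc}(g,h)=\|g^{-1}\otimes h\|$. For a metric space $(E,d)$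 and $p<\infty$, $W^\alpha_p([0,T];E)$ is the set of measurable paths $f:[0,T]\to E$ with $\iint_{[0,T]^2}\frac{d(f(s),f(t))^p}{|t-s|^{\alpha p+1}}\,ds\,dt<\infty$; for $p=\infty$ it is the space of $\alpha$-Hölder continuous paths. Since $\alpha>1/p$, elements of these spaces are taken to be continuous paths (continuous representatives). *)

(* Defs.v *)
From HB Require Import structures.
From mathcomp Require Import all_boot all_order all_algebra all_field.
From mathcomp Require Import all_classical all_reals all_analysis.
Set Implicit Arguments.
Unset Strict Implicit.
Unset Printing Implicit Defensive.
Import Order.TTheory GRing.Theory Num.Theory.
Import numFieldNormedType.Exports.
Local Open Scope classical_set_scope.
Local Open Scope ring_scope.

(* The truncated tensor algebra T^N(K^d), in the basis e_w = e_w1 ⊗ ... ⊗ e_wk *)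
(* indexed by the words w of length k <= N over the alphabet 'I_d. The ring    *)
(* product is ⊗; as T^N(K^d) is finite-dimensional, falgebra provides the      *)
(* inverse x^-1.                                                               *)
Definition tensor (K : fieldType) (d N : nat) : Type :=
  {ffun N.-bseq 'I_d -> K^o}.

Section TensorAlgebra.
Variables (K : fieldType) (d N : nat).
Local Notation T := (tensor K d N).
Implicit Types (a b c : T) (w : seq 'I_d).

HB.instance Definition _ := Vector.copy T {ffun N.-bseq 'I_d -> K^o}.

(* 0 on the words of length > N *)
Definition tcoef a w : K := if insub w is Some u then a u else 0.

Definition tone : T := [ffun w : N.-bseq 'I_d => (nilp w)%:R].

Definition tmul a b : T := [ffun w : N.-bseq 'I_d =>
  \sum_(k < (size w).+1) tcoef a (take k w) * tcoef b (drop k w)].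

Lemma tcoefE a (w : N.-bseq 'I_d) : tcoef a w = a w.
Proof. by rewrite /tcoef valK. Qed.

Lemma tcoef_le (f : N.-bseq 'I_d -> K^o) w (wN : (size w <= N)%N) :
  tcoef ([ffun u => f u] : T) w = f (Bseq wN).
Proof. by rewrite /tcoef insubT ffunE. Qed.

Lemma tcoef_gt a w : (N < size w)%N -> tcoef a w = 0.
Proof. by move=> wN; rewrite /tcoef insubN // -ltnNge. Qed.

Lemma tensorP a b : (forall w, (size w <= N)%N -> tcoef a w = tcoef b w) ->
  a = b.
Proof.
by move=> ab; apply/ffunP => w; rewrite -!tcoefE ab// size_bseq.
Qed.

Lemma tcoefD a b w : tcoef (a + b) w = tcoef a w + tcoef b w.
Proof. by rewrite /tcoef; case: insubP => [u _ _|_]; rewrite ?ffunE ?addr0. Qed.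

Lemma tcoefZ (k : K) a w : tcoef (k *: a) w = k * tcoef a w.
Proof. by rewrite /tcoef; case: insubP => [u _ _|_]; rewrite ?ffunE ?mulr0. Qed.

Lemma tcoef1 w : tcoef tone w = (nilp w)%:R.
Proof.
have [wN|wN] := leqP (size w) N; first by rewrite tcoef_le.
by rewrite tcoef_gt//; case: w wN.
Qed.

Lemma tcoefM a b w : (size w <= N)%N ->
  tcoef (tmul a b) w =
  \sum_(k < (size w).+1) tcoef a (take k w) * tcoef b (drop k w).
Proof. by move=> wN; rewrite tcoef_le. Qed.

Lemma triangular_sum (F : nat -> nat -> K) n :
  \sum_(k < n.+1) \sum_(l < (n - k).+1) F k (k + l)%N =
  \sum_(m < n.+1) \sum_(k < m.+1) F k m.
Proof.
transitivity (\sum_(k < n.+1) \sum_(m < n.+1 | (k <= m)%N) F k m).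
  apply: eq_bigr => -[k /= kn] _.
  rewrite -(big_mkord (fun m => k <= m)%N (F k)).
  rewrite -(big_mkord xpredT (fun l => F k (k + l)%N)) -subSn//.
  under eq_bigr do rewrite addnC.
  by rewrite -(big_addn 0 n.+1 k xpredT) add0n (big_nat_widenl k 0).
rewrite (exchange_big_dep xpredT)//=; apply: eq_bigr => -[m /= mn] _.
rewrite -(big_mkord (fun k => k <= m)%N (F ^~ m)).
by rewrite -(big_mkord xpredT (F ^~ m)) (big_nat_widen 0 m.+1 n.+1)//.
Qed.

Lemma tmulA : associative tmul.
Proof.
move=> a b c; apply: tensorP => w wN; rewrite !tcoefM//.
pose F k m := tcoef a (take k w) * tcoef b (drop k (take m w))
  * tcoef c (drop m w).
transitivity (\sum_(k < (size w).+1) \sum_(l < (size w - k).+1) F k (k + l)%N).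
  apply: eq_bigr => -[k /= kw] _.
  rewrite tcoefM ?size_drop ?(leq_trans (leq_subr _ _))// mulr_sumr.
  apply: eq_bigr => l _; rewrite /F mulrA drop_drop [(l + k)%N]addnC.
  by rewrite take_drop [(l + k)%N]addnC.
rewrite triangular_sum; apply: eq_bigr => -[m /=]; rewrite ltnS => mw _.
rewrite tcoefM size_takel ?(leq_trans mw)// mulr_suml.
by apply: eq_bigr => -[k /=]; rewrite ltnS => km _; rewrite /F take_takel.
Qed.

Lemma tmul1 : left_id tone tmul.
Proof.
move=> a; apply: tensorP => w wN; rewrite tcoefM// big_ord_recl big1.
  by rewrite addr0 take0 drop0 tcoef1 mul1r.
move=> [k kw] _; rewrite tcoef1 lift0 /nilp size_takel//.
by rewrite mul0r.
Qed.

Lemma tmulr1 : right_id tone tmul.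
Proof.
move=> a; apply: tensorP => w wN; rewrite tcoefM// big_ord_recr big1 /=.
  by rewrite add0r take_size drop_size tcoef1 mulr1.
move=> [k kw] _; rewrite tcoef1 /nilp size_drop subn_eq0 leqNgt kw.
by rewrite mulr0.
Qed.

Lemma tmulDl : left_distributive tmul +%R.
Proof.
move=> a b c; apply: tensorP => w wN; rewrite tcoefD !tcoefM// -big_split/=.
by apply: eq_bigr => k _; rewrite tcoefD mulrDl.
Qed.

Lemma tmulDr : right_distributive tmul +%R.
Proof.
move=> a b c; apply: tensorP => w wN; rewrite tcoefD !tcoefM// -big_split/=.
by apply: eq_bigr => k _; rewrite tcoefD mulrDr.
Qed.

Lemma tone_neq0 : tone != 0.
Proof.
apply/eqP => /(congr1 (tcoef ^~ [::])); rewrite /= tcoef1 tcoef_le//=.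
by move/eqP; rewrite oner_eq0.
Qed.

HB.instance Definition _ := GRing.Zmodule_isNzRing.Build T
  tmulA tmul1 tmulr1 tmulDl tmulDr tone_neq0.

Lemma tensor_scalerAl (k : K) a b : k *: (a * b) = (k *: a) * b.
Proof.
apply: tensorP => w wN; rewrite tcoefZ !tcoefM// mulr_sumr.
by apply: eq_bigr => i _; rewrite tcoefZ mulrA.
Qed.

HB.instance Definition _ := GRing.Lmodule_isLalgebra.Build K T tensor_scalerAl.

Lemma tensor_scalerAr (k : K) a b : k *: (a * b) = a * (k *: b).
Proof.
apply: tensorP => w wN; rewrite tcoefZ !tcoefM// mulr_sumr.
by apply: eq_bigr => i _; rewrite tcoefZ mulrCA.
Qed.

HB.instance Definition _ :=
  GRing.Lalgebra_isAlgebra.Build K T tensor_scalerAr.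

HB.instance Definition _ := Algebra_isFalgebra.Build K T.

End TensorAlgebra.

Section FreeNilpotentGroup.
Variables (K : fieldType) (d N : nat).
Local Notation T := (tensor K d N).

(* the embedding of K^d as the first level, for N >= 1 *)
Definition level1 (x : 'rV[K]_d) : T :=
  [ffun w : N.-bseq 'I_d => if val w is [:: i] then x 0 i else 0 : K].

Definition pi1 (a : T) : 'rV[K]_d := \row_i tcoef a [:: i].

Definition bracket (a b : T) : T := a * b - b * a.

Definition linear_span (A : set T) : set T :=
  [set x | exists2 s : seq T, (forall y, y \in s -> A y) & x \in span s].

(* lieW k is W_{k+1} *)
Fixpoint lieW (k : nat) : set T :=
  if k is j.+1 then
    linear_span [set y | exists x w, lieW j w /\ y = bracket (level1 x) w]
  else range level1.

(* the Lie algebra W_1 + ... + W_N *)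
Definition free_lie : set T :=
  [set x | exists2 w : 'I_N -> T, (forall i : 'I_N, lieW i (w i)) & x = \sum_i w i].

(* The sum stops at N because x ^+ k = 0 for k > N when x has no component of  *)
(* level 0, as is the case in free_lie.                                        *)
Definition texp (x : T) : T := \sum_(k < N.+1) (k`!%:R)^-1 *: x ^+ k.

Definition free_group : set T := texp @` free_lie.

End FreeNilpotentGroup.

Arguments free_lie : clear implicits.
Arguments free_group : clear implicits.

Section PathsOfBoundedVariation.
Variable R : realType.

Definition euclidean_norm d (x : 'rV[R]_d) : R := Num.sqrt (\sum_i x 0 i ^+ 2).

Definition euclidean_dist d (x y : 'rV[R]_d) : R := euclidean_norm (x - y).

Definition continuous_on (E : Type) (dist : E -> E -> R) (a b : R)
    (f : R -> E) : Prop :=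
  forall s, s \in `[a, b] ->
    dist (f s) (f t) @[t --> within [set` `[a, b]] (nbhs s)] --> (0 : R).

(* As in itv_partition, the partition points are those of a :: s. *)
Definition path_length d (a b : R) (g : R -> 'rV[R]_d) : \bar R :=
  ereal_sup [set (\sum_(0 <= k < size s)
      euclidean_dist (g (nth b (a :: s) k)) (g (nth b (a :: s) k.+1)))%:E
    | s in itv_partition a b].

(* Riemann-Stieltjes integral of f against g over [a, b]; xi gives the tags *)
Definition is_RS_integral (f g : R -> R) (a b I : R) : Prop :=
  forall e, 0 < e -> exists2 delta, 0 < delta &
    forall (s : seq R) (xi : nat -> R), itv_partition a b s ->
      let t := nth b (a :: s) in
      (forall k, (k < size s)%N ->
        t k.+1 - t k < delta /\ t k <= xi k <= t k.+1) ->
      `|\sum_(0 <= k < size s) f (xi k) * (g (t k.+1) - g (t k)) - I| < e.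

(* The choice is unique for a <= b, and exists for f continuous and g of       *)
(* bounded variation on [a, b].                                                *)
Definition RS_integral (f g : R -> R) (a b : R) : R :=
  get [set I | is_RS_integral f g a b I].

(* integral of dg^{w1}_{u1} ... dg^{wk}_{uk} over 0 < u1 < ... < uk < t, by    *)
(* iterating F |-> (t |-> integral of F dg^{wj} over [0, t]) along w           *)
Definition iterated_integral d (g : R -> 'rV[R]_d) (w : seq 'I_d) : R -> R :=
  foldl (fun F i t => RS_integral F (fun u => g u 0 i) 0 t) (cst 1) w.

Definition signature d N (g : R -> 'rV[R]_d) : tensor R d N :=
  [ffun w : N.-bseq 'I_d => iterated_integral g w 1].

(* Every element of free_group is the signature of a continuous path of        *)
(* bounded variation (Chow), so that the infimum is over a nonempty set there. *)
Definition cc_norm d N (x : tensor R d N) : R :=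
  inf [set l | exists g : R -> 'rV[R]_d,
    [/\ continuous_on (@euclidean_dist d) 0 1 g, path_length 0 1 g = l%:E
      & signature N g = x]].

Definition cc_dist d N (x y : free_group R d N) : R :=
  cc_norm ((val x)^-1 * val y).

End PathsOfBoundedVariation.

(* W^alpha_p([0, T]; E) for the metric dist on E and alpha > 1/p: its elements *)
(* are the continuous paths, whence measurable, and only the values on [0, T]  *)
(* of a path R -> E matter. On the diagonal the integrand is 0 / 0 = 0.        *)
Definition sobolev_path (R : realType) (E : Type) (dist : E -> E -> R)
    (alpha : R) (p : \bar R) (T : R) (f : R -> E) : Prop :=
  continuous_on dist 0 T f /\
  match p with
  | q%:E => (\int[lebesgue_measure \x lebesgue_measure]_(z in
               [set` `[0%R, T]] `*` [set` `[0%R, T]])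
             (dist (f z.1) (f z.2) `^ q /
               `|z.2 - z.1| `^ (alpha * q + 1))%:E < +oo)%E
  | +oo%E => exists C : R, forall s t, s \in `[0, T] -> t \in `[0, T] ->
               dist (f s) (f t) <= C * `|t - s| `^ alpha
  | -oo%E => False
  end.

(* Main.v *)
Require Import Defs.
From mathcomp Require Import all_boot all_order all_algebra.
From mathcomp Require Import all_classical all_reals all_analysis.
From mathcomp Require Import measurable_realfun.
From mathcomp Require Import zify ring lra.
Import Order.TTheory GRing.Theory Num.Theory.
Import numFieldNormedType.Exports.
(** The lift is built on dyadic points by the method of Lyons and Victoir, from a
    family of sizes [om m k], one for each dyadic interval of [0, T], that bound
    the increments of [X] and shrink from an interval to its halves by factors
    between two constants [b <= a < 1] with [1 < 2 * b ^ N] ([control]).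

    Each interval carries a product of exponentials of vectors whose total length
    is at most a multiple of its size.  One starts from the exponential of the
    increment of [X], so that products over two halves agree with the value on the
    whole interval at level one, and gains one level at a time
    ([lift_tree_step]).  The defect of multiplicativity at the next level is a Lie
    element of order the power [n + 1] of the size; it is shared equally between
    the two halves.  The corrections inherited from all ancestors form a geometric
    series, which converges because [1 < 2 * b ^ (n + 1)]: as [b] is close to
    [2 ^ (- alpha)], this is [alpha * (n + 1) < 1], true for [n + 1 <= N] since
    [1 / alpha] is not an integer above one.

    The group is handled through the derivation [deg] that multiplies level [k]
    by [k].  An element [g] is in [grp] when [g^-1 * deg g] is a Lie element.
    Products of exponentials of vectors have this property because conjugation by
    such an exponential preserves Lie elements ([conj_texp1_lie]).  Two elements
    of [grp] that agree up to level [n] differ at level [n + 1] by a Lie element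
    ([grp_lev]).  Hence elements of [grp] are exponentials of Lie elements
    ([grp_free_group]), and, Lie elements being reached by nested group
    commutators, they are products of exponentials of vectors whose total length
    is comparable with their homogeneous size ([chow]).  Such a product is the
    signature of a polygonal path, so that its length bounds the
    Carnot-Caratheodory norm ([cc_norm_wexp]).  As [grp] and homogeneous bounds
    pass to limits, the lift extends from dyadic points to a path whose increments
    are bounded by sizes ([lift_path]).

    For Hoelder paths the sizes are [2 ^ (- alpha m)].  For finite [p], a chain of
    central points through nested dyadic intervals bounds the increments of [X] by
    [energy], an integral of the Sobolev energy density, as in the inequality of
    Garsia, Rodemich and Rumsey; its smallest slowly decaying majorant
    ([control_majorant]) provides sizes whose [p]-th powers, weighted by
    [2 ^ (m (alpha p - 1))], are summable.  Conversely this summability bounds the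
    Sobolev energy of the lift ([sobolev_integral_fin]). *)

Set Implicit Arguments.
Unset Strict Implicit.
Unset Printing Implicit Defensive.
Local Open Scope classical_set_scope.
Local Open Scope ring_scope.

(** * Levels of the truncated tensor algebra *)

Section GradedAlgebra.
Variables (K : fieldType) (d N : nat).
Local Notation T := (tensor K d N).
Implicit Types (a b c x : T) (w : seq 'I_d).

Lemma tcoef_mul a b w : (size w <= N)%N ->
  tcoef (a * b) w =
  \sum_(k < (size w).+1) tcoef a (take k w) * tcoef b (drop k w).
Proof. exact: tcoefM. Qed.

Lemma tcoef_one w : tcoef (1 : T) w = (nilp w)%:R.
Proof. exact: tcoef1. Qed.

Lemma tcoefN a w : tcoef (- a) w = - tcoef a w.
Proof. by rewrite -scaleN1r tcoefZ mulN1r. Qed.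

Lemma tcoefB a b w : tcoef (a - b) w = tcoef a w - tcoef b w.
Proof. by rewrite tcoefD tcoefN. Qed.

Lemma tcoef0 w : tcoef (0 : T) w = 0.
Proof. by rewrite -(subrr 0) tcoefB subrr. Qed.

Lemma tcoef_sum (I : Type) (r : seq I) (P : pred I) (F : I -> T) w :
  tcoef (\sum_(i <- r | P i) F i) w = \sum_(i <- r | P i) tcoef (F i) w.
Proof.
by elim/big_rec2: _ => [|i y1 y2 _ <-]; rewrite ?tcoef0// tcoefD.
Qed.

Lemma tcoef_mul_nil a b : tcoef (a * b) [::] = tcoef a [::] * tcoef b [::].
Proof. by rewrite tcoef_mul// big_ord1. Qed.

Definition eqlev n a b := forall w, (size w <= n)%N -> tcoef a w = tcoef b w.

Definition vanish n a := forall w, (size w < n)%N -> tcoef a w = 0.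

Lemma eqlevP n a b : eqlev n a b <-> vanish n.+1 (a - b).
Proof.
split=> ab w /ab.
  by rewrite tcoefB => ->; rewrite subrr.
by rewrite tcoefB => /eqP; rewrite subr_eq0 => /eqP.
Qed.

Lemma vanishD n a b : vanish n a -> vanish n b -> vanish n (a + b).
Proof. by move=> va vb w wn; rewrite tcoefD va// vb// addr0. Qed.

Lemma vanishN n a : vanish n a -> vanish n (- a).
Proof. by move=> va w wn; rewrite tcoefN va// oppr0. Qed.

Lemma vanishW m n a : (m <= n)%N -> vanish n a -> vanish m a.
Proof. by move=> mn va w wm; apply: va; exact: leq_trans mn. Qed.

Lemma vanishM m n a b : vanish m a -> vanish n b -> vanish (m + n) (a * b).
Proof.
move=> va vb w wmn; have [wN|wN] := leqP (size w) N; last by rewrite tcoef_gt.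
rewrite tcoef_mul// big1// => -[k /=]; rewrite ltnS => kw _.
have [km|mk] := ltnP k m.
  by rewrite va ?mul0r// size_takel.
by rewrite vb ?mulr0// size_drop; lia.
Qed.

Lemma vanishMl n a b : vanish n b -> vanish n (a * b).
Proof. by move=> vb; apply: (@vanishM 0) => // w. Qed.

Lemma vanishMr n a b : vanish n a -> vanish n (a * b).
Proof. by move=> va; rewrite -[n]addn0; apply: vanishM => // w. Qed.

Lemma vanish_eq0 n a : (N < n)%N -> vanish n a -> a = 0.
Proof.
move=> Nn va; apply: tensorP => w wN; rewrite tcoef0 va//.
exact: leq_ltn_trans Nn.
Qed.

Lemma eqlev_sym n a b : eqlev n a b -> eqlev n b a.
Proof. by move=> ab w wn; rewrite ab. Qed.

Lemma eqlev_trans n a b c : eqlev n a b -> eqlev n b c -> eqlev n a c.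
Proof. by move=> ab bc w wn; rewrite ab// bc. Qed.

Lemma eqlevW m n a b : (m <= n)%N -> eqlev n a b -> eqlev m a b.
Proof. by move=> mn ab w wm; apply: ab; exact: leq_trans mn. Qed.

Lemma eqlevM n a b c x : eqlev n a b -> eqlev n c x -> eqlev n (a * c) (b * x).
Proof.
move=> /eqlevP ab /eqlevP cx; apply/eqlevP.
rewrite -[_ - _](subrKA (b * c)) -mulrBl -mulrBr.
by apply: vanishD; [exact: vanishMr|exact: vanishMl].
Qed.

Lemma eqlev_eq a b : eqlev N a b -> a = b.
Proof. by move=> ab; apply: tensorP. Qed.

Definition lev (k : nat) a : T :=
  [ffun w : N.-bseq 'I_d => if size w == k then a w : K else 0].

Lemma tcoef_lev k a w : tcoef (lev k a) w = if size w == k then tcoef a w else 0.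
Proof.
have [wN|wN] := leqP (size w) N; last by rewrite !tcoef_gt// if_same.
by rewrite tcoef_le/= /tcoef insubT.
Qed.

Lemma levD k a b : lev k (a + b) = lev k a + lev k b.
Proof.
by apply: tensorP => w _; rewrite !(tcoefD, tcoef_lev); case: ifP; rewrite ?addr0.
Qed.

Lemma levZ k (t : K) a : lev k (t *: a) = t *: lev k a.
Proof.
by apply: tensorP => w _; rewrite !(tcoefZ, tcoef_lev); case: ifP; rewrite ?mulr0.
Qed.

Lemma levB k a b : lev k (a - b) = lev k a - lev k b.
Proof. by rewrite levD -[- b]scaleN1r levZ scaleN1r. Qed.

Lemma lev0 k : lev k 0 = 0.
Proof. by rewrite -[X in lev _ X](subrr 0) levB subrr. Qed.

Lemma lev_sum k (I : Type) (r : seq I) (P : pred I) (F : I -> T) :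
  lev k (\sum_(i <- r | P i) F i) = \sum_(i <- r | P i) lev k (F i).
Proof.
by elim/big_rec2: _ => [|i y1 y2 _ <-]; rewrite ?lev0// levD.
Qed.

Lemma levS a : \sum_(k < N.+1) lev k a = a.
Proof.
apply: tensorP => w wN; rewrite tcoef_sum.
rewrite (bigD1 (Ordinal (wN : (size w < N.+1)%N)))//= big1 ?addr0.
  by rewrite tcoef_lev eqxx.
move=> i; rewrite -val_eqE /= => iw.
by rewrite tcoef_lev eq_sym (negbTE iw).
Qed.

Lemma lev_vanish k n a : (k < n)%N -> vanish n a -> lev k a = 0.
Proof.
move=> kn va; apply: tensorP => w _; rewrite tcoef_lev tcoef0.
by case: eqP => // wk; rewrite va// wk.
Qed.

Lemma vanish_lev k a : vanish k (lev k a).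
Proof. by move=> w wk; rewrite tcoef_lev ltn_eqF. Qed.

Lemma lev_lev j k a : lev j (lev k a) = if j == k then lev k a else 0.
Proof.
apply: tensorP => w _; rewrite !tcoef_lev.
case: (altP (j =P k)) => [->|jk].
  by rewrite tcoef_lev; case: (size w == k).
by rewrite tcoef0; case: eqP => // ->; rewrite (negbTE jk).
Qed.

(** The derivation generating the dilations of the tensor algebra. *)
Definition deg a : T := [ffun w : N.-bseq 'I_d => (size w)%:R * a w : K].

Lemma tcoef_deg a w : tcoef (deg a) w = (size w)%:R * tcoef a w.
Proof.
have [wN|wN] := leqP (size w) N; last by rewrite !tcoef_gt// mulr0.
by rewrite tcoef_le/= /tcoef insubT.
Qed.

Lemma degM a b : deg (a * b) = deg a * b + a * deg b.
Proof.
apply: tensorP => w wN; rewrite tcoef_deg tcoefD !tcoef_mul// mulr_sumr.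
rewrite -big_split/=; apply: eq_bigr => -[k /=]; rewrite ltnS => kw _.
rewrite !tcoef_deg size_takel// size_drop -[in LHS](subnKC kw) natrD; ring.
Qed.

Lemma degD a b : deg (a + b) = deg a + deg b.
Proof. by apply: tensorP => w wN; rewrite !(tcoef_deg, tcoefD) mulrDr. Qed.

Lemma degZ (t : K) a : deg (t *: a) = t *: deg a.
Proof. by apply: tensorP => w wN; rewrite !(tcoef_deg, tcoefZ) mulrCA. Qed.

Lemma deg1 : deg 1 = 0.
Proof.
apply: tensorP => w wN; rewrite tcoef_deg tcoef_one tcoef0.
by case: w {wN} => [|? ?]; rewrite ?mul0r ?mulr0.
Qed.

Lemma lev_deg k a : lev k (deg a) = k%:R *: lev k a.
Proof.
apply: tensorP => w wN; rewrite tcoefZ !tcoef_lev tcoef_deg.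
by case: eqP => [->//|]; rewrite mulr0.
Qed.

Lemma deg_lev k a : deg (lev k a) = k%:R *: lev k a.
Proof.
apply: tensorP => w wN; rewrite tcoefZ tcoef_deg !tcoef_lev.
by case: eqP => [->//|]; rewrite !mulr0.
Qed.

Lemma tcoef_level1 (v : 'rV[K]_d) w : (size w <= N)%N ->
  tcoef (level1 N v) w = if w is [:: i] then v 0 i else 0.
Proof. by move=> wN; rewrite tcoef_le. Qed.

Lemma vanish_level1 (v : 'rV[K]_d) : vanish 1 (level1 N v).
Proof. by case=> //= _; rewrite tcoef_level1. Qed.

Lemma tcoef_mul_level1 a (v : 'rV[K]_d) w i : (size w < N)%N ->
  tcoef (a * level1 N v) (rcons w i) = tcoef a w * v 0 i.
Proof.
move=> wN; have w1N : (size (rcons w i) <= N)%N by rewrite size_rcons.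
rewrite tcoef_mul// (bigD1 (inord (size w)))//= big1 => [|k].
  rewrite addr0 inordK ?size_rcons// -cats1 take_size_cat// drop_size_cat//.
  by rewrite tcoef_level1// (leq_ltn_trans _ wN).
move=> kw; rewrite tcoef_level1 ?size_drop; last first.
  by rewrite (leq_trans (leq_subr _ _)).
have : size (drop k (rcons w i)) != 1%N.
  apply: contra kw; rewrite size_drop => /eqP kw; have sw := size_rcons w i.
  by apply/eqP/val_inj; rewrite /= inordK; lia.
by case: (drop _ _) => [|j [|]]; rewrite ?mulr0.
Qed.

Lemma tcoef_level1_mul a (v : 'rV[K]_d) w i : (size w < N)%N ->
  tcoef (level1 N v * a) (i :: w) = v 0 i * tcoef a w.
Proof.
move=> wN; rewrite tcoef_mul// (bigD1 (inord 1))//= big1 => [|k].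
  by rewrite addr0 inordK//= take0 drop0 tcoef_level1// (leq_ltn_trans _ wN).
move=> kw; have tkw : size (take k (i :: w)) = k.
  by rewrite size_takel// -ltnS.
rewrite tcoef_level1 ?tkw; last by rewrite (leq_trans _ wN)// -ltnS.
have : size (take k (i :: w)) != 1%N.
  apply: contra kw; rewrite tkw.
  by move=> /eqP k1; apply/eqP/val_inj; rewrite /= inordK.
by case: (take _ _) => [|j [|]]; rewrite ?mul0r.
Qed.

Lemma tcoef_mul_level1_nil a (v : 'rV[K]_d) : tcoef (a * level1 N v) [::] = 0.
Proof. by rewrite tcoef_mul_nil tcoef_level1// mulr0. Qed.

Lemma tcoef_level1_mul_nil a (v : 'rV[K]_d) : tcoef (level1 N v * a) [::] = 0.
Proof. by rewrite tcoef_mul_nil tcoef_level1// mul0r. Qed.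

Lemma lev_bracket_level1 k a (v : 'rV[K]_d) :
  lev k.+1 (bracket a (level1 N v)) = bracket (lev k a) (level1 N v).
Proof.
apply: tensorP => w wN; rewrite tcoef_lev !tcoefB.
case/lastP: w wN => [|w i] wN.
  by rewrite !(tcoef_mul_level1_nil, tcoef_level1_mul_nil) subrr.
have wN' : (size w < N)%N by rewrite -(size_rcons w i).
rewrite !tcoef_mul_level1// size_rcons eqSS tcoef_lev.
have -> : rcons w i = head i w :: behead (rcons w i) by case: (w).
rewrite !tcoef_level1_mul ?size_behead ?size_rcons// tcoef_lev.
rewrite size_behead size_rcons/=.
by case: ifP => //; rewrite mulr0 mul0r subrr.
Qed.

Lemma lev0_bracket_level1 a (v : 'rV[K]_d) : lev 0 (bracket a (level1 N v)) = 0.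
Proof.
apply: (@lev_vanish _ 1) => //; apply: vanishD; first exact/vanishMl/vanish_level1.
by apply: vanishN; apply/vanishMr/vanish_level1.
Qed.

End GradedAlgebra.

(** * Products of exponentials of vectors *)

Section WordExponentials.
Variables (K : realFieldType) (d N : nat).
Local Notation T := (tensor K d N).
Implicit Types (a b c x : T) (w : seq 'I_d) (v : 'rV[K]_d) (s : seq 'rV[K]_d).

(** The exponential of a vector of the first level, which is the signature of the
    straight path with increment [v]. *)
Definition texp1 v : T :=
  [ffun w : N.-bseq 'I_d => (\prod_(i <- w) v 0 i) / (size w)`!%:R : K].

Lemma tcoef_texp1 v w : (size w <= N)%N ->
  tcoef (texp1 v) w = (\prod_(i <- w) v 0 i) / (size w)`!%:R.
Proof. by move=> wN; rewrite tcoef_le. Qed.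

Lemma tcoef_texp1_nil v : tcoef (texp1 v) [::] = 1.
Proof. by rewrite tcoef_texp1// big_nil divr1. Qed.

Lemma binomial_fact (s t : K) n :
  \sum_(k < n.+1) s ^+ k / k`!%:R * (t ^+ (n - k) / (n - k)`!%:R) =
  (s + t) ^+ n / n`!%:R.
Proof.
rewrite exprDn mulr_suml [RHS](reindex_inj rev_ord_inj)/=.
apply: eq_bigr => -[k /=]; rewrite ltnS subSS => kn _; rewrite subKn//.
have kn' : (n - k <= n)%N by exact: leq_subr.
have fact_neq0 m : (m`!%:R : K) != 0 by rewrite pnatr_eq0 -lt0n fact_gt0.
rewrite -mulr_natl bin_sub// -[in RHS](bin_fact kn) !natrM.
have bin_neq0 : ('C(n, k)%:R : K) != 0 by rewrite pnatr_eq0 -lt0n bin_gt0.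
by field; rewrite !fact_neq0 bin_neq0.
Qed.

Lemma texp1D v (s t : K) : texp1 (s *: v) * texp1 (t *: v) = texp1 ((s + t) *: v).
Proof.
have prodZ (u : K) w :
    \prod_(i <- w) (u *: v) 0 i = u ^+ size w * \prod_(i <- w) v 0 i.
  elim: w => [|i w IH]; first by rewrite !big_nil mulr1.
  by rewrite !big_cons IH mxE exprS; ring.
apply: tensorP => w wN; rewrite tcoef_mul// tcoef_texp1// prodZ.
transitivity (\sum_(k < (size w).+1) s ^+ k / k`!%:R *
   (t ^+ (size w - k) / (size w - k)`!%:R) * \prod_(i <- w) v 0 i).
  apply: eq_bigr => -[k /=]; rewrite ltnS => kw _.
  have tkw := size_takel kw; have dkw := size_drop k w.
  rewrite !tcoef_texp1 ?tkw ?dkw; [|lia|lia].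
  rewrite -[in X in _ = _ * X](cat_take_drop k w) big_cat/= !prodZ tkw dkw.
  by ring.
by rewrite -mulr_suml binomial_fact; ring.
Qed.

Lemma texp10 : texp1 0 = 1.
Proof.
apply: tensorP => w wN; rewrite tcoef_texp1// tcoef_one.
case: w wN => [|i w] _; first by rewrite big_nil divr1.
by rewrite big_cons mxE !mul0r.
Qed.

Lemma texp1VN v : texp1 v * texp1 (- v) = 1.
Proof.
by rewrite -[v in texp1 v]scale1r -scaleN1r texp1D subrr scale0r texp10.
Qed.

Lemma deg_texp1 v : deg (texp1 v) = texp1 v * level1 N v.
Proof.
apply: tensorP => w wN; rewrite tcoef_deg.
case/lastP: w wN => [|w i] wN; first by rewrite mul0r tcoef_mul_level1_nil.
move: (wN); rewrite size_rcons => wN'.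
rewrite tcoef_mul_level1// !tcoef_texp1// ?size_rcons 1?ltnW//.
rewrite -cats1 big_cat/= big_seq1 factS natrM.
have fact_neq0 m : (m`!%:R : K) != 0 by rewrite pnatr_eq0 -lt0n fact_gt0.
by field; rewrite fact_neq0 (natr1, nat1r) pnatr_eq0.
Qed.

Lemma deg_texp1' v : deg (texp1 v) = level1 N v * texp1 v.
Proof.
apply: tensorP => w wN; rewrite tcoef_deg.
case: w wN => [|i w] wN; first by rewrite mul0r tcoef_level1_mul_nil.
rewrite tcoef_level1_mul// !tcoef_texp1//= 1?ltnW//.
rewrite big_cons factS natrM.
have fact_neq0 m : (m`!%:R : K) != 0 by rewrite pnatr_eq0 -lt0n fact_gt0.
by field; rewrite fact_neq0 (natr1, nat1r) pnatr_eq0.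
Qed.

Definition wexp s : T := \prod_(v <- s) texp1 v.

Lemma wexp_nil : wexp [::] = 1. Proof. exact: big_nil. Qed.

Lemma wexp1 v : wexp [:: v] = texp1 v. Proof. exact: big_seq1. Qed.

Lemma wexp_cat s1 s2 : wexp (s1 ++ s2) = wexp s1 * wexp s2.
Proof. exact: big_cat. Qed.

Lemma wexp_cons v s : wexp (v :: s) = texp1 v * wexp s.
Proof. exact: big_cons. Qed.

(** The word of the path run backwards. *)
Definition winv s : seq 'rV[K]_d := rev (map -%R s).

Lemma winvK s : winv (winv s) = s.
Proof. by rewrite /winv map_rev revK -map_comp map_id_in// => v _ /=; rewrite opprK. Qed.

Lemma wexpK s : wexp s * wexp (winv s) = 1.
Proof.
elim: s => [|v s IH]; first by rewrite /winv/= wexp_nil mul1r.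
rewrite wexp_cons /winv/= rev_cons -cats1 wexp_cat wexp1 mulrA -[_ * _ * wexp _]mulrA.
by rewrite IH mulr1 texp1VN.
Qed.

Lemma wexpVK s : wexp (winv s) * wexp s = 1.
Proof. by rewrite -[X in _ * wexp X]winvK wexpK. Qed.

Lemma wexp_unit s : wexp s \is a GRing.unit.
Proof. by apply/unitrP; exists (wexp (winv s)); rewrite wexpK wexpVK. Qed.

Lemma tcoef_wexp_nil s : tcoef (wexp s) [::] = 1.
Proof.
elim: s => [|v s IH]; first by rewrite wexp_nil tcoef_one.
by rewrite wexp_cons tcoef_mul_nil IH tcoef_texp1_nil mul1r.
Qed.

Lemma tcoef_wexp_letter s i : (0 < N)%N ->
  tcoef (wexp s) [:: i] = \sum_(v <- s) v 0 i.
Proof.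
move=> N0; elim: s => [|v s IH]; first by rewrite wexp_nil tcoef_one big_nil.
rewrite wexp_cons tcoef_mul// !big_ord_recl big_ord0/= addr0 IH tcoef_texp1_nil mul1r tcoef_wexp_nil mulr1 big_cons addrC.
by rewrite tcoef_texp1// big_seq1 divr1.
Qed.

(** The length of the polygonal path with increments [s], in the l1 norm: it
    dominates the Euclidean length and bounds the coefficients directly. *)
Definition wlen s : K := \sum_(v <- s) \sum_i `|v 0 i|.

Lemma wlen_nil : wlen [::] = 0. Proof. exact: big_nil. Qed.

Lemma wlen_cat s1 s2 : wlen (s1 ++ s2) = wlen s1 + wlen s2.
Proof. exact: big_cat. Qed.

Lemma wlen_cons v s : wlen (v :: s) = \sum_i `|v 0 i| + wlen s.
Proof. exact: big_cons. Qed.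

Lemma wlen_inv s : wlen (winv s) = wlen s.
Proof.
rewrite /wlen (perm_big _ (permEl (perm_rev _)))/= big_map.
by apply: eq_bigr => v _; apply: eq_bigr => i _; rewrite mxE normrN.
Qed.

Lemma wlen_ge0 s : 0 <= wlen s.
Proof. by apply: sumr_ge0 => v _; apply: sumr_ge0. Qed.

(** Products add the lengths because the factorials turn the convolution of the
    bounds into a binomial expansion. *)
Lemma wexp_bound s w : `|tcoef (wexp s) w| <= wlen s ^+ size w / (size w)`!%:R.
Proof.
have [wN|wN] := leqP (size w) N; last first.
  by rewrite tcoef_gt// normr0 divr_ge0// exprn_ge0// wlen_ge0.
have fact_ge0 m : 0 <= (m`!%:R : K)^-1 by rewrite invr_ge0.
elim: s w wN => [|v s IH] w wN.
  rewrite wexp_nil tcoef_one wlen_nil expr0n.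
  by case: w {wN} => [|i w]/=; rewrite ?normr1 ?invr1 ?mulr1// normr0 mul0r.
rewrite wexp_cons tcoef_mul// wlen_cons -binomial_fact.
apply: le_trans (ler_norm_sum _ _ _) _; apply: ler_sum => -[k /=].
rewrite ltnS => kw _; rewrite normrM; apply: ler_pM => //.
  have tkw := size_takel kw.
  rewrite tcoef_texp1 ?tkw; last exact: leq_trans wN.
  rewrite normrM [X in _ * X]ger0_norm// ler_wpM2r//.
  rewrite normr_prod -[X in _ ^+ X]tkw; elim: (take k w) => [|i u IHu].
    by rewrite big_nil expr0.
  rewrite big_cons exprS ler_pM// ?prodr_ge0//.
  by rewrite (bigD1 i)//= lerDl sumr_ge0.
by rewrite -(size_drop k w) IH// size_drop (leq_trans (leq_subr _ _)).
Qed.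

Lemma wexp_bound' s w : `|tcoef (wexp s) w| <= wlen s ^+ size w.
Proof.
apply: le_trans (wexp_bound s w) _; rewrite ler_piMr ?exprn_ge0 ?wlen_ge0//.
by rewrite invf_le1 ?ltr0n ?fact_gt0// ler1n fact_gt0.
Qed.

End WordExponentials.

(** * Lie elements and logarithmic derivatives *)

Section LieElements.
Variables (K : realFieldType) (d N : nat).
Local Notation T := (tensor K d N).
Implicit Types (a b c x y : T) (w : seq 'I_d) (v : 'rV[K]_d) (s : seq 'rV[K]_d).

Lemma bracketC a b : bracket a b = - bracket b a.
Proof. by rewrite /bracket opprB. Qed.

Lemma bracketDr a b c : bracket a (b + c) = bracket a b + bracket a c.
Proof. by rewrite /bracket mulrDr mulrDl opprD addrACA. Qed.

Lemma bracketZr (t : K) a b : bracket a (t *: b) = t *: bracket a b.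
Proof. by rewrite /bracket -scalerAr -scalerAl scalerBr. Qed.

Lemma bracketZl (t : K) a b : bracket (t *: a) b = t *: bracket a b.
Proof. by rewrite /bracket -scalerAr -scalerAl scalerBr. Qed.

Lemma bracket0r a : bracket a 0 = 0.
Proof. by rewrite /bracket mulr0 mul0r subrr. Qed.

Lemma jacobi a b c :
  bracket (bracket a b) c = bracket a (bracket b c) - bracket b (bracket a c).
Proof.
apply: tensorP => w _; rewrite /bracket !(mulrBl, mulrBr) !mulrA.
by rewrite !tcoefB; ring.
Qed.

Definition lword1 (i : 'I_d) : T := level1 N (delta_mx 0 i).

(** These right-nested brackets already span the Lie algebra: bracketing with a
    letter lengthens the word, and the Jacobi identity does the rest. *)
Fixpoint lword w : T :=
  match w with
  | [::] => 0
  | [:: i] => lword1 i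
  | i :: w' => bracket (lword1 i) (lword w')
  end.

Lemma lword_cons i w : w != [::] -> lword (i :: w) = bracket (lword1 i) (lword w).
Proof. by case: w. Qed.

Lemma lev_lword k w : lev k (lword w) = if k == size w then lword w else 0.
Proof.
elim: w k => [|i [|j w] IH] k; first by rewrite lev0 if_same.
  apply: tensorP => u uN; rewrite tcoef_lev /= /lword1.
  case: (altP (k =P 1%N)) => [->|k1]; last first.
    case: eqP => [uk|_]; rewrite ?tcoef0// tcoef_level1//.
    by case: u uN uk => [|? [|? ?]]//= _ uk; rewrite -uk in k1.
  rewrite tcoef_level1//; case: eqP => //.
  by case: u uN => [|? [|? ?]].
rewrite lword_cons// bracketC -scaleN1r levZ.
case: k => [|k]; first by rewrite lev0_bracket_level1 scaler0.
rewrite lev_bracket_level1 IH eqSS; case: eqP => // _.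
by rewrite /bracket mul0r mulr0 subrr scaler0.
Qed.

Lemma vanish_lword w : vanish (size w) (lword w).
Proof.
move=> u uw; have := congr1 (fun a => tcoef a u) (lev_lword (size u) w).
by rewrite tcoef_lev eqxx ltn_eqF// tcoef0.
Qed.

Lemma lword_gt w : (N < size w)%N -> lword w = 0.
Proof. by move=> wN; exact: vanish_eq0 wN (@vanish_lword w). Qed.

Definition lie_tuple := [tuple of [seq lword w | w : N.-bseq 'I_d]].

Definition lie : {vspace T} := (<<lie_tuple>>)%VS.

Lemma lword_lie w : lword w \in lie.
Proof.
have [wN|/lword_gt ->] := leqP (size w) N; last exact: mem0v.
apply: memv_span; rewrite /= (_ : lword w = lword (Bseq wN))//.
by apply: map_f; rewrite mem_enum.
Qed.

Lemma lie_coord x : x \in lie ->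
  x = \sum_(w : N.-bseq 'I_d) coord lie_tuple (enum_rank w) x *: lword w.
Proof.
move=> /coord_span xE.
rewrite [RHS](reindex (@enum_val _ (pred_of_simpl predT))) /=; last first.
  by apply: onW_bij; exact: enum_val_bij.
rewrite [LHS]xE; apply: eq_bigr => i _.
by rewrite enum_valK nth_image.
Qed.

Lemma lie_ind (P : T -> Prop) : P 0 -> (forall a b, P a -> P b -> P (a + b)) ->
  (forall (t : K) w, P (t *: lword w)) -> forall x, x \in lie -> P x.
Proof.
move=> P0 PD PZ x /lie_coord ->; elim/big_rec: _ => // w y _ Py.
by apply: PD.
Qed.

Lemma level1_sum v : level1 N v = \sum_i v 0 i *: lword1 i.
Proof.
apply: tensorP => w wN; rewrite tcoef_level1// tcoef_sum.
case: w wN => [|i [|j w]] wN; last 2 first.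
- rewrite (bigD1 i)//= big1 => [|j ji].
    by rewrite tcoefZ tcoef_level1// mxE !eqxx mulr1 addr0.
  by rewrite tcoefZ tcoef_level1// mxE eqxx eq_sym (negbTE ji) mulr0.
- by rewrite big1// => k _; rewrite tcoefZ tcoef_level1// mulr0.
- by rewrite big1// => k _; rewrite tcoefZ tcoef_level1// mulr0.
Qed.

Lemma level1_lie v : level1 N v \in lie.
Proof.
rewrite level1_sum; apply: memv_suml => i _; apply: memvZ.
exact: (lword_lie [:: i]).
Qed.

Lemma bracket_lword1_lie i x : x \in lie -> bracket (lword1 i) x \in lie.
Proof.
move: x; apply: lie_ind => [|a b la lb|t w].
- by rewrite bracket0r mem0v.
- by rewrite bracketDr memvD.
rewrite bracketZr; apply: memvZ.
have [->|wn] := eqVneq w [::]; first by rewrite bracket0r mem0v.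
by rewrite -lword_cons// lword_lie.
Qed.

Lemma bracket_lie x y : x \in lie -> y \in lie -> bracket x y \in lie.
Proof.
move=> xl yl; rewrite bracketC -memvN opprK; move: x xl; apply: lie_ind.
- by rewrite bracket0r mem0v.
- by move=> a b la lb; rewrite bracketDr memvD.
move=> t w; rewrite bracketZr; apply: memvZ; rewrite bracketC memvN.
elim: w y yl => [|i w IH] y yl.
  by rewrite bracketC bracket0r oppr0 mem0v.
have [->|wn] := eqVneq w [::]; first exact: bracket_lword1_lie.
rewrite lword_cons// jacobi memvB//; first exact/bracket_lword1_lie/IH.
by apply: IH; apply: bracket_lword1_lie.
Qed.

Lemma bracket_level1_lie x v : x \in lie -> bracket x (level1 N v) \in lie.
Proof. by move=> xl; apply: bracket_lie => //; exact: level1_lie. Qed.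

Lemma lev_lie k x : x \in lie -> lev k x \in lie.
Proof.
move: x; apply: lie_ind => [|a b la lb|t w].
- by rewrite lev0 mem0v.
- by rewrite levD memvD.
rewrite levZ lev_lword; case: ifP => _; last by rewrite scaler0 mem0v.
by rewrite memvZ// lword_lie.
Qed.

Lemma deg_lie x : x \in lie -> deg x \in lie.
Proof.
move=> xl; rewrite -(levS (deg x)); apply: memv_suml => k _.
by rewrite lev_deg memvZ// lev_lie.
Qed.

Lemma lie_vanish1 x : x \in lie -> vanish 1 x.
Proof.
move: x; apply: lie_ind => [w _|a b la lb|t [|i w]].
- by rewrite tcoef0.
- exact: vanishD.
- by move=> u _; rewrite scaler0 tcoef0.
move=> u u1; rewrite tcoefZ vanish_lword ?mulr0//.
exact: leq_trans u1 _.
Qed.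

(** Conjugation by an exponential preserves the Lie elements.  For [x]
    homogeneous of degree k, the conjugate [M] satisfies
    [deg M = k M + bracket M v], so each component of [M] above level [k] is a
    multiple of the bracket of the previous one with [v]. *)
Lemma conj_texp1_lie v x : x \in lie -> texp1 N (- v) * x * texp1 N v \in lie.
Proof.
move: x; apply: lie_ind => [|a b la lb|t w].
- by rewrite mulr0 mul0r mem0v.
- by rewrite mulrDr mulrDl memvD.
rewrite -scalerAr -scalerAl memvZ//.
set M := _ * _ * _.
have degM : deg M = (size w)%:R *: M + bracket M (level1 N v).
  have degw : deg (lword w) = (size w)%:R *: lword w.
    by have := deg_lev (size w) (lword w); rewrite lev_lword eqxx.
  have lN : level1 N (- v) = - level1 N v :> T.
    rewrite !level1_sum -sumrN; apply: eq_bigr => i _.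
    by rewrite mxE scaleNr.
  rewrite /M !degM deg_texp1' deg_texp1 degw lN /bracket -scalerAr.
  rewrite !mulrDl !mulNr -scalerAl !mulrA.
  apply: tensorP => u _; rewrite !(tcoefD, tcoefN); ring.
have M_vanish : vanish (size w) M.
  by apply: vanishMr; apply: vanishMl; exact: vanish_lword.
have levw : lev (size w) M = lword w.
  have -> : lword w = lev (size w) (1 * lword w * 1).
    by rewrite mul1r mulr1 lev_lword eqxx.
  have vtexp u : vanish 1 (texp1 N u - 1).
    case=> // _; rewrite tcoefB tcoef_texp1_nil tcoef_one subrr//.
  apply/eqP; rewrite -subr_eq0 -levB; apply/eqP.
  apply: (@lev_vanish _ _ _ _ (size w).+1) => //.
  have -> : M - 1 * lword w * 1 =
     (texp1 N (- v) - 1) * lword w * texp1 N v + lword w * (texp1 N v - 1).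
    rewrite /M !mulrBl !mulrBr !mul1r !mulr1.
    by apply: tensorP => u _; rewrite !(tcoefD, tcoefN); ring.
  apply: vanishD.
    by apply: vanishMr; apply: (@vanishM _ _ _ 1) => //; exact: vanish_lword.
  by rewrite -addn1; apply: vanishM => //; exact: vanish_lword.
rewrite -(levS M); apply: memv_suml => -[j /= _] _.
elim: j => [|j IH].
  have [w0|w0] := eqVneq (size w) 0%N.
    by rewrite -w0 levw lword_lie.
  by rewrite (lev_vanish (n := size w))// ?mem0v// lt0n.
have [<-|jw] := eqVneq (size w) j.+1; first by rewrite levw lword_lie.
have := congr1 (lev j.+1) degM.
rewrite lev_deg levD levZ lev_bracket_level1 => /eqP.
rewrite addrC -subr_eq -scalerBl => /eqP ME.
have jw0 : (j.+1%:R - (size w)%:R : K) != 0.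
  by rewrite subr_eq0 eqr_nat eq_sym.
rewrite -[lev _ _]scale1r -(mulVf jw0) -scalerA ME.
by rewrite memvZ// bracket_level1_lie.
Qed.

(** The elements whose logarithmic derivative along the dilations is Lie.  They
    are the products of exponentials of vectors, by [chow], and they lie in the
    free nilpotent group, by [grp_free_group]; but this linear condition is
    easier to propagate through products and limits than either. *)
Definition grp a := tcoef a [::] = 1 /\ exists2 L, L \in lie & deg a = a * L.

Lemma grp1 : grp 1.
Proof.
split; first by rewrite tcoef_one.
by exists 0; rewrite ?mem0v// deg1 mulr0.
Qed.

Lemma grp_mul_wexp a s : grp a -> grp (a * wexp N s).
Proof.
elim: s a => [|v s IH] a; first by rewrite wexp_nil mulr1.
move=> [a1 [L Ll aL]]; rewrite wexp_cons mulrA; apply: IH; split.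
  by rewrite tcoef_mul_nil a1 tcoef_texp1_nil mulr1.
exists (texp1 N (- v) * L * texp1 N v + level1 N v).
  by rewrite memvD ?level1_lie ?conj_texp1_lie.
rewrite degM aL deg_texp1 mulrDr; congr (_ + _); last by rewrite mulrA.
by rewrite !mulrA -[a * texp1 N v * _]mulrA texp1VN mulr1.
Qed.

Lemma grp_wexp s : grp (wexp N s).
Proof. by rewrite -[wexp N s]mul1r; apply/grp_mul_wexp/grp1. Qed.

(** If two group elements agree up to level [n], comparing their logarithmic
    derivatives shows that they differ by a Lie element at level [n + 1]. *)
Lemma eqlev_logderiv n a b L M : deg a = a * L -> deg b = b * M ->
  tcoef a [::] = 1 -> tcoef b [::] = 1 ->
  eqlev n a b -> eqlev n L M.
Proof.
move=> aL bM a1 b1 ab w; have [m] := ubnP (size w).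
elim: m w => // m IH w; rewrite ltnS => wm wn.
have [wN|wN] := leqP (size w) N; last by rewrite !tcoef_gt.
have := congr1 (fun x => tcoef x w) aL.
have := congr1 (fun x => tcoef x w) bM.
rewrite !tcoef_deg !tcoef_mul// !big_ord_recl !take0 !drop0 a1 b1 !mul1r ab//.
move=> -> /eqP; rewrite -subr_eq0 opprD addrACA.
set S1 := \sum_(i < size w) _; set S2 := \sum_(i < size w) _.
suff -> : S1 = S2 by rewrite subrr addr0 subr_eq0 => /eqP.
apply: eq_bigr => i _; rewrite /= /bump add1n ab; last first.
  by rewrite size_takel//; apply: leq_trans wn.
by rewrite IH// ?size_drop; have := ltn_ord i; lia.
Qed.

Lemma lev_logderiv n a b L M : deg a = a * L -> deg b = b * M ->
  L \in lie -> M \in lie ->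
  tcoef a [::] = 1 -> tcoef b [::] = 1 ->
  eqlev n a b -> lev n.+1 (a - b) \in lie.
Proof.
move=> aL bM Ll Ml a1 b1 ab; have LM := eqlev_logderiv aL bM a1 b1 ab.
have n0 : (n.+1%:R : K) != 0 by rewrite pnatr_eq0.
rewrite -[lev _ _]scale1r -(mulVf n0) -scalerA memvZ//.
rewrite -lev_deg -scaleN1r degD degZ scaleN1r aL bM.
suff -> : lev n.+1 (a * L - b * M) = lev n.+1 L - lev n.+1 M.
  by rewrite memvB// lev_lie.
rewrite -levB; apply/eqP; rewrite -subr_eq0 -levB.
have -> : a * L - b * M - (L - M) = (a - b) * L + (b - 1) * (L - M).
  by rewrite !mulrBl !mulrBr !mul1r; apply: tensorP => u _;
     rewrite !(tcoefD, tcoefN); ring.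
apply/eqP/(@lev_vanish _ _ _ _ n.+2) => //; apply: vanishD.
  rewrite -addn1; apply: vanishM; last exact: lie_vanish1.
  exact/eqlevP.
apply: (@vanishM _ _ _ 1 n.+1); last exact/eqlevP.
by case=> // _; rewrite tcoefB b1 tcoef_one subrr.
Qed.

Lemma grp_lev n a b : grp a -> grp b -> eqlev n a b -> lev n.+1 (a - b) \in lie.
Proof.
by move=> [a1 [L Ll aL]] [b1 [M Ml bM]]; exact: lev_logderiv aL bM Ll Ml a1 b1.
Qed.

End LieElements.

(** * Chow's theorem with homogeneous bounds *)

Section Chow.
Variables (K : realFieldType) (d N : nat).
Local Notation T := (tensor K d N).
Implicit Types (a b c x : T) (w : seq 'I_d) (v : 'rV[K]_d) (s : seq 'rV[K]_d).

Lemma eqlev_texp1 v : eqlev 1 (texp1 N v) (1 + level1 N v).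
Proof.
move=> w w1; rewrite tcoefD tcoef_one.
have [wN|wN] := leqP (size w) N; last first.
  by rewrite !tcoef_gt// addr0; case: w w1 wN.
rewrite tcoef_level1// tcoef_texp1//.
case: w w1 wN => [|i [|j w]]//= _ _; first by rewrite big_nil divr1 addr0.
by rewrite big_seq1 divr1 add0r.
Qed.

Lemma vanish_one_nil a : tcoef a [::] = 1 -> vanish 1 (a - 1).
Proof. by move=> a1 [|//] _; rewrite tcoefB a1 tcoef_one subrr. Qed.

Lemma vanish_wexp s : vanish 1 (wexp N s - 1).
Proof. by apply: vanish_one_nil; rewrite tcoef_wexp_nil. Qed.

Lemma vanishZ n (t : K) a : vanish n a -> vanish n (t *: a).
Proof. by move=> va w wn; rewrite tcoefZ va// mulr0. Qed.

(** The group commutator of two exponentials starts with the Lie bracket of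
    their leading terms. *)
Lemma eqlev_commutator n s1 s2 a b : vanish 1 a -> vanish n b ->
  eqlev 1 (wexp N s1) (1 + a) -> eqlev n (wexp N s2) (1 + b) ->
  eqlev n.+1 (wexp N (s1 ++ s2 ++ winv s1 ++ winv s2)) (1 + bracket a b).
Proof.
move=> va vb /eqlevP eA /eqlevP eB; rewrite !wexp_cat.
set A := wexp N s1 in eA *; set B := wexp N s2 in eB *.
set A' := wexp N (winv s1); set B' := wexp N (winv s2).
have AA : A * A' = 1 by exact: wexpK.
have BB : B * B' = 1 by exact: wexpK.
apply/eqlevP.
have -> : A * (B * (A' * B')) - (1 + bracket a b) =
  ((A - (1 + a)) * (B - 1) + a * (B - (1 + b)) -
   ((B - (1 + b)) * (A - 1) + b * (A - (1 + a)))) * (A' * B')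
  + bracket a b * (A' * B' - 1).
  have -> : (A - (1 + a)) * (B - 1) + a * (B - (1 + b)) -
    ((B - (1 + b)) * (A - 1) + b * (A - (1 + a))) = A * B - B * A - bracket a b.
    rewrite /bracket !(mulrBl, mulrBr, mulrDl, mulrDr) !mulr1 !mul1r.
    by apply: tensorP => w _; rewrite !(tcoefD, tcoefN); ring.
  rewrite /bracket !(mulrBl, mulrBr) !mulr1.
  rewrite -[B * A * _]mulrA (mulrA A A') AA mul1r BB -[A * B * _]mulrA.
  by apply: tensorP => w _; rewrite !(tcoefD, tcoefN); ring.
have vB : vanish n (B - 1).
  have -> : B - 1 = (B - (1 + b)) + b by rewrite opprD addrA addrNK.
  apply: vanishD => //.
  exact: vanishW eB.
have vA : vanish 1 (A - 1) by exact: vanish_wexp.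
apply: vanishD.
  apply: vanishMr; apply: vanishD; last apply: vanishN; apply: vanishD.
  - by apply: (@vanishM _ _ _ 2).
  - by apply: (@vanishM _ _ _ 1).
  - by rewrite -addn1; apply: vanishM.
  - by rewrite -addn2; apply: vanishM.
rewrite -addn1; apply: vanishM.
  apply: vanishD; first by apply: (@vanishM _ _ _ 1).
  by apply: vanishN; rewrite -addn1; apply: vanishM.
have -> : A' * B' = wexp N (winv s1 ++ winv s2) by rewrite wexp_cat.
exact: vanish_wexp.
Qed.

Lemma sum_delta (i : 'I_d) : \sum_j `|(delta_mx 0 i : 'rV[K]_d) 0 j| = 1.
Proof.
rewrite (bigD1 i)//= big1 ?mxE ?eqxx ?normr1 ?addr0// => j ji.
by rewrite mxE eqxx (negbTE ji) normr0.
Qed.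

Lemma wlen_letter (t : K) i : wlen [:: t *: delta_mx 0 i : 'rV[K]_d] = `|t|.
Proof.
rewrite wlen_cons wlen_nil addr0.
under eq_bigr do rewrite mxE normrM.
by rewrite -mulr_sumr sum_delta mulr1.
Qed.

(** Nested group commutators realize nested Lie brackets up to higher levels, at
    a cost in length homogeneous to the size of the bracket. *)
Lemma commutator_word w : w != [::] -> exists2 C : K, 0 <= C &
  forall (t r : K), 0 < r -> `|t| <= r ^+ size w ->
  exists2 s, wlen s <= C * r & eqlev (size w) (wexp N s) (1 + t *: lword K N w).
Proof.
elim: w => [//|i w IH] _.
have level1Z (t : K) u : level1 N (t *: u) = t *: level1 N u.
  apply: tensorP => z zN; rewrite tcoefZ !tcoef_level1//.
  by case: z zN => [|j [|]]; rewrite ?mulr0// mxE.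
have [->|wn] := eqVneq w [::].
  exists 1 => // t r r0 tr; exists [:: t *: delta_mx 0 i].
    by rewrite wlen_letter mul1r; move: tr; rewrite expr1.
  by rewrite wexp1 /= -level1Z; exact: eqlev_texp1.
have [C C0 HC] := IH wn; exists (2 * (1 + C)) => [|t r r0 tr].
  by rewrite mulr_ge0// addr_ge0.
have rw0 : 0 < r ^+ size w by rewrite exprn_gt0.
have [|s sC se] := HC (r ^+ size w) r r0; first by rewrite ger0_norm// ltW.
(* The first letter carries what is left of [t] once the others have size [r]. *)
pose s1 : seq 'rV[K]_d := [:: (t / r ^+ size w) *: delta_mx 0 i].
have s1r : wlen s1 <= r.
  rewrite wlen_letter normrM normfV (ger0_norm (ltW rw0)).
  by rewrite ler_pdivrMr// -exprS.
exists (s1 ++ s ++ winv s1 ++ winv s).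
  by rewrite !wlen_cat !wlen_inv; lra.
rewrite lword_cons//.
have -> : t *: bracket (lword1 K N i) (lword K N w) =
    bracket ((t / r ^+ size w) *: lword1 K N i) (r ^+ size w *: lword K N w).
  by rewrite bracketZl bracketZr scalerA divfK// gt_eqF.
apply: eqlev_commutator => //.
- by apply: vanishZ; exact: vanish_level1.
- by apply: vanishZ; exact: vanish_lword.
- by rewrite wexp1 /lword1 -level1Z; exact: eqlev_texp1.
Qed.

Lemma eqlev_mul_leading k a b x y : (0 < k)%N -> vanish k x -> vanish k y ->
  eqlev k a (1 + x) -> eqlev k b (1 + y) -> eqlev k (a * b) (1 + (x + y)).
Proof.
move=> k0 vx vy ax bx; apply: (eqlev_trans (eqlevM ax bx)); apply/eqlevP.
have -> : (1 + x) * (1 + y) - (1 + (x + y)) = x * y.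
  rewrite mulrDl !mulrDr !mul1r mulr1.
  by apply: tensorP => w _; rewrite !(tcoefD, tcoefN); ring.
by apply: (vanishW _ (vanishM vx vy)); rewrite -addn1 leq_add2l.
Qed.

Lemma commutator_sum k (l : seq (N.-bseq 'I_d)) : (0 < k)%N ->
  exists2 C : K, 0 <= C & forall (t : N.-bseq 'I_d -> K) (r : K), 0 < r ->
  (forall w : N.-bseq 'I_d, `|t w| <= r ^+ k) ->
  exists2 s, wlen s <= C * r &
    eqlev k (wexp N s) (1 + \sum_(w <- l | size w == k) t w *: lword K N w).
Proof.
move=> k0; elim: l => [|w l [C C0 HC]].
  exists 0 => // t r r0 _; exists [::]; first by rewrite wlen_nil mul0r.
  by rewrite wexp_nil big_nil addr0.
have [wk|wk] := eqVneq (size w) k; last first.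
  exists C => // t r r0 tr; rewrite big_cons (negbTE wk); exact: HC.
have wn : (w : seq _) != [::] by rewrite -size_eq0 wk -lt0n.
have [C' C'0] := commutator_word wn; rewrite wk => HC'.
exists (C' + C) => [|t r r0 tr]; first exact: addr_ge0.
have [s' s'C' s'e] := HC' (t w) r r0 (tr w).
have [s sC se] := HC t r r0 tr.
exists (s' ++ s); first by rewrite wlen_cat mulrDl lerD.
rewrite wexp_cat big_cons wk eqxx; apply: eqlev_mul_leading => //.
- by apply: vanishZ; rewrite -wk; exact: vanish_lword.
- elim/big_ind: _ => //; first by move=> u _; rewrite tcoef0.
    by move=> a b va vb; exact: vanishD.
  by move=> u /eqP <-; apply: vanishZ; exact: vanish_lword.
Qed.

Definition tdelta (w : N.-bseq 'I_d) : T := [ffun u => (u == w)%:R : K].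

Lemma tdelta_sum x : x = \sum_(w : N.-bseq 'I_d) tcoef x w *: tdelta w.
Proof.
apply: tensorP => u uN; rewrite tcoef_sum (bigD1 (Bseq uN))//= big1 => [|w wu].
  by rewrite tcoefZ tcoef_le eqxx mulr1 addr0.
by rewrite tcoefZ tcoef_le eq_sym (negbTE wu) mulr0.
Qed.

(** The coordinates along the spanning family of brackets are linear, hence
    bounded: this is what makes the constants below uniform. *)
Lemma lie_coord_bound : exists2 C : K, 1 <= C & forall x (M : K), x \in lie K d N ->
  0 <= M -> (forall w, `|tcoef x w| <= M) ->
  exists2 t : N.-bseq 'I_d -> K, x = \sum_(w : N.-bseq 'I_d) t w *: lword K N w &
    forall w : N.-bseq 'I_d, `|t w| <= C * M.
Proof.
pose f (u : N.-bseq 'I_d) x := coord (lie_tuple K d N) (enum_rank u) x.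
exists (1 + \sum_u \sum_w `|f u (tdelta w)|).
  by rewrite lerDl sumr_ge0// => u _; rewrite sumr_ge0.
move=> x M xl M0 xM; exists (f ^~ x); first exact: lie_coord.
move=> u; rewrite [x in f _ x]tdelta_sum /f linear_sum/=.
apply: (le_trans (ler_norm_sum _ _ _)).
apply: (@le_trans _ _ (\sum_w `|f u (tdelta w)| * M)).
  by apply: ler_sum => w _; rewrite linearZ/= normrM mulrC ler_wpM2l.
rewrite -mulr_suml ler_wpM2r//.
apply: (@le_trans _ _ (\sum_u \sum_w `|f u (tdelta w)|)); last by rewrite lerDr.
by rewrite [leRHS](bigD1 u)//= lerDl sumr_ge0// => v _; rewrite sumr_ge0.
Qed.

Lemma commutator_lie k : (0 < k)%N -> exists2 C : K, 0 <= C &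
  forall x (r : K), x \in lie K d N -> 0 < r -> lev k x = x ->
  (forall w, `|tcoef x w| <= r ^+ k) ->
  exists2 s, wlen s <= C * r & eqlev k (wexp N s) (1 + x).
Proof.
move=> k0; have [C C1 HC] := lie_coord_bound.
have C0 : 0 < C by rewrite (lt_le_trans ltr01).
have [C' C'0 HC'] := commutator_sum (index_enum _) k0.
exists (C' * C) => [|x r xl r0 xk xr]; first by rewrite mulr_ge0// ltW.
have [|t xE tC] := HC x (r ^+ k) xl _ xr; first by rewrite exprn_ge0// ltW.
have -> : x = \sum_(w : N.-bseq 'I_d | size w == k) t w *: lword K N w.
  rewrite -xk [in LHS]xE lev_sum [RHS]big_mkcond/=; apply: eq_bigr => w _.
  by rewrite levZ lev_lword eq_sym; case: ifP; rewrite ?scaler0.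
rewrite -mulrA; apply: HC'; first exact: mulr_gt0.
move=> w; apply: (le_trans (tC w)); rewrite exprMn.
by apply: ler_wpM2r; [rewrite exprn_ge0// ltW|rewrite ler_eXnr].
Qed.

(** For [0 < r] this bounds the image of [a] under the dilation by [r^-1], which
    is the natural notion of size when [r] is a length. *)
Definition hbound (C r : K) a := forall w, `|tcoef a w| <= C * r ^+ size w.

Lemma hboundM (C D r : K) a b : 0 <= C -> 0 <= D -> 0 <= r ->
  hbound C r a -> hbound D r b -> hbound (N.+1%:R * (C * D)) r (a * b).
Proof.
move=> C0 D0 r0 aC bD w.
have [wN|wN] := leqP (size w) N; last first.
  by rewrite tcoef_gt// normr0 !mulr_ge0// exprn_ge0.
rewrite tcoef_mul//; apply: (le_trans (ler_norm_sum _ _ _)).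
apply: (@le_trans _ _ (\sum_(k < (size w).+1) C * D * r ^+ size w)).
  apply: ler_sum => -[k /=]; rewrite ltnS => kw _.
  rewrite normrM; apply: (le_trans (ler_pM _ _ (aC _) (bD _))) => //.
  rewrite size_takel// size_drop -[in leRHS](subnKC kw) exprD.
  by rewrite le_eqVlt; apply/orP; left; apply/eqP; ring.
rewrite sumr_const card_ord -[leLHS]mulr_natl -[leRHS]mulrA; apply: ler_wpM2r.
  by rewrite !mulr_ge0// exprn_ge0.
by rewrite ler_nat.
Qed.

Lemma hbound_wexp s (C r : K) : 1 <= C -> 0 <= r -> wlen s <= C * r ->
  hbound (C ^+ N) r (wexp N s).
Proof.
move=> C1 r0 sC w; have C0 : 0 <= C by rewrite (le_trans ler01).
have [wN|wN] := leqP (size w) N; last first.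
  by rewrite tcoef_gt// normr0 !mulr_ge0// exprn_ge0.
apply: (le_trans (wexp_bound' _ _ _)).
apply: (@le_trans _ _ ((C * r) ^+ size w)).
  by rewrite lerXn2r// nnegrE ?wlen_ge0// mulr_ge0.
rewrite exprMn ler_wpM2r ?exprn_ge0//.
by rewrite ler_weXn2l.
Qed.

(** By induction on the number of levels left: the first nontrivial level of the
    element is Lie by [grp_lev], and a product of exponentials realizing it can
    be divided off on the right without leaving [grp]. *)
Lemma chow_aux n (C : K) : (n <= N)%N -> 0 <= C -> exists2 C' : K, 0 <= C' &
  forall a r, 0 < r -> grp a -> eqlev (N - n) a 1 -> hbound C r a ->
  exists2 s, wexp N s = a & wlen s <= C' * r.
Proof.
elim: n C => [|n IH] C nN C0.
  exists 0 => // a r r0 _; rewrite subn0 => /eqlev_eq -> _.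
  by exists [::]; rewrite ?wexp_nil// wlen_nil mul0r.
have k0 : (0 < N - n)%N by lia.
have [C1 C10 HC1] := commutator_lie k0.
pose D := 1 + C1 * (1 + C).
have D1 : 1 <= D by rewrite lerDl mulr_ge0// addr_ge0.
have D0 : 0 <= D by rewrite (le_trans ler01).
have [||C2 C20 HC2] := IH (N.+1%:R * (C * D ^+ N)).
- exact: ltnW.
- by rewrite !mulr_ge0// exprn_ge0.
exists (C2 + D) => [|a r r0 aG a1 ar]; first by rewrite addr_ge0.
pose x := lev (N - n) (a - 1).
have Nn : (N - n = (N - n.+1).+1)%N by lia.
have xl : x \in lie K d N by rewrite /x Nn; apply: grp_lev => //; exact: grp1.
have [||w|s sC se] := HC1 x ((1 + C) * r) xl.
- by rewrite mulr_gt0// (lt_le_trans ltr01)// lerDl.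
- by rewrite /x lev_lev eqxx.
- rewrite /x tcoef_lev; case: eqP => [wk|_]; last first.
    by rewrite normr0 exprn_ge0// mulr_ge0 ?addr_ge0// ltW.
  rewrite tcoefB tcoef_one; have -> : nilp w = false.
    by apply/negbTE; rewrite /nilp -lt0n wk.
  rewrite subr0; apply: (le_trans (ar w)); rewrite wk exprMn.
  rewrite ler_wpM2r ?exprn_ge0 ?(ltW r0)//.
  apply: (@le_trans _ _ (1 + C)); first by rewrite lerDr.
  by rewrite ler_eXnr// lerDl.
have sD : wlen s <= D * r.
  by apply: (le_trans sC); rewrite mulrA ler_wpM2r ?(ltW r0)// lerDr.
have [||s' s'E s'C] := HC2 (a * wexp N (winv s)) r r0 (grp_mul_wexp _ aG).
- have -> : 1 = wexp N s * wexp N (winv s) by rewrite wexpK.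
  apply: eqlevM => //; apply: (eqlev_trans _ (eqlev_sym se)).
  move=> w wn; rewrite tcoefD /x tcoef_lev; case: eqP => wk.
    by rewrite tcoefB addrCA subrr addr0.
  by rewrite addr0; apply: a1; lia.
- apply: hboundM (ltW r0) ar _; rewrite ?exprn_ge0//.
  by apply: hbound_wexp (ltW r0) _; rewrite ?wlen_inv.
exists (s' ++ s); first by rewrite wexp_cat s'E -mulrA wexpVK mulr1.
by rewrite wlen_cat mulrDl lerD.
Qed.

(** Every group element is a product of exponentials of vectors, of total
    length comparable to its homogeneous size. *)
Lemma chow (C : K) : 0 <= C -> exists2 C' : K, 0 <= C' &
  forall a r, 0 < r -> grp a -> hbound C r a ->
  exists2 s, wexp N s = a & wlen s <= C' * r.
Proof.
move=> C0; have [C' C'0 HC'] := chow_aux (leqnn N) C0.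
exists C' => // a r r0 aG aC; apply: HC' => //.
by rewrite subnn => -[|//] _; rewrite tcoef_one; case: aG.
Qed.

Lemma grp_wexpP a : grp a -> exists s, wexp N s = a.
Proof.
move=> aG.
have C0 : 0 <= \sum_(w : N.-bseq 'I_d) `|tcoef a w| by rewrite sumr_ge0.
have [C' _ HC'] := chow C0.
have [|s sE _] := HC' a 1 ltr01 aG; last by exists s.
move=> w; rewrite expr1n mulr1.
have [wN|wN] := leqP (size w) N; last by rewrite tcoef_gt// normr0.
by rewrite (bigD1 (Bseq wN))//= lerDl sumr_ge0.
Qed.

End Chow.

(** * Logarithms of group elements *)

Section FreeGroup.
Variables (K : realFieldType) (d N : nat).
Local Notation T := (tensor K d N).
Implicit Types (a b c x z : T) (w : seq 'I_d) (v : 'rV[K]_d) (s : seq 'rV[K]_d).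

Lemma linear_span_comb (A : set T) (I : Type) (r : seq I) (P : pred I)
    (t : I -> K) (F : I -> T) :
  (forall i, P i -> A (F i)) ->
  linear_span A (\sum_(i <- r | P i) t i *: F i).
Proof.
move=> AF; exists [seq F i | i <- r & P i].
  elim: r => [//|i r IH] y /=; case: ifPn => Pi; last exact: IH.
  by rewrite inE => /orP[/eqP ->|/IH//]; exact: AF.
elim: r => [|i r IH]; first by rewrite big_nil mem0v.
rewrite big_cons /=; case: ifPn => [Pi|Pi]//=.
by rewrite span_cons memv_add// memvZ// memv_line.
Qed.

Lemma lword_lieW w k : size w = k.+1 -> lieW k (lword K N w).
Proof.
elim: k w => [|k IH] [|i w]//= [wk].
  by case: w wk => // _; exists (delta_mx 0 i).
have wn : w != [::] by rewrite -size_eq0 wk.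
have := @linear_span_comb [set y | exists (p : 'rV[K]_d) u, lieW k u /\ y = bracket (level1 N p) u]%classic
  unit [:: tt] xpredT (fun=> 1) (fun=> lword K N (i :: w)).
rewrite big_seq1 scale1r; apply => _ _.
by exists (delta_mx 0 i), (lword K N w); split; [exact: IH|rewrite lword_cons].
Qed.

Lemma lev_lieW k x : x \in lie K d N -> lieW k (lev k.+1 x).
Proof.
case: k => [|k] xl.
  exists (pi1 x) => //; apply: tensorP => w wN.
  rewrite tcoef_level1// tcoef_lev; case: w wN => [|i [|j w]]//= _.
  by rewrite mxE.
have -> : lev k.+2 x = \sum_(w : N.-bseq 'I_d | size w == k.+2)
    coord (lie_tuple K d N) (enum_rank w) x *: lword K N w.
  rewrite [in LHS](lie_coord xl) lev_sum [RHS]big_mkcond; apply: eq_bigr => w _.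
  by rewrite levZ lev_lword eq_sym; case: ifP; rewrite ?scaler0.
apply: linear_span_comb => -[[|i w] wN] //= /eqP[wk].
exists (delta_mx 0 i), (lword K N w); split; first exact: lword_lieW.
have wn : w != [::] by rewrite -size_eq0 wk.
exact: (lword_cons _ _ _ wn).
Qed.

Lemma lie_free_lie x : x \in lie K d N -> free_lie K d N x.
Proof.
move=> xl; exists (fun i : 'I_N => lev i.+1 x).
  by move=> i; exact: lev_lieW.
rewrite -[LHS]levS big_ord_recl (lev_vanish (n := 1))//; last exact: lie_vanish1 xl.
by rewrite add0r.
Qed.

Definition ad z i x := iter i (bracket z) x.

Lemma ad_lie z i x : z \in lie K d N -> x \in lie K d N -> ad z i x \in lie K d N.
Proof. by move=> zl xl; elim: i => // i IH; exact: bracket_lie. Qed.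

Lemma vanish_ad z i x : vanish 1 z -> vanish 1 x -> vanish i.+1 (ad z i x).
Proof.
move=> vz vx; elim: i => // i IH; apply: vanishD; last apply: vanishN.
  by apply: (@vanishM _ _ _ 1).
by rewrite -addn1; apply: vanishM.
Qed.

(** Moving [deg z] to the right past the powers of [z] costs iterated brackets
    with binomial coefficients, which Pascal's rule adds up. *)
Lemma deg_exp z m : deg (z ^+ m) = \sum_(i < m)
  ((-1) ^+ i * 'C(m, i.+1)%:R) *: (z ^+ (m.-1 - i) * ad z i (deg z)).
Proof.
elim: m => [|m IH]; first by rewrite deg1 big_ord0.
have adz i : ad z i (deg z) * z = z * ad z i (deg z) - ad z i.+1 (deg z).
  by rewrite /= /bracket opprB addrCA subrr addr0.
rewrite exprSr degM IH mulr_suml.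
transitivity (\sum_(i < m.+1) ((-1) ^+ i * 'C(m, i.+1)%:R) *:
      (z ^+ (m - i) * ad z i (deg z)) +
    \sum_(i < m.+1) ((-1) ^+ i * 'C(m, i)%:R) *: (z ^+ (m - i) * ad z i (deg z))).
  rewrite [in X in _ = X + _]big_ord_recr/= bin_small// mulr0 scale0r addr0.
  rewrite [in X in _ = _ + X]big_ord_recl/= bin0 mulr1 scale1r subn0.
  rewrite addrCA addrC -big_split/=; congr (_ + _).
  apply: eq_bigr => -[i /= im] _; rewrite -scalerAl -mulrA adz mulrBr scalerBr.
  congr (_ + _).
    by rewrite mulrA -exprSr; congr (_ *: (_ ^+ _ * _)); lia.
  rewrite -scaleNr exprS mulN1r mulNr; congr (_ *: (_ ^+ _ * _)).
  by rewrite /bump; lia.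
rewrite -big_split; apply: eq_bigr => i _ /=.
by rewrite -scalerDl -mulrDr -natrD -binS.
Qed.

(** The derivation formula for exponentials,
    [deg (exp z) = exp z * ((1 - exp (- ad z)) / ad z) (deg z)]. *)
Lemma deg_texp z : vanish 1 z -> deg (texp z) =
  texp z * \sum_(i < N.+1) ((-1) ^+ i / (i.+1)`!%:R) *: ad z i (deg z).
Proof.
move=> vz; have vdz : vanish 1 (deg z).
  by case=> // _; rewrite tcoef_deg mul0r.
have vzn n : vanish n (z ^+ n).
  elim: n => [w|n IH]; first by rewrite ltn0.
  by rewrite exprS; apply: (@vanishM _ _ _ 1).
pose F j i : T := ((-1) ^+ i / (j`!%:R * (i.+1)`!%:R)) *: (z ^+ j * ad z i (deg z)).
have fact_neq0 m : (m`!%:R : K) != 0 by rewrite pnatr_eq0 -lt0n fact_gt0.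
transitivity (\sum_(m < N.+1) \sum_(i < m) F (m.-1 - i)%N i).
  rewrite /texp.
  have -> : deg (\sum_(k < N.+1) k`!%:R^-1 *: z ^+ k) =
      \sum_(k < N.+1) k`!%:R^-1 *: deg (z ^+ k).
    elim/big_rec2: _ => [|i y1 y2 _ <-]; last by rewrite degD degZ.
    by apply: tensorP => w _; rewrite tcoef_deg !tcoef0 mulr0.
  apply: eq_bigr => -[m /= mN] _; rewrite deg_exp scaler_sumr.
  apply: eq_bigr => -[i /= im] _; rewrite scalerA /F; congr (_ *: _).
  have im1 : (i.+1 <= m)%N by [].
  have -> : (m.-1 - i = m - i.+1)%N by lia.
  have -> : m`!%:R = 'C(m, i.+1)%:R * ((i.+1)`!%:R * (m - i.+1)`!%:R) :> K.
    by rewrite -!natrM bin_fact.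
  have bin_neq0 : ('C(m, i.+1)%:R : K) != 0 by rewrite pnatr_eq0 -lt0n bin_gt0.
  move: (fact_neq0 i.+1) (fact_neq0 (m - i.+1)%N) bin_neq0.
  move: (i.+1`!%:R : K) ((m - i.+1)`!%:R : K) ('C(m, i.+1)%:R : K).
  by move=> A B C A0 B0 C0; field; rewrite A0 B0 C0.
(* The terms added to complete the square have level above [N]. *)
transitivity (\sum_(i < N.+1) \sum_(j < N.+1) F j i).
  transitivity (\sum_(m < N.+1) \sum_(i < N.+1 | (i < m)%N) F (m.-1 - i)%N i).
    apply: eq_bigr => -[m /= mN] _.
    by rewrite (big_ord_widen _ (fun i => F (m.-1 - i)%N i) (ltnW mN)).
  rewrite (exchange_big_dep xpredT)//=; apply: eq_bigr => -[i /= iN] _.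
  rewrite -(big_mkord (fun m => (i < m)%N) (fun m => F (m.-1 - i)%N i)).
  rewrite -(big_mkord xpredT (F ^~ i)).
  rewrite [RHS](big_cat_nat (n := (N - i)%N))//=; last by lia.
  rewrite [X in _ = _ + X]big_nat_cond [X in _ = _ + X]big1 ?addr0; last first.
    move=> j jN; rewrite /F.
    rewrite (_ : z ^+ j * _ = 0) ?scaler0//; apply: (@vanish_eq0 _ _ _ (j + i.+1)).
      by lia.
    by apply: vanishM => //; exact: vanish_ad.
  rewrite (big_cat_nat (n := i.+1))//=.
  rewrite [X in X + _ = _]big_nat_cond [X in X + _ = _]big1 ?add0r; last by move=> j; lia.
  rewrite -{1}[i.+1]add0n big_addn subSS big_nat_cond [RHS]big_nat_cond.
  apply: eq_big => [j|j _]; first by apply/idP/idP; lia.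
  by congr (F _ i); lia.
rewrite exchange_big /texp mulr_suml; apply: eq_bigr => j _ /=.
rewrite mulr_sumr; apply: eq_bigr => i _.
rewrite -scalerAl -scalerAr scalerA /F; congr (_ *: _).
move: (fact_neq0 i.+1) (fact_neq0 j).
move: (i.+1`!%:R : K) (j`!%:R : K) => A B A0 B0.
by field; rewrite A0 B0.
Qed.

Lemma vanish_exp n z : vanish 1 z -> vanish n (z ^+ n).
Proof.
move=> vz; elim: n => [w|n IH]; first by rewrite ltn0.
by rewrite exprS; apply: (@vanishM _ _ _ 1).
Qed.

Lemma eqlev_texpD n z u : (n < N)%N -> vanish 1 z -> vanish n.+1 u ->
  eqlev n.+1 (texp (z + u)) (texp z + u).
Proof.
move=> nN vz vu; apply/eqlevP.
have vzu k : vanish (n.+1 + k) ((z + u) ^+ k.+1 - z ^+ k.+1).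
  elim: k => [|k IH].
    by rewrite !expr1 addrC addKr addn0.
  rewrite exprS [z ^+ k.+2]exprS.
  have -> : (z + u) * (z + u) ^+ k.+1 - z * z ^+ k.+1 =
      (z + u) * ((z + u) ^+ k.+1 - z ^+ k.+1) + u * z ^+ k.+1.
    by rewrite mulrBr [(z + u) * z ^+ _]mulrDl opprD addrA addrNK.
  apply: vanishD.
    rewrite addnS -add1n; apply: vanishM => //; apply: vanishD => //.
    exact: vanishW vu.
  by apply: vanishM => //; exact: vanish_exp.
have uE : u = \sum_(k < N.+1) (if k == 1%N :> nat then u else 0).
  rewrite -big_mkcond (bigD1 (Ordinal (leq_ltn_trans (leq0n n) nN : 1 < N.+1)%N))//=.
  by rewrite big1 ?addr0// => k /andP[/eqP k1]; rewrite -val_eqE/= k1 eqxx.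
rewrite opprD addrA [X in _ - X]uE /texp -!sumrB.
elim/big_ind: _ => //; first by move=> w _; rewrite tcoef0.
  by move=> a b va vb; exact: vanishD.
move=> [[|[|k]] /= _] _; rewrite -scalerBr.
- by rewrite !expr0 subrr scaler0 subr0 => w _; rewrite tcoef0.
- by rewrite (_ : 1`! = 1)%N// invr1 scale1r [z + u]addrC addrK subrr => w _; rewrite tcoef0.
rewrite subr0; apply: vanishZ.
by apply: (vanishW _ (vzu _)); lia.
Qed.

(** The logarithm is found level by level: both [texp z] and [a] have a Lie
    logarithmic derivative, so that their first discrepancy is Lie. *)
Lemma grp_texp_aux n a : grp a ->
  exists2 z, z \in lie K d N & eqlev n (texp z) a.
Proof.
move=> [a1 [L Ll aL]]; elim: n => [|n [z zl za]].
  exists 0; first exact: mem0v.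
  case=> // _; rewrite a1 /texp big_ord_recl expr0 fact0 invr1 scale1r.
  rewrite big1 ?addr0 ?tcoef_one// => i _.
  by rewrite expr0n/= scaler0.
have [Nn|nN] := leqP N n.
  by exists z => //; rewrite (eqlev_eq (eqlevW Nn za)).
have vz := lie_vanish1 zl.
have z1 : tcoef (texp z) [::] = 1 by rewrite za.
pose u := lev n.+1 (a - texp z).
exists (z + u).
  rewrite memvD//; apply: lev_logderiv aL (deg_texp vz) Ll _ a1 z1 (eqlev_sym za).
  by apply: memv_suml => i _; rewrite memvZ// ad_lie// deg_lie.
apply: (eqlev_trans (eqlev_texpD nN vz (@vanish_lev _ _ _ n.+1 _))) => w wn.
rewrite tcoefD tcoef_lev; case: eqP => wk.
  by rewrite tcoefB addrCA subrr addr0.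
by rewrite addr0 za//; lia.
Qed.

Lemma grp_free_group a : grp a -> free_group K d N a.
Proof.
move=> /(grp_texp_aux N)[z zl za]; exists z; first exact: lie_free_lie.
exact: eqlev_eq.
Qed.

End FreeGroup.

(** * Limits of group elements *)

Section Limits.
Variables (R : realType) (d N : nat).
Local Notation T := (tensor R d N).
Implicit Types (w : seq 'I_d).

(** Convergence coefficient by coefficient, i.e. in the finite-dimensional
    algebra. *)
Definition tcvg (a : nat -> T) (b : T) :=
  forall w, (fun l => tcoef (a l) w : R) @ \oo --> (tcoef b w : R).

Lemma cvg_fsum (I : Type) (r : seq I) (F : I -> nat -> R) (G : I -> R) :
  (forall i, F i @ \oo --> G i) ->
  (fun l => \sum_(i <- r) F i l) @ \oo --> \sum_(i <- r) G i.
Proof.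
move=> FG; elim: r => [|i r IH].
  rewrite big_nil; under eq_fun do rewrite big_nil.
  exact: cvg_cst.
rewrite big_cons; under eq_fun do rewrite big_cons.
exact: cvgD.
Qed.

Lemma tcvgM a b a0 b0 : tcvg a a0 -> tcvg b b0 ->
  tcvg (fun l => a l * b l) (a0 * b0).
Proof.
move=> aa bb w; have [wN|wN] := leqP (size w) N; last first.
  rewrite tcoef_gt//; under eq_fun do rewrite tcoef_gt//.
  exact: cvg_cst.
rewrite tcoef_mul//; under eq_fun do rewrite tcoef_mul//.
by apply: cvg_fsum => i; apply: cvgM.
Qed.

Lemma tcvg_unique a b c : tcvg a b -> tcvg a c -> b = c.
Proof.
by move=> ab ac; apply: tensorP => w _; apply: (cvg_unique _ (ab w) (ac w)).
Qed.

(** Left division is continuous: the coefficients of the quotient are obtained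
    one after the other along the length of words. *)
Lemma tcvg_ldiv (a c e : nat -> T) a0 e0 :
  (forall l, tcoef (a l) [::] = 1) -> (forall l, a l * c l = e l) ->
  tcvg a a0 -> tcvg e e0 -> exists2 c0, tcvg c c0 & a0 * c0 = e0.
Proof.
move=> a1 ace aa ee.
have cc w : cvg ((fun l => tcoef (c l) w : R) @ \oo).
  have [n] := ubnP (size w); elim: n w => // n IH w; rewrite ltnS => wn.
  have [wN|wN] := leqP (size w) N; last first.
    under eq_fun do rewrite tcoef_gt//.
    exact: is_cvg_cst.
  have -> : (fun l => tcoef (c l) w : R) = (fun l => tcoef (e l) w -
     \sum_(i < size w) tcoef (a l) (take i.+1 w) * tcoef (c l) (drop i.+1 w)).
    apply/funext => l; rewrite -ace tcoef_mul// big_ord_recl take0 drop0 a1 mul1r.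
    by rewrite addrK.
  apply: is_cvgB; first by apply: (cvgP _ (ee w)).
  apply: (cvgP (\sum_(i < size w) tcoef a0 (take i.+1 w) *
    lim ((fun l => tcoef (c l) (drop i.+1 w)) @ \oo))).
  apply: cvg_fsum => i; apply: cvgM; first exact: aa.
  by apply: IH; rewrite size_drop; have := ltn_ord i; lia.
exists [ffun w : N.-bseq 'I_d => lim ((fun l => tcoef (c l) w) @ \oo) : R] => [w|].
  have [wN|wN] := leqP (size w) N; last first.
    rewrite tcoef_gt//; under eq_fun do rewrite tcoef_gt//.
    exact: cvg_cst.
  by rewrite tcoef_le; exact: cc.
set c0 := finfun _.
have c0E : tcvg c c0.
  move=> w; have [wN|wN] := leqP (size w) N; last first.
    rewrite tcoef_gt//; under eq_fun do rewrite tcoef_gt//.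
    exact: cvg_cst.
  by rewrite tcoef_le; exact: cc.
apply: (tcvg_unique (tcvgM aa c0E)).
by under [X in tcvg X]eq_fun do rewrite ace.
Qed.

Lemma lie_closed (x : nat -> T) x0 : (forall l, x l \in lie R d N) ->
  tcvg x x0 -> x0 \in lie R d N.
Proof.
move=> xl xx; pose f (u : N.-bseq 'I_d) (y : T) : R := coord (lie_tuple R d N) (enum_rank u) y.
have fx u : (fun l => f u (x l)) @ \oo --> f u x0.
  have fE y : f u y = \sum_(w : N.-bseq 'I_d) tcoef y w * f u (tdelta R w).
    rewrite {1}(tdelta_sum y) /f linear_sum/=; apply: eq_bigr => w _.
    by rewrite linearZ.
  under eq_fun do rewrite fE.
  by rewrite fE; apply: cvg_fsum => w; apply: cvgM; [exact: xx|exact: cvg_cst].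
suff -> : x0 = \sum_u f u x0 *: lword R N u.
  by apply: memv_suml => u _; rewrite memvZ// lword_lie.
apply: (tcvg_unique xx) => w.
under eq_fun => l do rewrite (lie_coord (xl l)) tcoef_sum.
rewrite tcoef_sum; apply: cvg_fsum => u.
under eq_fun => l do rewrite tcoefZ.
by rewrite tcoefZ; apply: cvgM; [exact: fx|exact: cvg_cst].
Qed.

(** The logarithmic derivative is a left quotient, hence passes to the limit, and
    the Lie elements form a closed subspace. *)
Lemma grp_closed (a : nat -> T) a0 : (forall l, grp (a l)) -> tcvg a a0 -> grp a0.
Proof.
move=> aG aa.
have /choice[L La] : forall l, exists L, L \in lie R d N /\ deg (a l) = a l * L.
  by move=> l; have [_ [L Ll aL]] := aG l; exists L.
have a1 l : tcoef (a l) [::] = 1 by have [] := aG l.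
have dd : tcvg (fun l => deg (a l)) (deg a0).
  move=> w; rewrite tcoef_deg; under eq_fun do rewrite tcoef_deg.
  by apply: cvgM; [exact: cvg_cst|exact: aa].
have aL l : a l * L l = deg (a l) by have [_ ->] := La l.
have [L0 LL0 aL0] := tcvg_ldiv a1 aL aa dd.
split; last first.
  by exists L0; rewrite ?aL0//; apply: (lie_closed _ LL0) => l; have [] := La l.
have a1' : (fun l => tcoef (a l) [::] : R) @ \oo --> (1 : R).
  by under eq_fun do rewrite a1; exact: cvg_cst.
exact: (cvg_unique _ (aa [::]) a1').
Qed.

End Limits.

(** * Riemann-Stieltjes integrals and Euclidean norms *)

Section RiemannStieltjes.
Variable R : realType.
Implicit Types (f g F : R -> R) (a b : R).

Lemma partition_sum_telescope F a b s : itv_partition a b s ->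
  \sum_(0 <= k < size s) (F (nth b (a :: s) k.+1) - F (nth b (a :: s) k)) = F b - F a.
Proof.
move=> [_ /eqP sb]; rewrite (telescope_sumr (fun k => F (nth b (a :: s) k)))//=.
by rewrite -[nth _ _ (size s)](last_nth b a s) sb.
Qed.

Lemma partition_le a b s k : itv_partition a b s -> (k < size s)%N ->
  [/\ a <= nth b (a :: s) k, nth b (a :: s) k <= nth b (a :: s) k.+1 &
      nth b (a :: s) k.+1 <= b].
Proof.
move=> abs ks; split.
- by apply: itv_partition_nth_ge (abs); exact: ltnW.
- have [/(pathP b) + _] := abs; by move=> /(_ k ks) /= /ltW.
- exact: itv_partition_nth_le.
Qed.

(** When the increments of [F] are those of the integral up to a quadratic error,
    the errors add up to a multiple of the mesh. *)
Lemma is_RS_integral_quadratic f g F a b (M : R) : 0 <= M ->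
  (forall x xi y, a <= x -> x <= xi -> xi <= y -> y <= b ->
    `|F y - F x - f xi * (g y - g x)| <= M * (y - x) ^+ 2) ->
  a <= b -> is_RS_integral f g a b (F b - F a).
Proof.
move=> M0 H ab e e0; exists (e / (M * (b - a) + 1)).
  by rewrite divr_gt0// ltr_wpDl// mulr_ge0// subr_ge0.
move=> s xi abs /= fine; set t := nth b (a :: s).
rewrite distrC -(partition_sum_telescope F abs) -/t -sumrB.
apply: (le_lt_trans (ler_norm_sum _ _ _)).
have [s0|s0] := posnP (size s); first by rewrite s0 big_geq.
set delta := e / _ in fine.
have d0 : 0 < delta by rewrite divr_gt0// ltr_wpDl// mulr_ge0// subr_ge0.
apply: (@le_lt_trans _ _ (\sum_(0 <= k < size s) M * delta * (t k.+1 - t k))).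
  apply: ler_sum_nat => k /andP[_ ks].
  have [at_ tt tb] := partition_le abs ks; have [td /andP[tx xt]] := fine k ks.
  apply: (le_trans (H _ (xi k) _ at_ tx xt tb)).
  rewrite -mulrA ler_wpM2l// expr2 ler_wpM2r ?subr_ge0//.
  exact: ltW.
rewrite -mulr_sumr (partition_sum_telescope id abs) mulrAC /delta.
rewrite mulrA ltr_pdivrMr ?ltr_wpDl ?mulr_ge0 ?subr_ge0//.
by rewrite [ltRHS]mulrDr mulr1 [X in _ < X + _]mulrC ltrDl.
Qed.

Lemma fine_partition a b (delta : R) : a <= b -> 0 < delta ->
  exists2 s, itv_partition a b s &
    forall k, (k < size s)%N -> nth b (a :: s) k.+1 - nth b (a :: s) k < delta.
Proof.
move=> ab d0; have [<-|neq_ab] := eqVneq a b.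
  by exists [::] => //; split => /=.
have ltab : a < b by rewrite lt_neqAle neq_ab.
pose n := Num.truncn ((b - a) / delta).
have n0 : 0 < n.+1%:R :> R by [].
pose u k := a + (b - a) * k%:R / n.+1%:R.
have uS k : u k.+1 - u k = (b - a) / n.+1%:R.
  by rewrite /u -natr1; field; rewrite (natr1, nat1r) pnatr_eq0.
have sE k : (k <= n.+1)%N -> nth b (a :: [seq u i.+1 | i <- iota 0 n.+1]) k = u k.
  case: k => [|k] kn; first by rewrite /= /u mulr0 mul0r addr0.
  by rewrite [LHS](nth_map 0%N) ?size_iota// nth_iota.
exists [seq u i.+1 | i <- iota 0 n.+1].
  split.
    apply/(pathP b) => k; rewrite size_map size_iota => kn.
    rewrite sE 1?ltnW// -[nth _ (map _ _) _]/(nth b (a :: map _ _) k.+1) sE//.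
    by rewrite -subr_gt0 uS divr_gt0// subr_gt0.
  rewrite (last_nth b) size_map size_iota sE// /u mulfK ?pnatr_eq0//.
  by apply/eqP; rewrite addrC subrK.
move=> k; rewrite size_map size_iota => kn.
rewrite !sE//; last exact: ltnW.
rewrite uS ltr_pdivrMr// mulrC -ltr_pdivrMr//.
exact: truncnS_gt.
Qed.

Lemma is_RS_integral_unique f g a b (I J : R) : a <= b ->
  is_RS_integral f g a b I -> is_RS_integral f g a b J -> I = J.
Proof.
move=> ab fI fJ; apply/eqP; rewrite -subr_eq0 -normr_eq0 eq_le normr_ge0 andbT.
apply/ler_addgt0Pr => e e0; rewrite add0r.
have e20 : 0 < e / 2 by rewrite divr_gt0.
have [d1 d10 H1] := fI _ e20; have [d2 d20 H2] := fJ _ e20.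
have d0 : 0 < Num.min d1 d2 by rewrite lt_min d10.
have [s abs sd] := fine_partition ab d0.
pose t := nth b (a :: s).
have tt k : (k < size s)%N -> t k <= t k <= t k.+1.
  by move=> ks; have [_ -> _] := partition_le abs ks; rewrite lexx.
have td k : (k < size s)%N -> t k.+1 - t k < d1 /\ t k.+1 - t k < d2.
  by move=> /sd; rewrite lt_min => /andP.
have := H1 s t abs (fun k ks => conj (proj1 (td k ks)) (tt k ks)).
have := H2 s t abs (fun k ks => conj (proj2 (td k ks)) (tt k ks)).
set S := \sum_(_ <= _ < _) _ => SJ SI.
have -> : I - J = - (S - I) + (S - J) by ring.
by apply: (le_trans (ler_normD _ _)); rewrite normrN; lra.
Qed.

Lemma RS_integralE f g a b (I : R) : a <= b -> is_RS_integral f g a b I ->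
  RS_integral f g a b = I.
Proof.
move=> ab fI; apply: (is_RS_integral_unique ab _ fI).
by apply: (@getPex _ [set I | is_RS_integral f g a b I]); exists I.
Qed.

Lemma euclidean_norm_le_sum d (x : 'rV[R]_d) :
  euclidean_norm x <= \sum_i `|x 0 i|.
Proof.
have S0 : 0 <= \sum_i `|x 0 i| by exact: sumr_ge0.
rewrite /euclidean_norm -(ler_sqr (sqrtr_ge0 _) S0) ?nnegrE ?sqrtr_ge0//.
rewrite sqr_sqrtr; last by apply: sumr_ge0 => i _; exact: sqr_ge0.
rewrite expr2 mulr_suml; apply: ler_sum => i _.
rewrite -real_normK ?num_real// expr2 ler_wpM2l//.
by rewrite (bigD1 i)//= lerDl sumr_ge0.
Qed.

Lemma ler_abs_euclidean_norm d (x : 'rV[R]_d) i : `|x 0 i| <= euclidean_norm x.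
Proof.
rewrite /euclidean_norm -sqrtr_sqr ler_wsqrtr// (bigD1 i)//= lerDl.
by apply: sumr_ge0 => j _; exact: sqr_ge0.
Qed.

Lemma continuous_onP (E : Type) (dist : E -> E -> R) a b (f : R -> E) :
  continuous_on dist a b f <->
  forall s e, s \in `[a, b] -> 0 < e ->
    exists2 delta, 0 < delta & forall t, t \in `[a, b] -> `|t - s| < delta ->
      `|dist (f s) (f t)| < e.
Proof.
split=> [H s e sab e0|H s sab].
  have /cvgrPdist_lt/(_ e e0) := H s sab.
  rewrite near_withinE => /nbhs_ballP[delta /= d0 Hd]; exists delta => // t tab ts.
  have /= := Hd t; rewrite /ball/= distrC => /(_ ts).
  by rewrite inE => /(_ tab); rewrite sub0r normrN.
apply/cvgrPdist_lt => e e0; rewrite near_withinE.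
have [delta d0 Hd] := H s e sab e0.
apply/nbhs_ballP; exists delta => //= t; rewrite /ball/= distrC => ts tab.
by rewrite sub0r normrN; exact: Hd.
Qed.

End RiemannStieltjes.

(** * Polygonal paths and their signatures *)

Section PolygonalPaths.
Variables (R : realType) (d : nat).
Implicit Types (s : seq 'rV[R]_d) (a b t : R).

Definition clamp t : R := Num.min (Num.max t 0) 1.

Lemma clamp_ge0 t : 0 <= clamp t.
Proof. by rewrite /clamp le_min ler01 andbT le_max lexx orbT. Qed.

Lemma clamp_le0 t : t <= 0 -> clamp t = 0.
Proof. by move=> t0; rewrite /clamp max_r// min_l. Qed.

Lemma clamp_ge1 t : 1 <= t -> clamp t = 1.
Proof. by move=> t1; rewrite /clamp max_l ?min_r// (le_trans ler01). Qed.

Lemma clamp_le a b : a <= b -> clamp a <= clamp b.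
Proof.
move=> ab; rewrite /clamp le_min ge_min ge_min lexx orbT andbT.
by rewrite ge_max !le_max ab lexx !orbT.
Qed.

Lemma clamp_lipschitz a b : a <= b -> clamp b - clamp a <= b - a.
Proof.
rewrite /clamp /Num.min /Num.max => ab.
by repeat case: ifPn => //; rewrite -?leNgt => *; lra.
Qed.

(** The polygonal path with successive increments [s], the [j]-th of them being
    run through during [[j, j + 1]], as a word of partial increments. *)
Fixpoint wpart s t : seq 'rV[R]_d :=
  if s is v :: s' then clamp t *: v :: wpart s' (t - 1) else [::].

Fixpoint wdiff s a b : seq 'rV[R]_d :=
  if s is v :: s' then (clamp b - clamp a) *: v :: wdiff s' (a - 1) (b - 1)
  else [::].

Definition gpath s t : 'rV[R]_d := \sum_(v <- wpart s t) v.

Lemma wexp_wpart_le0 N s t : t <= 0 -> wexp N (wpart s t) = 1.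
Proof.
elim: s t => [|v s IH] t t0; first exact: wexp_nil.
by rewrite wexp_cons clamp_le0// scale0r texp10 mul1r IH//; lra.
Qed.

Lemma wlen_wpart_le0 s t : t <= 0 -> wlen (wpart s t) = 0.
Proof.
elim: s t => [|v s IH] t t0; first exact: wlen_nil.
rewrite wlen_cons clamp_le0// scale0r IH ?addr0; last by lra.
by rewrite big1// => i _; rewrite mxE normr0.
Qed.

Lemma wpart_ge s t : (size s)%:R <= t -> wpart s t = s.
Proof.
elim: s t => // v s IH t; rewrite /= -natr1 => st; have s0 := ler0n R (size s).
by rewrite IH ?clamp_ge1 ?scale1r//; lra.
Qed.

(** Only one increment is active at a time, so that the increments of the
    signature multiply. *)
Lemma wexp_wdiff N s a b : a <= b ->
  wexp N (wpart s b) = wexp N (wpart s a) * wexp N (wdiff s a b).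
Proof.
elim: s a b => [|v s IH] a b ab; first by rewrite !wexp_nil mul1r.
have ab1 : a - 1 <= b - 1 by lra.
rewrite !wexp_cons (IH _ _ ab1).
have [a1|a1] := leP 1 a.
  rewrite !clamp_ge1//; last exact: le_trans ab.
  by rewrite subrr scale0r texp10 mul1r !mulrA.
rewrite (wexp_wpart_le0 _ _ (t := a - 1)) ?mul1r ?mulr1; last by lra.
by rewrite mulrA texp1D [clamp a + _]addrC subrK.
Qed.

Lemma wlen_wdiff s a b : a <= b ->
  wlen (wdiff s a b) = wlen (wpart s b) - wlen (wpart s a).
Proof.
have wlenZ (t : R) (v : 'rV[R]_d) : 0 <= t ->
    \sum_i `|(t *: v) 0 i| = t * \sum_i `|v 0 i|.
  move=> t0; rewrite mulr_sumr; apply: eq_bigr => i _.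
  by rewrite mxE normrM ger0_norm.
elim: s a b => [|v s IH] a b ab; first by rewrite !wlen_nil subrr.
have ab1 : a - 1 <= b - 1 by lra.
rewrite !wlen_cons (IH _ _ ab1) !wlenZ ?clamp_ge0 ?subr_ge0 ?clamp_le//.
by ring.
Qed.

Lemma wlen_wdiff_lipschitz s a b : a <= b ->
  wlen (wdiff s a b) <= wlen s * (b - a).
Proof.
elim: s a b => [|v s IH] a b ab; first by rewrite !wlen_nil mul0r.
have ab1 : a - 1 <= b - 1 by lra.
rewrite !wlen_cons mulrDl lerD//; last first.
  by apply: (le_trans (IH _ _ ab1)); rewrite opprB addrA subrK.
rewrite mulr_suml; apply: ler_sum => i _.
rewrite mxE normrM mulrC ler_wpM2l// ger0_norm ?subr_ge0 ?clamp_le//.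
exact: clamp_lipschitz.
Qed.

Lemma wlen_wpart_le s t : wlen (wpart s t) <= wlen s.
Proof.
elim: s t => [|v s IH] t; first by rewrite !wlen_nil.
rewrite !wlen_cons lerD//; apply: ler_sum => i _.
rewrite mxE normrM ger0_norm ?clamp_ge0// ler_piMl//.
by rewrite /clamp ge_min lexx orbT.
Qed.

Lemma gpath_diff s a b i : gpath s b 0 i - gpath s a 0 i =
  \sum_(v <- wdiff s a b) v 0 i.
Proof.
rewrite /gpath; elim: s a b => [|v s IH] a b; first by rewrite !big_nil subrr.
rewrite !big_cons -IH !mxE.
by ring.
Qed.

Lemma gpath_dist s a b : a <= b ->
  euclidean_dist (gpath s a) (gpath s b) <= wlen (wdiff s a b).
Proof.
move=> ab; apply: (le_trans (euclidean_norm_le_sum _)).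
under eq_bigr do rewrite mxE [X in _ + X]mxE distrC gpath_diff.
rewrite /wlen exchange_big; apply: ler_sum => i _; exact: ler_norm_sum.
Qed.

End PolygonalPaths.

Section Signature.
Variables (R : realType) (d N : nat).
Implicit Types (s : seq 'rV[R]_d) (a b t : R).

Lemma tcoef_gpath_diff s a b i : (0 < N)%N ->
  tcoef (wexp N (wdiff s a b)) [:: i] = gpath s b 0 i - gpath s a 0 i.
Proof. by move=> N0; rewrite tcoef_wexp_letter// gpath_diff. Qed.

(** Along a polygonal path, the coefficients of the signature increase to
    second order like the integrands of the iterated integrals. *)
Lemma signature_quadratic s w i (n : nat) : (size w < N)%N ->
  let S t := wexp N (wpart s (n%:R * t)) in
  exists2 M : R, 0 <= M & forall x xi y, 0 <= x -> x <= xi -> xi <= y -> y <= 1 ->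
  `|tcoef (S y) (rcons w i) - tcoef (S x) (rcons w i)
    - tcoef (S xi) w * (gpath s (n%:R * y) 0 i - gpath s (n%:R * x) 0 i)|
  <= M * (y - x) ^+ 2.
Proof.
move=> wN S; pose L := 1 + wlen s * n%:R; pose B := (1 + wlen s) ^+ N.
have ls := wlen_ge0 s.
have L1 : 1 <= L by rewrite lerDl mulr_ge0.
have L0 : 0 <= L by exact: le_trans L1.
have B0 : 0 <= B by rewrite exprn_ge0// addr_ge0.
exists (\sum_(j < size w) B * (L ^+ N.+1 *+ 2)).
  by apply: sumr_ge0 => j _; rewrite mulr_ge0// mulrn_wge0// exprn_ge0.
move=> x xi y x0 xxi xiy y1.
have wN1 : (size (rcons w i) <= N)%N by rewrite size_rcons.
have xy : x <= y by exact: le_trans xiy.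
have h0 : 0 <= y - x by rewrite subr_ge0.
have h1 : y - x <= 1 by lra.
have nmul (u v : R) : u <= v -> n%:R * u <= n%:R * v by move=> uv; rewrite ler_wpM2l.
pose D := wexp N (wdiff s (n%:R * x) (n%:R * y)).
pose D' := wexp N (wdiff s (n%:R * x) (n%:R * xi)).
have SD : S y = S x * D by exact/wexp_wdiff/nmul.
have SD' : S xi = S x * D' by exact/wexp_wdiff/nmul.
have lenD u v : x <= u -> u <= v -> v <= y ->
    wlen (wdiff s (n%:R * u) (n%:R * v)) <= L * (y - x).
  move=> xu uv vy; apply: (le_trans (wlen_wdiff_lipschitz s (nmul _ _ uv))).
  rewrite -mulrBr mulrA; apply: ler_pM; rewrite ?mulr_ge0// ?subr_ge0//.
    by rewrite /L lerDr.
  by lra.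
have powL m : (m <= N.+1)%N -> L ^+ m <= L ^+ N.+1.
  by move=> mN; rewrite ler_weXn2l.
have bD u v z : x <= u -> u <= v -> v <= y -> (size z <= N)%N -> (0 < size z)%N ->
    `|tcoef (wexp N (wdiff s (n%:R * u) (n%:R * v))) z| <= L ^+ size z * (y - x).
  move=> xu uv vy zN z0; apply: (le_trans (wexp_bound' _ _ _)).
  apply: (@le_trans _ _ ((L * (y - x)) ^+ size z)).
    by rewrite lerXn2r ?nnegrE ?wlen_ge0 ?mulr_ge0 ?lenD.
  rewrite exprMn ler_wpM2l ?exprn_ge0//.
  by case: (size z) z0 => // m _; rewrite exprS ler_piMr// exprn_ile1.
have bD2 z : (size z <= N)%N -> (1 < size z)%N ->
    `|tcoef D z| <= L ^+ N.+1 * (y - x) ^+ 2.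
  move=> zN z0; apply: (le_trans (wexp_bound' _ _ _)).
  apply: (@le_trans _ _ ((L * (y - x)) ^+ size z)).
    by rewrite lerXn2r ?nnegrE ?wlen_ge0 ?mulr_ge0 ?lenD.
  rewrite exprMn ler_pM ?exprn_ge0 ?powL ?(leqW zN)//.
  case: (size z) z0 => [|[|m]]// _.
  by rewrite exprS exprS mulrA -expr2 ler_piMr ?sqr_ge0// exprn_ile1.
have bS z : `|tcoef (S x) z| <= B.
  have := @hbound_wexp _ _ N (wpart s (n%:R * x)) (1 + wlen s) 1 _ ler01 _ z.
  rewrite expr1n !mulr1; apply; first by rewrite lerDl.
  by apply: (le_trans (wlen_wpart_le _ _)); rewrite lerDr.
have N0 : (0 < N)%N by exact: leq_ltn_trans wN.
have -> : tcoef (S y) (rcons w i) - tcoef (S x) (rcons w i)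
    - tcoef (S xi) w * (gpath s (n%:R * y) 0 i - gpath s (n%:R * x) 0 i) =
  \sum_(j < size w) (tcoef (S x) (take j w) * (tcoef D (rcons (drop j w) i)
     - tcoef D' (drop j w) * tcoef D [:: i])).
  rewrite -tcoef_gpath_diff// -/D SD SD' !tcoef_mul// 1?ltnW//.
  rewrite size_rcons !big_ord_recr/= take_size drop_size.
  have -> : take (size w).+1 (rcons w i) = rcons w i.
    by rewrite -[(size w).+1](size_rcons w i) take_size.
  have -> : drop (size w).+1 (rcons w i) = [::].
    by rewrite -[(size w).+1](size_rcons w i) drop_size.
  have -> : take (size w) (rcons w i) = w by rewrite -cats1 take_size_cat.
  have -> : drop (size w) (rcons w i) = [:: i] by rewrite -cats1 drop_size_cat.
  rewrite !tcoef_wexp_nil !mulr1 addrK mulrDl opprD addrACA subrr addr0.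
  rewrite mulr_suml -sumrB; apply: eq_bigr => -[j /= jw] _.
  rewrite -!cats1 takel_cat ?(ltnW jw)// drop_cat jw.
  by rewrite mulrBr mulrA.
rewrite mulr_suml; apply: (le_trans (ler_norm_sum _ _ _)).
apply: ler_sum => -[j /= jw] _.
rewrite normrM -mulrA ler_pM//.
apply: (le_trans (ler_normB _ _)); rewrite mulr2n mulrDl; apply: lerD.
  by apply: bD2; rewrite size_rcons size_drop; move: jw wN; clear; lia.
rewrite normrM.
have dj : (0 < size (drop j w))%N by rewrite size_drop subn_gt0.
have djN : (size (drop j w) < N)%N.
  by rewrite (leq_ltn_trans _ wN)// size_drop leq_subr.
have H1 := bD x xi (drop j w) (lexx x) xxi xiy (ltnW djN) dj.
have H2 := bD x y [:: i] (lexx x) xy (lexx y) N0 isT.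
apply: (le_trans (ler_pM _ _ H1 H2)) => //.
rewrite mulrACA -expr2 -exprD ler_wpM2r ?sqr_ge0// powL//=.
by rewrite addn1; exact: leqW.
Qed.

Lemma iterated_integral_gpath s (n : nat) w t : (size w <= N)%N ->
  0 <= t <= 1 ->
  iterated_integral (fun u => gpath s (n%:R * u)) w t =
  tcoef (wexp N (wpart s (n%:R * t))) w.
Proof.
move=> + /andP[]; elim/last_ind: w t => [|w i IH] t wN t0 t1.
  by rewrite /= tcoef_wexp_nil.
have wN' : (size w < N)%N by move: wN; rewrite size_rcons.
rewrite /iterated_integral foldl_rcons -/(iterated_integral _ w).
have [M M0 HM] := signature_quadratic s i n wN'.
pose F u := tcoef (wexp N (wpart s (n%:R * u))) (rcons w i).
have F0 : F 0 = 0.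
  by rewrite /F mulr0 wexp_wpart_le0// tcoef_one /nilp size_rcons.
rewrite -/(F t) -[F t]subr0 -[X in _ - X]F0.
apply: RS_integralE => //; apply: (is_RS_integral_quadratic M0) => //.
move=> x xi y x0 xxi xiy yt; rewrite IH//; last 3 first.
- exact: ltnW.
- exact: le_trans xxi.
- exact: le_trans (le_trans yt t1).
exact: HM x0 xxi xiy (le_trans yt t1).
Qed.

Lemma signature_gpath s :
  signature N (fun u => gpath s ((size s)%:R * u)) = wexp N s.
Proof.
apply: tensorP => w wN; rewrite tcoef_le/= iterated_integral_gpath ?ler01 ?lexx//.
by rewrite wpart_ge// mulr1.
Qed.

Lemma path_length_gpath s (n : nat) :
  exists2 l : R, path_length 0 1 (fun u => gpath s (n%:R * u)) = l%:E & 0 <= l <= wlen s.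
Proof.
set P := path_length _ _ _.
have Ple : (P <= (wlen s)%:E)%E.
  apply: ge_ereal_sup => _ [p p01 <-]; rewrite lee_fin.
  pose F u := wlen (wpart s (n%:R * u)).
  apply: (@le_trans _ _ (\sum_(0 <= k < size p)
     (F (nth 1 (0 :: p) k.+1) - F (nth 1 (0 :: p) k)))).
    apply: ler_sum_nat => k /andP[_ kp]; have [_ tt _] := partition_le p01 kp.
    have ntt := ler_wpM2l (ler0n R n) tt.
    by apply: (le_trans (gpath_dist _ ntt)); rewrite wlen_wdiff.
  rewrite partition_sum_telescope// /F mulr0 (wlen_wpart_le0 _ (lexx 0)) subr0.
  exact: wlen_wpart_le.
have P0 : (0%:E <= P)%E.
  apply: le_trans; last first.
    by apply: ereal_sup_ubound; exists [:: 1] => //; apply: itv_partition1.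
  rewrite lee_fin sumr_ge0// => k _; exact: sqrtr_ge0.
have Pfin : P \is a fin_num by rewrite ge0_fin_numE// (le_lt_trans Ple)// ltry.
exists (fine P); first by rewrite fineK.
by rewrite -!lee_fin fineK// P0.
Qed.

Lemma cc_norm_ge0 (x : tensor R d N) : 0 <= cc_norm x.
Proof.
rewrite /cc_norm; set E := [set _ | _].
have [->|/set0P ne] := eqVneq E set0; first by rewrite inf0.
apply: lb_le_inf => // l [g [_ gl _]]; rewrite -lee_fin -gl.
apply: le_trans; last first.
  by apply: ereal_sup_ubound; exists [:: 1] => //; apply: itv_partition1.
rewrite lee_fin sumr_ge0// => k _; exact: sqrtr_ge0.
Qed.

(** The polygonal path with increments [s], run in unit time, competes in the
    infimum defining the norm. *)
Lemma cc_norm_wexp s : cc_norm (wexp N s) <= wlen s.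
Proof.
have [l gl /andP[l0 ls]] := path_length_gpath s (size s).
apply: (le_trans _ ls); apply: ge_inf.
  exists 0 => r [g [_ gr _]]; rewrite -lee_fin -gr.
  apply: le_trans; last first.
    by apply: ereal_sup_ubound; exists [:: 1] => //; apply: itv_partition1.
  by rewrite lee_fin sumr_ge0// => k _; exact: sqrtr_ge0.
exists (fun u => gpath s ((size s)%:R * u)); split => //; last first.
  exact: signature_gpath.
pose L := 1 + wlen s * (size s)%:R.
have L0 : 0 < L by rewrite ltr_pwDl// mulr_ge0// wlen_ge0.
have lip a b : a <= b -> euclidean_dist (gpath s ((size s)%:R * a))
    (gpath s ((size s)%:R * b)) <= L * (b - a).
  move=> ab; have nab := ler_wpM2l (ler0n R (size s)) ab.
  apply: (le_trans (gpath_dist s nab)); apply: (le_trans (wlen_wdiff_lipschitz s nab)).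
  by rewrite -mulrBr mulrA ler_wpM2r ?subr_ge0// /L lerDr.
have distC (x y : 'rV[R]_d) : euclidean_dist x y = euclidean_dist y x.
  rewrite /euclidean_dist /euclidean_norm; congr Num.sqrt; apply: eq_bigr => i _.
  by rewrite !mxE -sqrrN opprB.
apply/continuous_onP => a e a01 e0; exists (e / L); first exact: divr_gt0.
move=> b b01; rewrite ltr_pdivlMr// mulrC => abe.
rewrite ger0_norm ?sqrtr_ge0//; apply: le_lt_trans abe.
have [ab|ba] := leP a b; first by rewrite ger0_norm ?subr_ge0// lip.
by rewrite distC ltr0_norm ?subr_lt0// opprB lip// ltW.
Qed.

End Signature.

(** * The lift along the dyadic tree *)

(** A size [om m k] for the [k]-th dyadic interval of generation [m], whose
    parent is the [k./2]-th one of the generation before; along the tree sizes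
    are multiplied by factors between [b] and [a]. *)
Definition control (R : realType) (a b : R) (om : nat -> nat -> R) :=
  (forall m k, 0 < om m k) /\
  forall m k, b * om m k./2 <= om m.+1 k /\ om m.+1 k <= a * om m k./2.

Section LiftTree.
Variables (R : realType) (d N : nat) (a b : R) (om : nat -> nat -> R).
Local Notation T := (tensor R d N).
Variable x : nat -> nat -> 'rV[R]_d.
Hypothesis xS : forall m k, x m k = x m.+1 k.*2 + x m.+1 k.*2.+1.
Hypothesis om_control : control a b om.
Hypothesis a_lt1 : a < 1.
Hypothesis b_gt0 : 0 < b.

Let om_gt0 m k : 0 < om m k. Proof. by have [->] := om_control. Qed.

Let om_ge m k : b * om m k./2 <= om m.+1 k.
Proof. by have [_ /(_ m k)[]] := om_control. Qed.

Let om_le m k : om m.+1 k <= a * om m k./2.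
Proof. by have [_ /(_ m k)[]] := om_control. Qed.

Lemma control_le1 : b <= 1.
Proof.
have := le_trans (om_ge 0 0) (om_le 0 0); rewrite ler_pM2r// => ba.
exact: le_trans (ltW a_lt1).
Qed.

Lemma om_child m k : om m.+1 k <= om m k./2.
Proof. by apply: (le_trans (om_le m k)); rewrite ler_piMl// ltW. Qed.

Lemma eqlev_mul_add k (A S z : T) : tcoef A [::] = 1 -> vanish k z ->
  eqlev k S (1 + z) -> eqlev k (A * S) (A + z).
Proof.
move=> A1 vz Sz; have AA : eqlev k A A by [].
apply: (eqlev_trans (eqlevM AA Sz)).
apply/eqlevP; rewrite mulrDr mulr1 opprD addrACA subrr add0r.
rewrite -[X in _ - X]mul1r -mulrBl; apply: (@vanishM _ _ _ 1) => //.
exact: vanish_one_nil.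
Qed.

(** One step of the lift: the defect of multiplicativity at level [n + 1] is
    split evenly between the two halves of each dyadic interval. *)
Lemma lift_tree_step (K : R) (s : nat -> nat -> seq 'rV[R]_d) n :
  (0 < n < N)%N -> 0 <= K -> 1 < 2 * b ^+ n.+1 ->
  (forall m k, wlen (s m k) <= K * om m k) ->
  (forall m k, eqlev n (wexp N (s m k))
     (wexp N (s m.+1 k.*2) * wexp N (s m.+1 k.*2.+1))) ->
  exists2 K' : R, 0 <= K' & exists s' : nat -> nat -> seq 'rV[R]_d, forall m k,
  [/\ wlen (s' m k) <= K' * om m k,
    eqlev n (wexp N (s' m k)) (wexp N (s m k))  &
    eqlev n.+1 (wexp N (s' m k))
      (wexp N (s' m.+1 k.*2) * wexp N (s' m.+1 k.*2.+1))].
Proof.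
move=> /andP[n0 nN] K0 bn sK sn.
pose phi m k : T := lev n.+1 (wexp N (s m k) -
  wexp N (s m.+1 k.*2) * wexp N (s m.+1 k.*2.+1)).
have phi_lie m k : phi m k \in lie R d N.
  rewrite /phi -wexp_cat; apply: grp_lev; [exact: grp_wexp|exact: grp_wexp|].
  by rewrite wexp_cat.
pose C1 := 2 * (2 * K) ^+ n.+1.
have C10 : 0 <= C1 by rewrite mulr_ge0// exprn_ge0// mulr_ge0.
have phi_bound m k w : `|tcoef (phi m k) w| <= C1 * om m k ^+ n.+1.
  have om0 := ltW (om_gt0 m k).
  rewrite tcoef_lev; case: eqP => wn; last first.
    by rewrite normr0 mulr_ge0// exprn_ge0.
  rewrite tcoefB -wexp_cat; apply: (le_trans (ler_normB _ _)).
  have -> : C1 * om m k ^+ n.+1 =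
      (2 * (K * om m k)) ^+ n.+1 + (2 * (K * om m k)) ^+ n.+1.
    by rewrite /C1 !exprMn; ring.
  apply: lerD; apply: (le_trans (wexp_bound' _ _ _)); rewrite wn;
    rewrite lerXn2r// ?nnegrE ?wlen_ge0 ?mulr_ge0//.
    apply: (le_trans (sK m k)); rewrite ler_peMl ?mulr_ge0// ler1n//.
  rewrite wlen_cat mulr_natl mulr2n; apply: lerD; apply: (le_trans (sK _ _));
    rewrite ler_wpM2l//; apply: (le_trans (om_child _ _)).
    by rewrite doubleK.
  by rewrite -[k.*2.+1]/(true + k.*2)%N half_bit_double.
pose z := fix z m k : T :=
  if m is m'.+1 then 2^-1 *: (z m' k./2 + phi m' k./2) else 0.
have z_lie m k : z m k \in lie R d N.
  by elim: m k => [|m IH] k; rewrite /= ?mem0v// memvZ// memvD.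
have lev_z m k : lev n.+1 (z m k) = z m k.
  elim: m k => [|m IH] k /=; first exact: lev0.
  by rewrite levZ levD IH lev_lev eqxx.
(* As the sizes decay slowly, halving the correction from a parent to a child
   shrinks it, relatively to the power [n.+1] of the size, by a factor [q < 1]. *)
pose q := (2 * b ^+ n.+1)^-1.
have b20 : 0 < 2 * b ^+ n.+1 by rewrite mulr_gt0// exprn_gt0.
have q0 : 0 < q by rewrite invr_gt0.
have q1 : q < 1 by rewrite invf_lt1.
(* [K2] is the fixed point of [K2 = q * (K2 + C1)]. *)
pose K2 := q * C1 / (1 - q).
have K20 : 0 <= K2.
  by apply: divr_ge0; [exact: mulr_ge0 (ltW q0) C10|rewrite subr_ge0 ltW].
have qpar m k : 2^-1 * om m k./2 ^+ n.+1 <= q * om m.+1 k ^+ n.+1.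
  rewrite /q invfM -mulrA ler_wpM2l// ler_pdivlMl ?exprn_gt0// -exprMn.
  by rewrite lerXn2r// nnegrE ?mulr_ge0// ltW.
have z_bound m k w : `|tcoef (z m k) w| <= K2 * om m k ^+ n.+1.
  elim: m k => [|m IH] k /=.
    by rewrite tcoef0 normr0 mulr_ge0// exprn_ge0// ltW.
  rewrite tcoefZ tcoefD normrM ger0_norm//.
  apply: (@le_trans _ _ (2^-1 * ((K2 + C1) * om m k./2 ^+ n.+1))).
    rewrite ler_wpM2l//; apply: (le_trans (ler_normD _ _)).
    by rewrite mulrDl lerD.
  rewrite mulrCA; apply: (@le_trans _ _ ((K2 + C1) * (q * om m.+1 k ^+ n.+1))).
    by rewrite ler_wpM2l// addr_ge0.
  rewrite mulrA le_eqVlt; apply/orP; left; apply/eqP; congr (_ * _).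
  by rewrite /K2; field; rewrite subr_eq0 gt_eqF.
have [C C0 HC] := @commutator_lie R d N n.+1 isT.
have /choice[s' Hs'] : forall mk : nat * nat, exists s' : seq 'rV[R]_d,
    wlen s' <= C * ((1 + K2) * om mk.1 mk.2) /\ eqlev n.+1 (wexp N s') (1 + z mk.1 mk.2).
  move=> [m k] /=; have [||||s' s'C s'z] := HC (z m k) ((1 + K2) * om m k).
  - exact: z_lie.
  - by rewrite mulr_gt0// ltr_pwDl.
  - exact: lev_z.
  - move=> w; apply: (le_trans (z_bound m k w)); rewrite exprMn ler_wpM2r//.
      by rewrite exprn_ge0// ltW.
    apply: (@le_trans _ _ (1 + K2)); first by rewrite lerDr.
    by rewrite ler_eXnr// lerDl.
  by exists s'.
exists (K + C * (1 + K2)); first by rewrite addr_ge0// mulr_ge0// addr_ge0.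
exists (fun m k => s m k ++ s' (m, k)) => m k.
have vz m' k' : vanish n.+1 (z m' k') by rewrite -lev_z; exact: vanish_lev.
have ss' m' k' : eqlev n.+1 (wexp N (s m' k' ++ s' (m', k')))
    (wexp N (s m' k') + z m' k').
  rewrite wexp_cat; apply: eqlev_mul_add => //; first exact: tcoef_wexp_nil.
  by have [] := Hs' (m', k').
split.
- rewrite wlen_cat mulrDl; apply: lerD => //.
  by have [] := Hs' (m, k); rewrite mulrA.
- apply: (eqlev_trans (eqlevW (leqnSn n) (ss' m k))).
  by move=> w wn; rewrite tcoefD [X in _ + X]vz// addr0.
apply: (eqlev_trans (ss' m k)); apply: eqlev_sym.
apply: (eqlev_trans (eqlevM (ss' _ _) (ss' _ _))) => /=.
rewrite doubleK uphalf_double.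
set G := wexp N (s m k); set G0 := wexp N (s m.+1 k.*2).
set G1 := wexp N (s m.+1 k.*2.+1); set z' := _ *: _.
have vz' : vanish n.+1 z'.
  by apply: vanishZ; apply: vanishD => //; exact: vanish_lev.
have zz : z' + z' = z m k + phi m k.
  by rewrite -scalerDl (_ : 2^-1 + 2^-1 = 1) ?scale1r//; lra.
have G01 : vanish 1 (G0 - 1) by exact: vanish_wexp.
have G11 : vanish 1 (G1 - 1) by exact: vanish_wexp.
apply/eqlevP.
have -> : (G0 + z') * (G1 + z') - (G + z m k) =
  (G0 - 1) * z' + z' * (G1 - 1) + z' * z' + (phi m k - (G - G0 * G1)).
  rewrite !(mulrDl, mulrDr, mulrN, mulNr) mul1r mulr1.
  have -> : phi m k = z' + z' - z m k by rewrite zz addrC addKr.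
  by apply: tensorP => w _; rewrite !(tcoefD, tcoefN); ring.
apply: vanishD; last first.
  move=> w wn; rewrite tcoefB tcoef_lev -/G -/G0 -/G1.
  case: eqP => wn1; first by rewrite subrr.
  have wn' : (size w <= n)%N by move: wn wn1; clear; lia.
  by rewrite sub0r tcoefB (sn m k w wn') subrr oppr0.
apply: vanishD; last first.
  by apply: (vanishW _ (vanishM vz' vz')); clear; lia.
apply: vanishD; first by apply: (@vanishM _ _ _ 1).
by rewrite -addn1; apply: vanishM.
Qed.

(** Starting from the exponentials of the increments of [x], multiplicativity is
    gained one level at a time. *)
Lemma lift_tree (A : R) n : (0 < n <= N)%N -> 1 < 2 * b ^+ n -> 0 <= A ->
  (forall m k i, `|x m k 0 i| <= A * om m k) ->
  exists2 K : R, 0 <= K & exists s : nat -> nat -> seq 'rV[R]_d, forall m k,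
  [/\ wlen (s m k) <= K * om m k,
    forall i, tcoef (wexp N (s m k)) [:: i] = x m k 0 i  &
    eqlev n (wexp N (s m k))
      (wexp N (s m.+1 k.*2) * wexp N (s m.+1 k.*2.+1))].
Proof.
move=> + + A0 xA; elim: n => [//|n IH] /andP[_ nN] bn.
have [->|n0] := posnP n.
  have N0 : (0 < N)%N by exact: leq_trans nN.
  exists (d%:R * A); first by rewrite mulr_ge0.
  exists (fun m k => [:: x m k]) => m k; split.
  - rewrite wlen_cons wlen_nil addr0.
    apply: (@le_trans _ _ (\sum_(i < d) A * om m k)); first exact: ler_sum.
    by rewrite sumr_const card_ord -[leLHS]mulr_natl mulrA.
  - by move=> i; rewrite tcoef_wexp_letter// big_seq1.
  rewrite -wexp_cat => -[|i [|j w]]//= _; first by rewrite !tcoef_wexp_nil.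
  rewrite !tcoef_wexp_letter// big_seq1 big_cons big_seq1 xS mxE //.
have bn' : 1 < 2 * b ^+ n.
  apply: (lt_le_trans bn); rewrite ler_wpM2l// exprS ler_piMl ?control_le1//.
  by rewrite exprn_ge0// ltW.
have [|//|K K0 [s Hs]] := IH; first by rewrite n0 ltnW.
have [|||||K' K'0 [s' Hs']] := @lift_tree_step K s n.
- by rewrite n0.
- exact: K0.
- exact: bn.
- by move=> m k; have [] := Hs m k.
- by move=> m k; have [] := Hs m k.
exists K' => //; exists s' => m k; have [s'K ss' s'n] := Hs' m k; split => // i.
by rewrite ss'//; have [] := Hs m k.
Qed.

End LiftTree.

(** * The lift as a path *)

Section Sequences.
Variable R : realType.

Lemma cvg_geometric_bound (u : nat -> R) (C a : R) : 0 < a -> a < 1 ->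
  (forall m j, `|u (m + j)%N - u m| <= C * a ^+ m) -> cvg (u @ \oo).
Proof.
move=> a0 a1 ua; apply/cauchy_cvgP/cauchy_exP => e e0.
have : (fun m => C * a ^+ m) @ \oo --> (0 : R).
  rewrite -(mulr0 C); apply: cvgM; first exact: cvg_cst.
  by apply: cvg_expr; rewrite ger0_norm// ltW.
move=> /cvgrPdist_lt/(_ e e0)[m _ Hm].
exists (u m); exists m => // n /= mn; rewrite /ball/= distrC -(subnKC mn).
apply: (le_lt_trans (ua m (n - m)%N)); have := Hm m (leqnn m).
by rewrite sub0r normrN; apply: le_lt_trans; exact: ler_norm.
Qed.

End Sequences.

Section DyadicIntervals.
Variables (R : realType) (T : R).
Hypothesis T_gt0 : 0 < T.

Definition dyadic (m k : nat) : R := T * k%:R / 2 ^+ m.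

(** The index of the dyadic interval of generation [m] that contains [t]. *)
Definition dindex (m : nat) (t : R) : nat := Num.truncn (t * 2 ^+ m / T).

Lemma dyadicS m k : dyadic m.+1 k.*2 = dyadic m k.
Proof.
rewrite /dyadic -muln2 natrM exprS.
by field; rewrite expf_neq0.
Qed.

Lemma dyadic_step m k : dyadic m k.+1 - dyadic m k = T / 2 ^+ m.
Proof. by rewrite /dyadic -natr1; field; rewrite expf_neq0. Qed.

Lemma dyadic_le m k l : (k <= l)%N -> dyadic m k <= dyadic m l.
Proof.
move=> kl; rewrite /dyadic ler_wpM2r ?invr_ge0 ?exprn_ge0//.
by rewrite ler_wpM2l ?ler_nat// ltW.
Qed.

Lemma dindexP m t k : 0 <= t ->
  reflect (dyadic m k <= t < dyadic m k.+1) (dindex m t == k).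
Proof.
move=> t0; rewrite /dindex truncn_eq; last first.
  by rewrite divr_ge0 ?mulr_ge0 ?exprn_ge0// ltW.
have p0 : 0 < 2 ^+ m :> R by rewrite exprn_gt0.
rewrite /dyadic ler_pdivlMr// ltr_pdivrMr// ler_pdivrMr// ltr_pdivlMr//.
by rewrite ![_ * T]mulrC; exact: idP.
Qed.

Lemma dindex_itv m t : 0 <= t ->
  dyadic m (dindex m t) <= t < dyadic m (dindex m t).+1.
Proof. by move=> t0; apply/dindexP. Qed.

Lemma half_dindex m t : 0 <= t -> (dindex m.+1 t)./2 = dindex m t.
Proof.
move=> t0; apply/esym/eqP/(dindexP _ _ t0).
have /andP[lt tl] := dindex_itv m.+1 t0.
set k := dindex m.+1 t in lt tl *.
rewrite -!(dyadicS m); apply/andP; split.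
  by apply: le_trans lt; apply: dyadic_le; rewrite -[leqRHS]odd_double_half leq_addl.
apply: lt_le_trans tl _; apply: dyadic_le.
by rewrite -[k in leqLHS]odd_double_half doubleS; case: (odd k).
Qed.

Lemma dindex_near m s t : 0 <= s -> s <= t -> t - s <= T / 2 ^+ m ->
  dindex m t = dindex m s \/ dindex m t = (dindex m s).+1.
Proof.
move=> s0 st ts; have t0 : 0 <= t by exact: le_trans st.
have /andP[ls sl] := dindex_itv m s0; have /andP[lt tl] := dindex_itv m t0.
have lt_dyadic k l : dyadic m k < dyadic m l -> (k < l)%N.
  by rewrite ltnNge; apply: contraL => kl; rewrite -leNgt dyadic_le.
have h1 : (dindex m s < (dindex m t).+1)%N.
  by apply: lt_dyadic; lra.
have h2 : (dindex m t < (dindex m s).+2)%N.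
  apply: lt_dyadic; have := dyadic_step m (dindex m s).+1; lra.
by move: h1 h2; lia.
Qed.

End DyadicIntervals.

Section LiftPath.
Variables (R : realType) (d N : nat) (a b T A : R) (om : nat -> nat -> R).
Variable X : R -> 'rV[R]_d.
Hypothesis N_gt0 : (0 < N)%N.
Hypothesis T_gt0 : 0 < T.
Hypothesis om_control : control a b om.
Hypothesis a_gt0 : 0 < a.
Hypothesis a_lt1 : a < 1.
Hypothesis b_gt0 : 0 < b.
Hypothesis bN : 1 < 2 * b ^+ N.
Hypothesis A_ge0 : 0 <= A.
Hypothesis X_om : forall m k i,
  `|(X (dyadic T m k.+1) - X (dyadic T m k)) 0 i| <= A * om m k.
Hypothesis X_cont : forall i, continuous (fun t => X t 0 i).

Let om_gt0 m k : 0 < om m k. Proof. by have [->] := om_control. Qed.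

Let om_le m k : om m.+1 k <= a * om m k./2.
Proof. by have [_ /(_ m k)[]] := om_control. Qed.

Lemma om_geometric m j t : 0 <= t ->
  om (m + j) (dindex T (m + j) t) <= a ^+ j * om m (dindex T m t).
Proof.
move=> t0; elim: j => [|j IH]; first by rewrite addn0 mul1r.
rewrite addnS; apply: (le_trans (om_le _ _)); rewrite half_dindex// exprS -mulrA.
by rewrite ler_pM2l.
Qed.

Section Word.
Variables (K : R) (s : nat -> nat -> seq 'rV[R]_d).
Hypothesis K_ge0 : 0 <= K.
Hypothesis sK : forall m k, wlen (s m k) <= K * om m k.
Hypothesis s_letter : forall m k i,
  tcoef (wexp N (s m k)) [:: i] = (X (dyadic T m k.+1) - X (dyadic T m k)) 0 i.
Hypothesis sM : forall m k,
  wexp N (s m k) = wexp N (s m.+1 k.*2) * wexp N (s m.+1 k.*2.+1).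

Fixpoint wpath m k : seq 'rV[R]_d :=
  if k is k'.+1 then wpath m k' ++ s m k' else [:: X 0].

Lemma wpathS m k : wexp N (wpath m.+1 k.*2) = wexp N (wpath m k).
Proof.
by elim: k => [//|k IH]; rewrite doubleS /= !wexp_cat IH (sM m k) mulrA.
Qed.

Lemma wpath_letter m k i : tcoef (wexp N (wpath m k)) [:: i] = X (dyadic T m k) 0 i.
Proof.
elim: k => [|k IH]; first by rewrite tcoef_wexp_letter// big_seq1 /dyadic mulr0 mul0r.
rewrite tcoef_wexp_letter// big_cat/= -!(tcoef_wexp_letter _ _ N_gt0) IH s_letter.
by rewrite !mxE; ring.
Qed.

(* [K1] sums the geometric series of the lengths of the dyadic pieces between a
   dyadic approximation of [t] and [t]. *)
Let K1 := K * a / (1 - a).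

Let K1_ge0 : 0 <= K1.
Proof. by rewrite divr_ge0 ?mulr_ge0 ?subr_ge0// ltW. Qed.

(** The lift at the left end of the dyadic interval of generation [m] around
    [t]. *)
Definition ypath m t := wexp N (wpath m (dindex T m t)).

Lemma ypath_reach j m t : 0 <= t -> exists2 u,
  ypath (m + j) t = ypath m t * wexp N u & wlen u <= K1 * om m (dindex T m t).
Proof.
move=> t0; elim: j m => [|j IH] m.
  exists [::]; first by rewrite addn0 wexp_nil mulr1.
  by rewrite wlen_nil mulr_ge0// ltW.
have [u uE uK] := IH m.+1; rewrite addnS -addSn.
have [v vE vK] : exists2 v, ypath m.+1 t = ypath m t * wexp N v &
    wlen v <= K * a * om m (dindex T m t).
  rewrite /ypath -(wpathS m) -(half_dindex T_gt0 m t0).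
  set k := dindex T m.+1 t; have [ok|ek] := boolP (odd k).
    exists (s m.+1 k./2.*2).
      by rewrite -wexp_cat -[in LHS](odd_double_half k) ok.
    apply: (le_trans (sK _ _)); rewrite -mulrA ler_wpM2l//.
    by apply: (le_trans (om_le _ _)); rewrite doubleK.
  exists [::]; last by rewrite wlen_nil !mulr_ge0// ltW.
  by rewrite wexp_nil mulr1 -[in LHS](odd_double_half k) (negbTE ek).
exists (v ++ u); first by rewrite uE vE wexp_cat mulrA.
rewrite wlen_cat; have -> : K1 = K * a + K1 * a.
  by rewrite /K1; field; rewrite subr_eq0 gt_eqF.
rewrite mulrDl lerD//; apply: (le_trans uK); rewrite -mulrA ler_wpM2l//.
by apply: (le_trans (om_le _ _)); rewrite half_dindex.
Qed.

Lemma ypath_cvg t : 0 <= t -> exists x, tcvg (fun m => ypath m t) x.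
Proof.
move=> t0; pose Q := K1 * om 0 (dindex T 0 t).
have Q0 : 0 <= Q by rewrite mulr_ge0// ltW.
pose L := 1 + (wlen (wpath 0 (dindex T 0 t)) + Q).
have L1 : 1 <= L by rewrite lerDl addr_ge0// wlen_ge0.
have yL m w : `|tcoef (ypath m t) w| <= L ^+ N.
  have [u uE uK] := ypath_reach m 0 t0; rewrite add0n in uE.
  have := @hbound_wexp _ _ N (wpath 0 (dindex T 0 t) ++ u) L 1 L1 ler01 _ w.
  rewrite wexp_cat -/(ypath 0 t) -uE expr1n !mulr1; apply.
  by rewrite wlen_cat; move: uK; rewrite -/Q /L; lra.
have cvgw w : cvg ((fun m => tcoef (ypath m t) w : R) @ \oo).
  apply: (@cvg_geometric_bound _ _ (\sum_(k < size w) L ^+ N * (1 + Q) ^+ N) a) => // m j.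
  have [wN|wN] := leqP (size w) N; last first.
    rewrite !tcoef_gt// subrr normr0; apply: mulr_ge0; last exact/exprn_ge0/ltW.
    apply: sumr_ge0 => k _; apply: mulr_ge0; apply: exprn_ge0.
      exact: le_trans L1.
    exact: addr_ge0.
  have [u -> uK] := ypath_reach j m t0.
  have am0 : 0 <= a ^+ m by rewrite exprn_ge0// ltW.
  have am1 : a ^+ m <= 1 by rewrite exprn_ile1// ltW.
  have uQ : wlen u <= a ^+ m * Q.
    apply: (le_trans uK); rewrite /Q mulrCA ler_wpM2l//.
    by have := om_geometric 0 m t0; rewrite add0n.
  rewrite tcoef_mul// big_ord_recr/= take_size drop_size tcoef_wexp_nil mulr1 addrK.
  rewrite mulr_suml; apply: (le_trans (ler_norm_sum _ _ _)).
  apply: ler_sum => -[k /= kw] _; rewrite normrM -mulrA ler_pM//.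
  apply: (le_trans (wexp_bound' _ _ _)).
  have dk : (0 < size (drop k w))%N by rewrite size_drop subn_gt0.
  have dkN : (size (drop k w) <= N)%N by rewrite size_drop (leq_trans (leq_subr _ _)).
  apply: (@le_trans _ _ ((a ^+ m * Q) ^+ size (drop k w))).
    by rewrite lerXn2r// nnegrE ?wlen_ge0// mulr_ge0.
  rewrite exprMn [leLHS]mulrC.
  apply: ler_pM; [exact: exprn_ge0|exact: exprn_ge0| |].
    apply: (@le_trans _ _ ((1 + Q) ^+ size (drop k w))).
      by rewrite lerXn2r// ?nnegrE ?addr_ge0// lerDr.
    by rewrite ler_weXn2l// lerDl.
  by case: (size _) dk => // i _; rewrite exprS ler_piMr// exprn_ile1.
exists [ffun w : N.-bseq 'I_d => lim ((fun m => tcoef (ypath m t) w) @ \oo) : R].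
move=> w; have [wN|wN] := leqP (size w) N.
  by rewrite tcoef_le; exact: cvgw.
by rewrite tcoef_gt//; under eq_fun do rewrite tcoef_gt//; exact: cvg_cst.
Qed.

Lemma ypath_near m l s' t : 0 <= s' -> 0 <= t -> `|t - s'| <= T / 2 ^+ m ->
  exists2 u, ypath (m + l) t = ypath (m + l) s' * wexp N u &
    wlen u <= (K + K1) * (om m (dindex T m s') + om m (dindex T m t)).
Proof.
have aux p t' : 0 <= p -> p <= t' -> t' - p <= T / 2 ^+ m ->
    exists2 u, ypath (m + l) t' = ypath (m + l) p * wexp N u &
      wlen u <= (K + K1) * (om m (dindex T m p) + om m (dindex T m t')).
  move=> p0 pt tp; have t'0 : 0 <= t' by exact: le_trans pt.
  have [u uE uK] := ypath_reach l m p0; have [v vE vK] := ypath_reach l m t'0.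
  have [w wE wK] : exists2 w, ypath m t' = ypath m p * wexp N w &
      wlen w <= K * om m (dindex T m p).
    rewrite /ypath; case: (dindex_near T_gt0 p0 pt tp) => ->.
      exists [::]; first by rewrite wexp_nil mulr1.
      by rewrite wlen_nil mulr_ge0// ltW.
    by exists (s m (dindex T m p)); [rewrite -wexp_cat|exact: sK].
  exists (winv u ++ w ++ v).
    rewrite !wexp_cat vE wE uE (mulrA _ (wexp N (winv u))).
    by rewrite -(mulrA _ (wexp N u)) wexpK mulr1 !mulrA.
  rewrite !wlen_cat wlen_inv mulrDl !mulrDr.
  have Ky : 0 <= K * om m (dindex T m t') by rewrite mulr_ge0// ltW.
  by move: uK vK wK Ky; lra.
move=> s0 t0; have [st|/ltW ts] := leP s' t.
  by rewrite ger0_norm ?subr_ge0// => ?; exact: aux.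
rewrite ler0_norm ?subr_le0// opprB => /(aux _ _ t0 ts)[u uE uK].
exists (winv u); first by rewrite uE -mulrA wexpK mulr1.
by rewrite wlen_inv [X in _ * X]addrC.
Qed.

End Word.

(** The values on dyadic points converge along the dyadic approximations of [t].
    The increment between two points is a limit of products of exponentials of
    bounded total length, so that [chow] bounds its norm. *)
Lemma lift_path : exists XX : R -> tensor R d N, exists2 C : R, 0 <= C &
  [/\ forall t, grp (XX t),
    forall t, 0 <= t -> pi1 (XX t) = X t &
    forall m s t, 0 <= s -> 0 <= t -> `|t - s| <= T / 2 ^+ m ->
      cc_norm ((XX s)^-1 * XX t) <=
        C * (om m (dindex T m s) + om m (dindex T m t))].
Proof.
pose x m k := X (dyadic T m k.+1) - X (dyadic T m k).
have xS m k : x m k = x m.+1 k.*2 + x m.+1 k.*2.+1.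
  rewrite /x -doubleS !dyadicS [RHS]addrC addrA; congr (_ - _).
  by rewrite addrNK.
have N1 : (0 < N <= N)%N by rewrite N_gt0 leqnn.
have [K K0 [s Hs]] := lift_tree xS om_control a_lt1 b_gt0 N1 bN A_ge0 X_om.
have sK m k : wlen (s m k) <= K * om m k by have [] := Hs m k.
have s_letter m k i : tcoef (wexp N (s m k)) [:: i] = x m k 0 i by have [_ ->] := Hs m k.
have sM m k : wexp N (s m k) = wexp N (s m.+1 k.*2) * wexp N (s m.+1 k.*2.+1).
  by apply: eqlev_eq; have [] := Hs m k.
have /choice[XX XXE] : forall t : R, exists y : tensor R d N,
    tcvg (fun m => ypath s m (Num.max t 0)) y.
  by move=> t; apply: (ypath_cvg K0 sK sM); rewrite le_max lexx orbT.
have XXE' t : 0 <= t -> tcvg (fun m => ypath s m t) (XX t).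
  by move=> t0; have := XXE t; rewrite max_l.
have XXG t : grp (XX t).
  by apply: (grp_closed _ (XXE t)) => l; exact: grp_wexp.
pose K1 := K * a / (1 - a).
have K10 : 0 <= K1 by rewrite divr_ge0 ?mulr_ge0 ?subr_ge0// ltW.
pose C1 := 1 + (K + K1).
have C11 : 1 <= C1 by rewrite lerDl addr_ge0.
have C10 : 0 <= C1 ^+ N by rewrite exprn_ge0// (le_trans ler01).
have [C C0 HC] := @chow R d N (C1 ^+ N) C10.
exists XX, C => //; split => // [t t0|m p t p0 t0 tp].
  apply/rowP => i; rewrite mxE.
  have h1 := XXE' t t0 [:: i].
  have h2 : (fun m => tcoef (ypath s m t) [:: i] : R) @ \oo --> X t 0 i.
    under eq_fun do rewrite (wpath_letter s_letter).
    have dt : (fun m => dyadic T m (dindex T m t)) @ \oo --> t.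
      have Tm : (fun m => t - T * (2^-1) ^+ m) @ \oo --> t.
        rewrite -[X in _ --> X]subr0 -[in X in _ --> X](mulr0 T).
        apply: cvgB; first exact: cvg_cst.
        apply: cvgM; first exact: cvg_cst.
        by apply: cvg_expr; rewrite ger0_norm// invf_lt1// ltr1n.
      apply: (squeeze_cvgr _ Tm (cvg_cst t)); apply: nearW => m.
      have /andP[lt tl] := dindex_itv T_gt0 m t0.
      have := dyadic_step T m (dindex T m t); rewrite exprVn lt andbT; lra.
    exact: (cvg_comp _ _ dt (@X_cont i t)).
  exact: (cvg_unique _ h1 h2).
pose r := om m (dindex T m p) + om m (dindex T m t).
have r0 : 0 < r by rewrite addr_gt0.
have /choice[u Hu] : forall l, exists u,
    ypath s (m + l) t = ypath s (m + l) p * wexp N u /\ wlen u <= (K + K1) * r.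
  by move=> l; have [u uE uK] := ypath_near K0 sK sM l p0 t0 tp; exists u.
have shift y : 0 <= y -> tcvg (fun l => ypath s (m + l) y) (XX y).
  move=> y0 w; have := XXE' y y0 w; rewrite -(cvg_shiftn m).
  by under eq_fun do rewrite addnC.
have [||D uD DE] := @tcvg_ldiv R d N (fun l => ypath s (m + l) p) (fun l => wexp N (u l))
    (fun l => ypath s (m + l) t) (XX p) (XX t) _ _ (shift p p0) (shift t t0).
- by move=> l; exact: tcoef_wexp_nil.
- by move=> l; have [] := Hu l.
have DG : grp D by apply: (grp_closed _ uD) => l; exact: grp_wexp.
have [v vD vC] : exists2 v, wexp N v = D & wlen v <= C * r.
  apply: HC => // w.
  apply: (cvgr_to_le (cvg_norm (uD w))).
  apply: nearW => l; apply: hbound_wexp => //; first exact: ltW.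
  by apply: (le_trans (proj2 (Hu l))); rewrite ler_wpM2r ?(ltW r0)// lerDr.
have [q qE] := grp_wexpP (XXG p).
rewrite -DE -qE mulKr ?wexp_unit// -vD.
exact: le_trans (cc_norm_wexp _ _) vC.
Qed.

End LiftPath.

(** * Sobolev energies of dyadic intervals *)

Section IntegralLemmas.
Variable R : realType.
Local Notation mu := (@lebesgue_measure R).
Local Notation mu2 := (mu \x mu)%E.

(** The integral of a nonnegative function is a supremum over the simple functions
    below it, whence monotonicity.  The Carnot-Caratheodory increments of the
    lift are only known to be dominated by measurable functions. *)
Lemma ge0_le_integral_nomeas d (S : measurableType d) (nu : {measure set S -> \bar R})
    (D : set S) (f g : S -> \bar R) :
  (forall x, D x -> 0 <= f x)%E -> (forall x, D x -> f x <= g x)%E ->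
  (\int[nu]_(x in D) f x <= \int[nu]_(x in D) g x)%E.
Proof.
move=> f0 fg; have g0 x : D x -> (0 <= g x)%E.
  by move=> Dx; apply: le_trans (f0 x Dx) (fg x Dx).
rewrite !ge0_integralE//; apply: le_ereal_sup => _ [h hf <-]; exists h => // x.
apply: (le_trans (hf x)); rewrite !patchE.
by case: ifPn => //; rewrite inE => Dx; exact: fg.
Qed.

(** Markov's inequality, in the form of the existence of a point where the
    function is at most twice its mean. *)
Lemma integral_exists_le d (S : measurableType d) (nu : {measure set S -> \bar R})
    (D : set S) (L c : R) (f : S -> \bar R) :
  measurable D -> nu D = L%:E -> 0 < L -> 0 < c ->
  (forall x, 0 <= f x)%E ->
  (\int[nu]_(x in D) f x <= (c * L)%:E)%E ->
  exists2 x, D x & (f x <= (2 * c)%:E)%E.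
Proof.
move=> mD DL L0 c0 f0 fL; apply: contrapT => H.
have Hf x : D x -> ((2 * c)%:E <= f x)%E.
  by move=> Dx; apply/ltW; rewrite ltNge; apply/negP => fx; apply: H; exists x.
have : (\int[nu]_(x in D) (cst (2 * c)%:E x) <= \int[nu]_(x in D) f x)%E.
  by apply: ge0_le_integral_nomeas => x Dx; [rewrite lee_fin mulr_ge0// ltW|exact: Hf].
rewrite integral_cst// DL -EFinM => /le_trans /(_ fL).
have h : 2 * c * L <= c * L -> False.
  by rewrite ler_pM2r// mulr_natl mulr2n gerDl leNgt c0.
by rewrite lee_fin.
Qed.

Lemma measurable_powR_comp d (S : measurableType d) (f : S -> R) (p : R) :
  measurable_fun setT f -> measurable_fun setT (fun z => f z `^ p).
Proof. by move=> mf; apply: (measurableT_comp (measurable_powR p) mf). Qed.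

Lemma exprn_powR (x r : R) m : 0 <= x -> (x `^ r) ^+ m = (x ^+ m) `^ r.
Proof.
move=> x0; elim: m => [|m IH]; first by rewrite !expr0 powR1.
by rewrite !exprS IH powRM// exprn_ge0.
Qed.

End IntegralLemmas.

Section Energy.
Variables (R : realType) (d : nat) (X : R -> 'rV[R]_d).
Hypothesis X_cont : forall i, continuous (fun t => X t 0 i).
Local Notation mu := (@lebesgue_measure R).
Local Notation mu2 := (mu \x mu)%E.

Let F (z : R * R) := euclidean_dist (X z.1) (X z.2).

Lemma measurable_distance : measurable_fun setT F.
Proof.
have mX i : measurable_fun setT (fun t => X t 0 i).
  exact (continuous_measurable_fun (@X_cont i)).
have m1 i : measurable_fun setT (fun z : R * R => X z.1 0 i).
  by apply: (measurableT_comp (mX i)); exact: measurable_fst.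
have m2 i : measurable_fun setT (fun z : R * R => X z.2 0 i).
  by apply: (measurableT_comp (mX i)); exact: measurable_snd.
have ms : measurable_fun setT (@Num.sqrt R).
  exact (continuous_measurable_fun (@sqrt_continuous R)).
rewrite /F /euclidean_dist /euclidean_norm; apply: (measurableT_comp ms).
apply: measurable_sum => i; apply: measurable_funX.
rewrite [X in measurable_fun _ X](_ : _ = (fun z => X z.1 0 i - X z.2 0 i)).
  exact: measurable_funB.
by apply/funext => z; rewrite !mxE.
Qed.

Lemma measurable_gap : measurable_fun setT (fun z : R * R => `|z.2 - z.1|).
Proof.
apply: measurableT_comp; first exact: normr_measurable.
by apply: measurable_funB; [exact: measurable_snd|exact: measurable_fst].
Qed.

Lemma geometric_sum_bound (D x c : R) (P : nat -> bool) M : 1 < D -> 0 <= x -> 0 <= c ->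
  (forall m, P m -> D ^+ m * x <= c) ->
  \sum_(m < M) (P m)%:R * (D ^+ m * x) <= c * (D / (D - 1)).
Proof.
move=> D1 x0 c0 Pc; have D0 : 0 < D by exact: lt_trans D1.
have D10 : 0 < D - 1 by rewrite subr_gt0.
elim: M => [|M IH].
  by rewrite big_ord0; apply: mulr_ge0 => //; apply: divr_ge0; exact: ltW.
rewrite big_ord_recr/=; have [PM|_] := boolP (P M); last by rewrite mul0r addr0.
apply: (@le_trans _ _ (\sum_(m < M.+1) D ^+ m * x)).
  rewrite big_ord_recr/= mul1r lerD2r; apply: ler_sum => m _.
  apply: ler_piMl; last by case: (P m).
  by apply: mulr_ge0 => //; exact/exprn_ge0/ltW.
rewrite -mulr_suml mulrA ler_pdivlMr//.
have -> : (\sum_(i < M.+1) D ^+ i) * x * (D - 1) = (D ^+ M.+1 - 1) * x.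
  by rewrite subrX1; ring.
apply: (@le_trans _ _ (D ^+ M * x * D)).
  by rewrite exprS mulrBl mul1r -[leRHS]mulrC mulrA gerBl.
by rewrite ler_pM2r// Pc.
Qed.

Variables (T q alpha e : R).
Hypothesis T_gt0 : 0 < T.
Hypothesis q_gt0 : 0 < q.
Hypothesis e_gt0 : 0 < e.
Let gam := alpha * q - 1 - e.
Hypothesis gam_gt0 : 0 < gam.

Let Q : set (R * R) := [set` `[0, T]] `*` [set` `[0, T]].
Let gap (z : R * R) : R := `|z.2 - z.1|.
Let H (z : R * R) : R := F z `^ q / gap z `^ (alpha * q + 1).
Hypothesis H_fin : (\int[mu2]_(z in Q) (H z)%:E < +oo)%E.

Definition ditv m k : set R := [set` `[dyadic T m k, dyadic T m k.+1[ ].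

Let H0 z : R := H z * \1_Q z.

Let mQ : measurable Q.
Proof. by apply: measurableX; exact: measurable_itv. Qed.

Let H_ge0 z : 0 <= H z.
Proof. by rewrite mulr_ge0 ?invr_ge0 ?powR_ge0. Qed.

Let H0_ge0 z : 0 <= H0 z.
Proof. by rewrite mulr_ge0. Qed.

Let mH0 : measurable_fun setT H0.
Proof.
apply: measurable_funM; last exact: measurable_indic.
apply: measurable_funM; first exact: measurable_powR_comp measurable_distance.
have -> : (fun z => (gap z `^ (alpha * q + 1))^-1) =
    (fun z => gap z `^ (- (alpha * q + 1))).
  by apply/funext => z; rewrite powRN.
exact: measurable_powR_comp measurable_gap.
Qed.

Let H0_fin : (\int[mu2]_z (H0 z)%:E < +oo)%E.
Proof.
apply: le_lt_trans H_fin; rewrite [in leRHS]integral_mkcond.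
apply: ge0_le_integral_nomeas => z _; first by rewrite lee_fin.
by rewrite patchE /H0 indicE; case: ifP => _; rewrite ?mulr1 ?mulr0.
Qed.

Let phi m k z : R := H0 z * gap z `^ gam * (\1_(ditv m k) z.1 * \1_(ditv m k) z.2).

Let phi_ge0 m k z : 0 <= phi m k z.
Proof. by apply: mulr_ge0; [apply: mulr_ge0 => //; exact: powR_ge0|exact: mulr_ge0]. Qed.

Let mphi m k : measurable_fun setT (phi m k).
Proof.
apply: measurable_funM.
  by apply: measurable_funM => //; exact: measurable_powR_comp measurable_gap.
have mi : measurable_fun setT (\1_(ditv m k) : R -> R).
  by apply: measurable_indic; exact: measurable_itv.
by apply: measurable_funM; apply: (measurableT_comp mi);
  [exact: measurable_fst|exact: measurable_snd].
Qed.

Let E m k := (\int[mu2]_z (phi m k z)%:E)%E.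

Let E_ge0 m k : (0 <= E m k)%E.
Proof. by apply: integral_ge0 => z _; rewrite lee_fin. Qed.

Let indic_itv_le1 m k z : (\1_(ditv m k) z.1 * \1_(ditv m k) z.2 : R) <= 1 :> R.
Proof. by rewrite !indicE; do 2!case: (_ \in _); rewrite ?mulr1 ?mulr0// mul0r. Qed.

Let E_fin m k : E m k \is a fin_num.
Proof.
rewrite ge0_fin_numE//.
apply: (@le_lt_trans _ _ (\int[mu2]_z ((T `^ gam)%:E * (H0 z)%:E))%E).
  apply: ge0_le_integral_nomeas => z _; rewrite -?EFinM lee_fin//.
  rewrite /phi mulrC.
  apply: (@le_trans _ _ (1 * (H0 z * gap z `^ gam))).
    by apply: ler_wpM2r => //; apply: mulr_ge0 => //; exact: powR_ge0.
  rewrite mul1r mulrC /H0 indicE; have [zQ|] := boolP (z \in Q); last by rewrite !mulr0.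
  apply: ler_wpM2r; first exact: mulr_ge0.
  apply: ge0_ler_powR; rewrite ?nnegrE ?(ltW gam_gt0) ?(ltW T_gt0)// ?normr_ge0//.
  move: zQ; rewrite inE => -[] /=; rewrite !in_itv/= => /andP[a1 a2] /andP[a3 a4].
  by rewrite /gap ler_norml; apply/andP; split; lra.
rewrite ge0_integralZl_EFin ?powR_ge0//; last 2 first.
- by move=> z _; rewrite lee_fin.
- exact/measurable_EFinP.
by rewrite lte_mul_pinfty ?lee_fin ?powR_ge0.
Qed.

Let g := 2 `^ (- e) : R.

(** Up to a power of [T], the bound of Garsia, Rodemich and Rumsey for the [q]-th
    power of an increment of [X] over the interval: the energy density integrated
    over its square, with the weight [gap ^ gam] that makes it decrease by a
    factor [2 ^ (- e)] from an interval to its halves. *)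
Definition energy m k : R := g ^+ m * fine (E m k).

Lemma energy_ge0 m k : 0 <= energy m k.
Proof. by rewrite mulr_ge0 ?exprn_ge0 ?powR_ge0// fine_ge0. Qed.

Lemma ditv_half m k : ditv m.+1 k `<=` ditv m k./2.
Proof.
move=> t; rewrite /ditv /= !in_itv/= => /andP[lt tl].
rewrite -!(dyadicS T m); apply/andP; split.
  by apply: le_trans lt; apply: dyadic_le => //; rewrite -[leqRHS]odd_double_half leq_addl.
apply: lt_le_trans tl _; apply: dyadic_le => //.
by rewrite -[k in leqLHS]odd_double_half doubleS; case: (odd k).
Qed.

Lemma energy_half m k : energy m.+1 k <= g * energy m k./2.
Proof.
rewrite /energy exprS -mulrA; apply: ler_wpM2l; first exact: powR_ge0.
apply: ler_wpM2l; first exact/exprn_ge0/powR_ge0.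
rewrite fine_le// ?E_fin//.
apply: ge0_le_integral_nomeas => z _; rewrite lee_fin//.
have sub t : (\1_(ditv m.+1 k) t : R) <= \1_(ditv m k./2) t.
  rewrite !indicE; have [|//] := boolP (t \in ditv m.+1 k).
  by rewrite inE => /ditv_half tm; rewrite mem_set.
rewrite /phi; apply: ler_wpM2l; last exact: ler_pM.
by apply: mulr_ge0 => //; exact: powR_ge0.
Qed.

Lemma integral_distance_le m k : (k < 2 ^ m)%N ->
  (\int[mu]_(u in ditv m k) \int[mu]_(v in ditv m k) (F (u, v) `^ q)%:E <=
   (T `^ e * (T / 2 ^+ m) ^+ 2 * energy m k)%:E)%E.
Proof.
move=> km; pose h (z : R * R) : R := F z `^ q * (\1_(ditv m k) z.1 * \1_(ditv m k) z.2).
have h0 z : 0 <= h z.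
  by apply: mulr_ge0; [exact: powR_ge0|exact: mulr_ge0].
have mh : measurable_fun setT h.
  apply: measurable_funM; first exact: measurable_powR_comp measurable_distance.
  have mi : measurable_fun setT (\1_(ditv m k) : R -> R).
    by apply: measurable_indic; exact: measurable_itv.
  by apply: measurable_funM; apply: (measurableT_comp mi);
    [exact: measurable_fst|exact: measurable_snd].
have -> : (\int[mu]_(u in ditv m k) \int[mu]_(v in ditv m k) (F (u, v) `^ q)%:E)%E =
    (\int[mu2]_z (h z)%:E)%E.
  rewrite fubini_tonelli1; last 2 first.
  - exact/measurable_EFinP.
  - by move=> z; rewrite lee_fin.
  rewrite integral_mkcond; apply: eq_integral => u _; rewrite patchE /fubini_F.
  case: ifPn => uJ.
    rewrite [LHS]integral_mkcond; apply: eq_integral => v _.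
    rewrite patchE /h/= [X in _ * (X * _)]indicE uJ mul1r indicE.
    by case: ifP => _; rewrite ?mulr1 ?mulr0.
  apply/esym/integral0_eq => v _.
  by rewrite /h/= [X in _ * (X * _)]indicE (negbTE uJ) mul0r mulr0.
pose l := T / 2 ^+ m.
have l0 : 0 < l by rewrite divr_gt0// exprn_gt0.
have lE : l `^ (e + 2) = T `^ e * l ^+ 2 * g ^+ m.
  rewrite powRD; last by rewrite (gt_eqF l0) implybT.
  have -> : l `^ 2 = l ^+ 2 by rewrite -powR_mulrn// ltW.
  rewrite mulrAC; congr (_ * _); rewrite /l powRM ?(ltW T_gt0) ?invr_ge0 ?exprn_ge0//.
  congr (_ * _); rewrite /g -powR_mulrn ?powR_ge0// -powRrM -exprVn.
  rewrite -powR_mulrn// -powR_inv1// -!powRrM; congr (_ `^ _); ring.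
rewrite /energy mulrA -lE EFinM fineK ?E_fin//.
rewrite -ge0_integralZl_EFin ?powR_ge0//; last 2 first.
- by move=> z _; rewrite lee_fin.
- by apply/measurable_EFinP; exact: mphi.
apply: ge0_le_integral_nomeas => z _; rewrite -?EFinM lee_fin// /h /phi.
rewrite !indicE; have [z1|_] := boolP (z.1 \in ditv m k); last by rewrite !mul0r !mulr0.
have [z2|_] := boolP (z.2 \in ditv m k); last by rewrite !mulr0.
rewrite !mulr1.
have dT : dyadic T m k.+1 <= T.
  rewrite /dyadic ler_pdivrMr ?exprn_gt0// ler_pM2l//.
  by rewrite -natrX ler_nat.
have d0 : 0 <= dyadic T m k by rewrite divr_ge0 ?exprn_ge0// mulr_ge0// ltW.
have dS := dyadic_step T m k.
move: z1 z2; rewrite !inE /ditv/= !in_itv/= => /andP[z1 z1'] /andP[z2 z2'].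
have zQ : z \in Q.
  by rewrite inE; split; rewrite /= in_itv/=; apply/andP; split; lra.
have gl : gap z <= l by rewrite /gap ler_norml /l -dS; apply/andP; split; lra.
have gap0 : 0 <= gap z by exact: normr_ge0.
rewrite /H0 indicE zQ mulr1.
have [gz|gz] := eqVneq (gap z) 0.
  have -> : F z = 0.
    move: gz => /eqP; rewrite normr_eq0 subr_eq0 => /eqP zz.
    rewrite /F zz /euclidean_dist subrr /euclidean_norm big1 ?sqrtr0// => i _.
    by rewrite mxE expr0n.
  rewrite powR0 ?gt_eqF//; apply: mulr_ge0; first exact: powR_ge0.
  by apply: mulr_ge0 => //; exact: powR_ge0.
have gp : 0 < gap z by rewrite lt_neqAle eq_sym gz.
have -> : F z `^ q = gap z `^ (e + 2) * (H z * gap z `^ gam).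
  rewrite mulrCA -powRD; last by rewrite gz implybT.
  have -> : e + 2 + gam = alpha * q + 1 by rewrite /gam; ring.
  by rewrite /H divfK// gt_eqF// powR_gt0.
apply: ler_wpM2r; first by apply: mulr_ge0 => //; exact: powR_ge0.
by apply: ge0_ler_powR; rewrite ?nnegrE ?addr_ge0 ?(ltW e_gt0) ?(ltW l0).
Qed.

(** A pair of points lies in a common dyadic interval of generation [m] only if
    [gap <= T / 2 ^ m]; summing over these generations gives a geometric series
    which cancels the weight [gap ^ gam]. *)
Lemma energy_sum : exists B : R, forall M,
  \sum_(m < M) (2 `^ (alpha * q - 1)) ^+ m * (\sum_(k < 2 ^ m.+1) energy m k) <= B.
Proof.
pose D := 2 `^ gam : R.
have D1 : 1 < D.
  by rewrite /D -[X in X < _](powRr0 2) /powR gt_eqF// ltr_expR mul0r mulr_gt0// ln_gt0 ?ltr1n.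
pose c := T `^ gam * (D / (D - 1)).
have c0 : 0 <= c.
  apply: mulr_ge0; first exact: powR_ge0.
  by apply: divr_ge0; [exact: powR_ge0|rewrite subr_ge0 ltW].
exists (fine (c%:E * \int[mu2]_z (H0 z)%:E)%E) => M.
have weight m : (2 `^ (alpha * q - 1)) ^+ m * g ^+ m = D ^+ m.
  rewrite -exprMn; congr (_ ^+ _); rewrite /g /D -powRD; last by rewrite pnatr_eq0 implybT.
  by [].
have -> : \sum_(m < M) (2 `^ (alpha * q - 1)) ^+ m * (\sum_(k < 2 ^ m.+1) energy m k) =
    \sum_(m < M) \sum_(k < 2 ^ m.+1) D ^+ m * fine (E m k).
  apply: eq_bigr => m _; rewrite mulr_sumr; apply: eq_bigr => k _.
  by rewrite /energy mulrA weight.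
pose psi z := \sum_(m < M) \sum_(k < 2 ^ m.+1) D ^+ m * phi m k z.
have D0 m : 0 <= D ^+ m by rewrite exprn_ge0// powR_ge0.
have psi_le (z : R * R) : psi z <= c * H0 z.
  have [zQ|zQ] := boolP (z \in Q); last first.
    rewrite /H0 indicE (negbTE zQ) !mulr0 /psi big1// => m _; rewrite big1// => k _.
    by rewrite /phi /H0 indicE (negbTE zQ) !(mulr0, mul0r).
  have gap0 : 0 <= gap z by exact: normr_ge0.
  move: zQ; rewrite inE => -[] /=; rewrite !in_itv/= => /andP[z10 z1T] /andP[z20 z2T].
  have psi_le : psi z <= \sum_(m < M) (gap z <= T / 2 ^+ m)%R%:R *
      (D ^+ m * (gap z `^ gam)) * H0 z.
    apply: ler_sum => m _.
    apply: (@le_trans _ _ (\sum_(k < 2 ^ m.+1) (k == dindex T m z.1 :> nat)%:R *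
        ((gap z <= T / 2 ^+ m)%R%:R * (D ^+ m * (gap z `^ gam)) * H0 z))).
      apply: ler_sum => k _; rewrite /phi.
      have -> : D ^+ m * (H0 z * gap z `^ gam * (\1_(ditv m k) z.1 * \1_(ditv m k) z.2)) =
         \1_(ditv m k) z.1 * \1_(ditv m k) z.2 * (D ^+ m * gap z `^ gam * H0 z) by ring.
      rewrite -[X in _ <= _ * X]mulrA [leRHS]mulrA; apply: ler_wpM2r.
        by apply: mulr_ge0 => //; apply: mulr_ge0 => //; exact: powR_ge0.
      rewrite !indicE; have [z1k|_] := boolP (z.1 \in ditv m k); last first.
        by rewrite mul0r mulr_ge0.
      have [z2k|_] := boolP (z.2 \in ditv m k); last first.
        by rewrite mulr0 mulr_ge0.
      move: z1k z2k; rewrite !inE /ditv/= !in_itv/= => z1k z2k.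
      have /eqP -> : dindex T m z.1 == k by apply/dindexP.
      have dS := dyadic_step T m k.
      rewrite eqxx !mul1r (_ : gap z <= _)//.
      by rewrite /gap ler_norml -dS; apply/andP; split; lra.
    rewrite -mulr_suml ler_piMl//.
      do 2?apply: mulr_ge0 => //; apply: mulr_ge0 => //; exact: powR_ge0.
    have [lt|ge] := ltnP (dindex T m z.1) (2 ^ m.+1).
      rewrite (bigD1 (Ordinal lt))//= eqxx big1 ?addr0// => k.
      by rewrite -val_eqE/= => /negbTE ->.
    by rewrite big1// => k _; rewrite ltn_eqF// (leq_trans (ltn_ord k)).
  apply: (le_trans psi_le); rewrite -mulr_suml; apply: ler_wpM2r => //.
  have := @geometric_sum_bound D (gap z `^ gam) (T `^ gam) (fun m => gap z <= T / 2 ^+ m) M D1 (powR_ge0 _ _) (powR_ge0 _ _).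
  apply => m gm; have -> : D ^+ m = (2 ^+ m) `^ gam.
    by rewrite /D exprn_powR.
  rewrite -powRM ?exprn_ge0//; apply: ge0_ler_powR; rewrite ?nnegrE ?mulr_ge0 ?exprn_ge0 ?(ltW gam_gt0) ?(ltW T_gt0)//.
  by rewrite mulrC -ler_pdivlMr// exprn_gt0.
have psiE : ((\sum_(m < M) \sum_(k < 2 ^ m.+1) D ^+ m * fine (E m k))%:E =
    \int[mu2]_z (psi z)%:E)%E.
  rewrite -sumEFin.
  transitivity (\sum_(m < M) \int[mu2]_z (\sum_(k < 2 ^ m.+1) (D ^+ m * phi m k z)%:E))%E.
    apply: eq_bigr => m _; rewrite -sumEFin ge0_integral_sum//; last 2 first.
    - by move=> k; apply/measurable_EFinP; exact: measurable_funM (measurable_cst _) (mphi _ _).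
    - by move=> k z _; rewrite lee_fin mulr_ge0.
    apply: eq_bigr => k _.
    under eq_integral do rewrite EFinM.
    rewrite ge0_integralZl_EFin//; last 2 first.
    - by move=> z _; rewrite lee_fin.
    - by apply/measurable_EFinP; exact: mphi.
    by rewrite EFinM fineK.
  rewrite -ge0_integral_sum//; last 2 first.
  - move=> m; apply: emeasurable_sum => k.
    by apply/measurable_EFinP; exact: measurable_funM (measurable_cst _) (mphi _ _).
  - by move=> m z _; apply: sume_ge0 => k _; rewrite lee_fin mulr_ge0.
  apply: eq_integral => z _; rewrite /psi -sumEFin; apply: eq_bigr => m _.
  by rewrite sumEFin.
rewrite -lee_fin fineK; last first.
  rewrite ge0_fin_numE ?mule_ge0 ?integral_ge0 ?lee_fin//.
    by rewrite lte_mul_pinfty ?lee_fin.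
  by move=> z _; rewrite lee_fin.
rewrite psiE -ge0_integralZl_EFin//; last 2 first.
- by move=> z _; rewrite lee_fin.
- exact/measurable_EFinP.
apply: ge0_le_integral_nomeas => z _.
  by rewrite lee_fin; apply: sumr_ge0 => m _; apply: sumr_ge0 => k _; rewrite mulr_ge0.
by rewrite -EFinM lee_fin; exact: psi_le.
Qed.

End Energy.

(** * Dyadic sizes of a Sobolev path *)

Section ControlOfTree.
Variables (R : realType) (en : nat -> nat -> R) (g b lam B : R).
Hypothesis en_ge0 : forall m k, 0 <= en m k.
Hypothesis en_half : forall m k, en m.+1 k <= g * en m k./2.
Hypothesis b_gt0 : 0 < b.
Hypothesis b_le : b <= g.
Hypothesis lam_gt0 : 0 < lam.
Hypothesis lam_b : 2 * lam * b < 1.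
Hypothesis en_sum : forall M,
  \sum_(m < M) lam ^+ m * (\sum_(k < 2 ^ m.+1) en m k) <= B.

Lemma sum_half (f : nat -> R) n : \sum_(k < 2 * n) f k./2 = 2 * \sum_(k < n) f k.
Proof.
elim: n => [|n IH]; first by rewrite muln0 !big_ord0 mulr0.
rewrite mulnS addSn add1n !big_ord_recr/= IH.
by rewrite mul2n half_double uphalf_double; ring.
Qed.

(** The smallest positive majorant that loses at most a factor [b] from parent to
    child is computed downwards from the root.  It remains summable: each value
    is passed to two children with total weight [2 * lam * b < 1]. *)
Lemma control_majorant : exists2 W : nat -> nat -> R, control g b W &
  (forall m k, en m k <= W m k) /\
  exists B', forall M, \sum_(m < M) lam ^+ m * (\sum_(k < 2 ^ m.+1) W m k) <= B'.
Proof.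
have g0 : 0 < g by exact: lt_le_trans b_le.
pose W := fix W m k := if m is m'.+1 then Num.max (en m k) (b * W m' k./2)
  else Num.max (en 0%N k) 1.
have W0 m k : 0 < W m k.
  elim: m k => [|m IH] k; first by rewrite /= lt_max ltr01 orbT.
  by rewrite /= lt_max (mulr_gt0 b_gt0 (IH _)) orbT.
have enW m k : en m k <= W m k by case: m => [|m]; rewrite /= le_max lexx.
exists W; first split=> [//|m k].
  split; first by rewrite /= le_max lexx orbT.
  rewrite /= ge_max; apply/andP; split; last by rewrite ler_wpM2r// ltW.
  by apply: (le_trans (en_half m k)); rewrite ler_wpM2l// ltW.
split=> //.
pose theta := 2 * lam * b.
pose s0 := \sum_(k < 2) W 0%N k.
have theta1 : 0 < 1 - theta by rewrite subr_gt0.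
have s00 : 0 <= s0 by apply: sumr_ge0 => k _; exact: ltW.
have B0 : 0 <= B by have := en_sum 0; rewrite big_ord0.
exists ((s0 + B) / (1 - theta)); elim=> [|M IH].
  by rewrite big_ord0; apply: divr_ge0; [exact: addr_ge0|exact: ltW].
rewrite big_ord_recl/= mul1r.
have step m : lam ^+ m.+1 * (\sum_(k < 2 ^ m.+2) W m.+1 k) <=
    lam ^+ m.+1 * (\sum_(k < 2 ^ m.+2) en m.+1 k) +
    theta * (lam ^+ m * (\sum_(k < 2 ^ m.+1) W m k)).
  have -> : theta * (lam ^+ m * (\sum_(k < 2 ^ m.+1) W m k)) =
      lam ^+ m.+1 * (\sum_(k < 2 ^ m.+2) b * W m k./2).
    rewrite [in RHS]expnS -mulr_sumr (sum_half (W m)) /theta exprS.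
    by ring.
  rewrite -mulrDr -big_split ler_wpM2l ?exprn_ge0 ?(ltW lam_gt0)//.
  apply: ler_sum => k _ /=; rewrite ge_max lerDl lerDr.
  by rewrite en_ge0 mulr_ge0 ?(ltW b_gt0) ?(ltW (W0 _ _)).
apply: (@le_trans _ _ (s0 + (B + theta * ((s0 + B) / (1 - theta))))); last first.
  rewrite le_eqVlt; apply/orP; left; apply/eqP.
  by field; rewrite gt_eqF.
rewrite lerD2l; apply: (@le_trans _ _ (\sum_(m < M)
   (lam ^+ m.+1 * (\sum_(k < 2 ^ m.+2) en m.+1 k) +
    theta * (lam ^+ m * (\sum_(k < 2 ^ m.+1) W m k))))).
  by apply: ler_sum => m _; exact: step.
rewrite big_split/= -mulr_sumr; apply: lerD; last first.
  by rewrite ler_wpM2l// mulr_ge0 ?(ltW b_gt0)// mulr_ge0 ?(ltW lam_gt0).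
apply: le_trans (en_sum M.+1); rewrite [leRHS]big_ord_recl/= lerDr mul1r.
by apply: sumr_ge0 => k _.
Qed.

End ControlOfTree.

Section Increments.
Variables (R : realType) (d : nat) (X : R -> 'rV[R]_d).
Hypothesis X_cont : forall i, continuous (fun t => X t 0 i).
Local Notation mu := (@lebesgue_measure R).
Variables (T q c a : R) (W : nat -> nat -> R).
Hypothesis T_gt0 : 0 < T.
Hypothesis q_gt0 : 0 < q.
Hypothesis c_gt0 : 0 < c.
Hypothesis a_gt0 : 0 < a.
Hypothesis a_lt1 : a < 1.
Hypothesis X_const : forall t, T <= t -> X t = X T.
Hypothesis W_gt0 : forall m k, 0 < W m k.
Hypothesis W_le : forall m k, W m.+1 k <= a `^ q * W m k./2.
Hypothesis W_mean : forall m k, (k < 2 ^ m)%N ->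
  (\int[mu]_(u in ditv T m k) \int[mu]_(v in ditv T m k)
     (euclidean_dist (X u) (X v) `^ q)%:E <=
   (c * (T / 2 ^+ m) ^+ 2 * W m k)%:E)%E.

Let F u v := euclidean_dist (X u) (X v).
Let l m := T / 2 ^+ m.

Let l_gt0 m : 0 < l m. Proof. by rewrite divr_gt0// exprn_gt0. Qed.

Let ditv_measure m k : mu (ditv T m k) = (l m)%:E.
Proof.
rewrite /ditv lebesgue_measure_itv/= lte_fin -subr_gt0 dyadic_step l_gt0.
by rewrite -EFinD dyadic_step.
Qed.

Let mditv m k : measurable (ditv T m k). Proof. exact: measurable_itv. Qed.

Let mF u : measurable_fun setT (fun v => (F u v `^ q)%:E).
Proof.
apply/measurable_EFinP; apply: measurable_powR_comp.
exact: (measurableT_comp (measurable_distance X_cont) (pair1_measurable u)).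
Qed.

Let F_ge0 u v : (0 <= (F u v `^ q)%:E)%E.
Proof. by rewrite lee_fin powR_ge0. Qed.

(** [W] lives on the scale of [q]-th powers of increments. *)
Definition omega m k := W m k `^ q^-1.

Let a_powK : (a `^ q) `^ q^-1 = a.
Proof. by rewrite -powRrM mulfV ?gt_eqF// powRr1// ltW. Qed.

Lemma omega_half m k : omega m.+1 k <= a * omega m k./2.
Proof.
rewrite -a_powK -powRM ?powR_ge0 ?(ltW (W_gt0 _ _))//.
apply: ge0_ler_powR; rewrite ?nnegrE ?invr_ge0 ?(ltW q_gt0) ?(ltW (W_gt0 _ _))//.
by rewrite mulr_ge0 ?powR_ge0 ?(ltW (W_gt0 _ _)).
Qed.

(** By Markov's inequality, since [W] bounds the mean of the distances over pairs
    of points of the interval. *)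
Let central_point : exists u : nat -> nat -> R, forall m k, (k < 2 ^ m)%N ->
  ditv T m k (u m k) /\
  (\int[mu]_(v in ditv T m k) (F (u m k) v `^ q)%:E <= (2 * (c * l m * W m k))%:E)%E.
Proof.
suff /choice[u Hu] : forall mk : nat * nat, exists u, (mk.2 < 2 ^ mk.1)%N ->
    ditv T mk.1 mk.2 u /\
    (\int[mu]_(v in ditv T mk.1 mk.2) (F u v `^ q)%:E <=
     (2 * (c * l mk.1 * W mk.1 mk.2))%:E)%E.
  by exists (fun m k => u (m, k)) => m k; exact: (Hu (m, k)).
move=> [m k] /=; have [km|] := boolP (k < 2 ^ m)%N; last by exists 0.
have [|||u uJ uW] := @integral_exists_le R _ _ mu (ditv T m k) (l m) (c * l m * W m k)
  (fun u => \int[mu]_(v in ditv T m k) (F u v `^ q)%:E)%E (mditv m k)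
  (ditv_measure m k) (l_gt0 m) _ _ _.
- by rewrite !mulr_gt0.
- by move=> u; exact: integral_ge0.
- apply: (le_trans (W_mean km)); rewrite lee_fin le_eqVlt; apply/orP; left.
  by apply/eqP; rewrite /l; ring.
by exists u.
Qed.

Let A0 := 2 * (12 * c) `^ q^-1.

(** The central points of an interval and of its half are both close to most
    points of the half, hence to a common one. *)
Let central_step (u : nat -> nat -> R) :
  (forall m k, (k < 2 ^ m)%N -> ditv T m k (u m k) /\
  (\int[mu]_(v in ditv T m k) (F (u m k) v `^ q)%:E <= (2 * (c * l m * W m k))%:E)%E) ->
  forall m k i, (k < 2 ^ m.+1)%N ->
  `|X (u m.+1 k) 0 i - X (u m k./2) 0 i| <= A0 * omega m k./2.
Proof.
move=> Hu m k i km; have km' : (k./2 < 2 ^ m)%N.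
  by move: km; rewrite expnS mul2n; move: (2 ^ m)%N => n; lia.
have [_ H1] := Hu m.+1 k km; have [_ H2] := Hu m k./2 km'.
set u1 := u m.+1 k in H1 *; set u2 := u m k./2 in H2 *.
have W'W : W m.+1 k <= W m k./2.
  apply: (le_trans (W_le m k)); rewrite ler_piMl ?(ltW (W_gt0 _ _))//.
  rewrite -(powRr0 a); apply: ltW; rewrite /powR gt_eqF// ltr_expR.
  by rewrite mul0r pmulr_rlt0// ln_lt0// a_gt0.
have [|||v vJ] := @integral_exists_le R _ _ mu (ditv T m.+1 k) (l m.+1)
    (6 * (c * W m k./2)) (fun v => (F u1 v `^ q)%:E + (F u2 v `^ q)%:E)%E
    (mditv m.+1 k) (ditv_measure m.+1 k) (l_gt0 m.+1) _ _ _.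
- by rewrite !mulr_gt0.
- by move=> v; exact: adde_ge0.
- rewrite ge0_integralD; first last.
  + exact (measurable_funTS (mF u2)).
  + by move=> v _; exact: F_ge0.
  + exact (measurable_funTS (mF u1)).
  + by move=> v _; exact: F_ge0.
  + exact: mditv.
  have H2' : (\int[mu]_(v in ditv T m.+1 k) (F u2 v `^ q)%:E <=
      (2 * (c * l m * W m k./2))%:E)%E.
    apply: le_trans H2; apply: ge0_subset_integral.
    - exact: mditv.
    - exact: mditv.
    - exact (measurable_funTS (mF u2)).
    - by move=> v _; exact: F_ge0.
    - exact: ditv_half.
  apply: (le_trans (leeD H1 H2')); rewrite -EFinD lee_fin.
  have -> : l m = 2 * l m.+1 by rewrite /l exprS; field; rewrite expf_neq0.
  have cl : 0 <= c * l m.+1 by rewrite mulr_ge0 ?(ltW c_gt0) ?(ltW (l_gt0 _)).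
  have := ler_wpM2l cl W'W; lra.
rewrite -EFinD lee_fin (_ : 2 * _ = 12 * c * W m k./2); last by ring.
move=> vW.
have small w : 0 <= w -> w `^ q <= 12 * c * W m k./2 -> w <= (12 * c) `^ q^-1 * omega m k./2.
  move=> w0 wW; have -> : w = (w `^ q) `^ q^-1.
    by rewrite -powRrM mulfV ?gt_eqF// powRr1.
  rewrite -powRM ?(ltW (W_gt0 _ _)) ?mulr_ge0 ?(ltW c_gt0)//.
  by apply: ge0_ler_powR; rewrite ?nnegrE ?invr_ge0 ?(ltW q_gt0) ?powR_ge0//
    !mulr_ge0 ?(ltW (W_gt0 _ _)) ?(ltW c_gt0).
have P1 := powR_ge0 (F u1 v) q; have P2 := powR_ge0 (F u2 v) q.
have S1 : F u1 v <= (12 * c) `^ q^-1 * omega m k./2.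
  by apply: small; [exact: sqrtr_ge0|apply: le_trans vW; rewrite lerDl; exact: P2].
have S2 : F u2 v <= (12 * c) `^ q^-1 * omega m k./2.
  by apply: small; [exact: sqrtr_ge0|apply: le_trans vW; rewrite lerDr; exact: P1].
have coord w : `|X w 0 i - X v 0 i| <= F w v.
  by have := ler_abs_euclidean_norm (X w - X v) i; rewrite !mxE.
have C1 := coord u1; have C2 := coord u2.
have -> : X u1 0 i - X u2 0 i = (X u1 0 i - X v 0 i) - (X u2 0 i - X v 0 i) by ring.
apply: (le_trans (ler_normB _ _)); rewrite /A0 -mulrA mulr_natl mulr2n.
exact: lerD (le_trans C1 S1) (le_trans C2 S2).
Qed.

Let chain (u : nat -> nat -> R) (kap : nat -> nat) m i n :
  (forall m k i, (k < 2 ^ m.+1)%N ->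
    `|X (u m.+1 k) 0 i - X (u m k./2) 0 i| <= A0 * omega m k./2) ->
  (forall j, (kap j.+1)./2 = kap j) -> (forall j, (kap j < 2 ^ (m + j))%N) ->
  `|X (u (m + n)%N (kap n)) 0 i - X (u m (kap 0%N)) 0 i| <=
    A0 / (1 - a) * omega m (kap 0%N).
Proof.
move=> step; have A00 : 0 <= A0 by rewrite mulr_ge0// powR_ge0.
have a1 : 0 < 1 - a by rewrite subr_gt0.
elim: n m kap => [|n IH] m kap kap2 kapm.
  rewrite addn0 subrr normr0 mulr_ge0 ?powR_ge0//.
  by apply: divr_ge0 => //; exact: ltW.
have kapm' j : (kap j.+1 < 2 ^ (m.+1 + j))%N by rewrite addSnnS.
have := IH m.+1 (fun j => kap j.+1) (fun j => kap2 j.+1) kapm'.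
rewrite addnS addSn => H.
have k1 : (kap 1%N < 2 ^ m.+1)%N by have := kapm' 0%N; rewrite addn0.
have S1 := step m (kap 1%N) i k1; rewrite kap2 in S1.
have O1 := omega_half m (kap 1%N); rewrite kap2 in O1.
have C0 : 0 <= A0 / (1 - a) by apply: divr_ge0 => //; exact: ltW.
have -> : A0 / (1 - a) * omega m (kap 0%N) =
    A0 / (1 - a) * (a * omega m (kap 0%N)) + A0 * omega m (kap 0%N).
  by field; rewrite gt_eqF.
rewrite -(subrKA (X (u m.+1 (kap 1%N)) 0 i)).
apply: (le_trans (ler_normD _ _)); apply: lerD => //.
by apply: (le_trans H); exact: ler_wpM2l.
Qed.

Let chain_limit (u : nat -> nat -> R) (kap : nat -> nat) m i y :
  (forall m k, (k < 2 ^ m)%N -> ditv T m k (u m k)) ->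
  (forall m k i, (k < 2 ^ m.+1)%N ->
    `|X (u m.+1 k) 0 i - X (u m k./2) 0 i| <= A0 * omega m k./2) ->
  (forall j, (kap j.+1)./2 = kap j) -> (forall j, (kap j < 2 ^ (m + j))%N) ->
  (forall j, dyadic T (m + j) (kap j) <= y <= dyadic T (m + j) (kap j).+1) ->
  `|X y 0 i - X (u m (kap 0%N)) 0 i| <= A0 / (1 - a) * omega m (kap 0%N).
Proof.
move=> uJ step kap2 kapm yk.
have uy : (fun n => u (m + n)%N (kap n)) @ \oo --> y.
  have l0 : (fun n => l (m + n)) @ \oo --> (0 : R).
    have -> : (fun n => l (m + n)) = (fun n => l m * (2^-1) ^+ n).
      by apply/funext => n; rewrite /l exprD exprVn invfM mulrA.
    rewrite -[X in _ --> X](mulr0 (l m)); apply: cvgM; first exact: cvg_cst.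
    by apply: cvg_expr; rewrite ger0_norm// invf_lt1// ltr1n.
  apply/cvgrPdist_le => eps eps0; move/cvgrPdist_le : l0 => /(_ _ eps0).
  apply: filterS => n; rewrite sub0r normrN (ger0_norm (ltW (l_gt0 _))) => le.
  apply: (le_trans _ le); rewrite /l -(dyadic_step T (m + n) (kap n)).
  have := uJ _ _ (kapm n); rewrite /ditv/= in_itv/= => /andP[h1 h2].
  have /andP[h3 h4] := yk n.
  by rewrite ler_norml; apply/andP; split; lra.
have Xuy : (fun n => `|X (u (m + n)%N (kap n)) 0 i - X (u m (kap 0%N)) 0 i|) @ \oo -->
    `|X y 0 i - X (u m (kap 0%N)) 0 i|.
  apply: cvg_norm; apply: cvgB; last exact: cvg_cst.
  exact: (cvg_comp _ _ uy (@X_cont i y)).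
apply: (cvgr_to_le Xuy); apply: nearW => n.
exact: chain.
Qed.

(** Joining the central points of nested dyadic intervals that shrink to an end
    point bounds the increments of [X]. *)
Lemma increment_bound : exists2 A : R, 0 <= A &
  forall m k i, `|(X (dyadic T m k.+1) - X (dyadic T m k)) 0 i| <= A * omega m k.
Proof.
have A00 : 0 <= A0 by rewrite mulr_ge0// powR_ge0.
have C0 : 0 <= A0 / (1 - a) by apply: divr_ge0 => //; rewrite subr_ge0 ltW.
have [u Hu] := central_point.
have step := central_step Hu.
have uJ m k : (k < 2 ^ m)%N -> ditv T m k (u m k) by move=> /Hu[].
exists (2 * (A0 / (1 - a))); first by rewrite mulr_ge0.
move=> m k i; have [km|mk] := ltnP k (2 ^ m); last first.
  have Tk : T <= dyadic T m k.
    rewrite /dyadic ler_pdivlMr ?exprn_gt0// ler_pM2l// -natrX ler_nat//.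
  have Tk1 : T <= dyadic T m k.+1 by apply: (le_trans Tk); exact: dyadic_le.
  rewrite (X_const Tk) (X_const Tk1) subrr mxE normr0.
  by rewrite mulr_ge0 ?powR_ge0// mulr_ge0.
pose kl := fix kl j := if j is j'.+1 then (kl j').*2 else k.
pose kr := fix kr j := if j is j'.+1 then (kr j').*2.+1 else k.
have klm j : (kl j < 2 ^ (m + j))%N.
  by elim: j => [|j IH]; rewrite ?addn0// addnS expnS mul2n ltn_double.
have krm j : (kr j < 2 ^ (m + j))%N.
  by elim: j => [|j IH]; rewrite ?addn0// addnS expnS mul2n ltn_Sdouble.
have kly j : dyadic T (m + j) (kl j) = dyadic T m k.
  by elim: j => [|j IH]; rewrite ?addn0// addnS /= dyadicS.
have kry j : dyadic T (m + j) (kr j).+1 = dyadic T m k.+1.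
  by elim: j => [|j IH]; rewrite ?addn0// addnS /= -doubleS dyadicS.
have kl2 j : (kl j.+1)./2 = kl j by rewrite /= doubleK.
have kr2 j : (kr j.+1)./2 = kr j by rewrite /= uphalf_double.
have L := @chain_limit u kl m i (dyadic T m k) uJ step kl2 klm _.
have Rr := @chain_limit u kr m i (dyadic T m k.+1) uJ step kr2 krm _.
have {}L : `|X (dyadic T m k) 0 i - X (u m k) 0 i| <= A0 / (1 - a) * omega m k.
  by apply: L => j; rewrite -(kly j) lexx dyadic_le.
have {}Rr : `|X (dyadic T m k.+1) 0 i - X (u m k) 0 i| <= A0 / (1 - a) * omega m k.
  by apply: Rr => j; rewrite -(kry j) lexx andbT dyadic_le.
have -> : (X (dyadic T m k.+1) - X (dyadic T m k)) 0 i =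
    (X (dyadic T m k.+1) 0 i - X (u m k) 0 i) -
    (X (dyadic T m k) 0 i - X (u m k) 0 i) by rewrite !mxE; ring.
by apply: (le_trans (ler_normB _ _)); lra.
Qed.

End Increments.

(** * Sobolev energy of controlled paths *)

Section SobolevIntegral.
Variable R : realType.
Local Notation mu := (@lebesgue_measure R).
Local Notation mu2 := (mu \x mu)%E.

Lemma dyadic_scale (T x : R) : 0 < x -> x <= T ->
  exists m, T / 2 ^+ m.+1 < x <= T / 2 ^+ m.
Proof.
move=> x0 xT.
have ex : exists n, T / 2 ^+ n < x.
  exists (Num.truncn (T / x)).+1; rewrite ltr_pdivrMr ?exprn_gt0// mulrC -ltr_pdivrMr//.
  apply: (lt_le_trans (truncnS_gt _)); rewrite -natrX ler_nat; exact: ltnW (ltn_expl _ _).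
case: (ex_minnP ex) => -[|n] nx nmin.
  by move: nx; rewrite expr0 divr1 ltNge xT.
exists n; rewrite nx leNgt; apply/negP => /nmin; by rewrite ltnn.
Qed.

Lemma integral_rectangle (A B : set R) : measurable A -> measurable B ->
  (\int[mu2]_z (\1_A z.1 * \1_B z.2 : R)%:E = mu A * mu B)%E.
Proof.
move=> mA mB.
transitivity (\int[mu2]_z (\1_(A `*` B) z : R)%:E)%E.
  apply: eq_integral => z _; rewrite !indicE in_setX.
  by case: (_ \in A); rewrite ?mul1r ?mul0r.
rewrite integral_indic ?setIT; [exact: product_measure1E|exact: measurableT|].
exact: measurableX.
Qed.

Variables (T q alpha C B : R) (W : nat -> nat -> R).
Hypothesis T_gt0 : 0 < T.
Hypothesis q_gt0 : 0 < q.
Hypothesis alpha_gt0 : 0 < alpha.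
Hypothesis W_gt0 : forall m k, 0 < W m k.
Hypothesis W_sum : forall M,
  \sum_(m < M) (2 `^ (alpha * q - 1)) ^+ m * (\sum_(k < 2 ^ m.+1) W m k) <= B.

Lemma powRD_le (x y : R) : 0 <= x -> 0 <= y ->
  (x + y) `^ q <= 2 `^ q * (x `^ q + y `^ q).
Proof.
wlog xy : x y / x <= y.
  move=> H x0 y0; have [xy|/ltW yx] := leP x y; first exact: H.
  by rewrite addrC [X in _ * X]addrC; exact: H.
move=> x0 y0; apply: (@le_trans _ _ ((2 * y) `^ q)).
  apply: ge0_ler_powR; rewrite ?nnegrE ?(ltW q_gt0) ?addr_ge0 ?mulr_ge0//.
  by rewrite mulr_natl mulr2n lerD2r.
by rewrite powRM// ler_wpM2l ?powR_ge0// lerDr powR_ge0.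
Qed.

Let l m : R := T / 2 ^+ m.

Let l_gt0 m : 0 < l m. Proof. by rewrite divr_gt0// exprn_gt0. Qed.

Let bigitv m k : set R := [set` `[dyadic T m k - l m, dyadic T m k.+1 + l m] ].

Let rect m k (z : R * R) : R :=
  \1_(ditv T m k) z.1 * \1_(bigitv m k) z.2 +
  \1_(bigitv m k) z.1 * \1_(ditv T m k) z.2.

Let rect_ge0 m k z : 0 <= rect m k z.
Proof. by rewrite addr_ge0// mulr_ge0. Qed.

Let mditv m k : measurable (ditv T m k). Proof. exact: measurable_itv. Qed.

Let mbigitv m k : measurable (bigitv m k). Proof. exact: measurable_itv. Qed.

Let mprod (D E : set R) : measurable D -> measurable E ->
  measurable_fun setT (fun z : R * R => \1_D z.1 * \1_E z.2 : R).
Proof.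
move=> mD mE.
have iD : measurable_fun setT (\1_D : R -> R) by exact: measurable_indic.
have iE : measurable_fun setT (\1_E : R -> R) by exact: measurable_indic.
apply: measurable_funM; first exact: (measurableT_comp iD measurable_fst).
exact: (measurableT_comp iE measurable_snd).
Qed.

Let mrect m k : measurable_fun setT (rect m k).
Proof. by apply: measurable_funD; exact: mprod. Qed.

Let integral_rect m k : (\int[mu2]_z (rect m k z)%:E = (6 * l m ^+ 2)%:E)%E.
Proof.
have dS := dyadic_step T m k.
have mud : mu (ditv T m k) = (l m)%:E.
  rewrite /ditv lebesgue_measure_itv/= lte_fin -subr_gt0 dS -/(l m) l_gt0.
  by rewrite -EFinD dS.
have mub : mu (bigitv m k) = (3 * l m)%:E.
  have lm := l_gt0 m; rewrite -/(l m) in dS.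
  rewrite /bigitv lebesgue_measure_itv/= lte_fin ifT; last by lra.
  by rewrite -EFinD; congr EFin; lra.
under eq_integral do rewrite EFinD.
rewrite ge0_integralD; first last.
- by apply/measurable_EFinP; exact: mprod.
- by move=> z _; rewrite lee_fin mulr_ge0.
- by apply/measurable_EFinP; exact: mprod.
- by move=> z _; rewrite lee_fin mulr_ge0.
- exact: measurableT.
rewrite !integral_rectangle// mud mub -!EFinM -EFinD; congr EFin; ring.
Qed.

(** A function of two points controlled along the dyadic tree by a summable
    family has finite Sobolev energy: cover each strip
    [T / 2 ^ (m + 1) < |t - s| <= T / 2 ^ m] by rectangles of that scale. *)
Lemma sobolev_integral_fin (D : R -> R -> R) :
  (forall s t, 0 <= D s t) ->
  (forall m s t, 0 <= s <= T -> 0 <= t <= T -> `|t - s| <= T / 2 ^+ m ->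
    D s t <= C * (omega q W m (dindex T m s) + omega q W m (dindex T m t))) ->
  (\int[mu2]_(z in [set` `[0%R, T]] `*` [set` `[0%R, T]])
     (D z.1 z.2 `^ q / `|z.2 - z.1| `^ (alpha * q + 1))%:E < +oo)%E.
Proof.
move=> D0 DC.
have C0 : 0 <= C.
  rewrite leNgt; apply/negP => C0.
  have := DC 0%N 0 0; rewrite lexx subrr normr0 (ltW T_gt0) expr0 divr1.
  move=> /(_ isT isT (ltW T_gt0)); apply/negP; rewrite -ltNge.
  apply: lt_le_trans (D0 0 0); rewrite nmulr_rlt0// addr_gt0// powR_gt0//.
pose K := C `^ q * 2 `^ q * (2 / T) `^ (alpha * q + 1).
have K0 : 0 <= K by rewrite !mulr_ge0 ?powR_ge0.
pose nu := 2 `^ (alpha * q + 1) : R.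
have nu0 m : 0 <= K * nu ^+ m by rewrite mulr_ge0// exprn_ge0// powR_ge0.
pose h m (z : R * R) := \sum_(k < 2 ^ m.+1) K * nu ^+ m * W m k * rect m k z.
have h_ge0 m z : 0 <= h m z.
  by apply: sumr_ge0 => k _; rewrite mulr_ge0// mulr_ge0// ltW.
have mh m : measurable_fun setT (fun z => (h m z)%:E).
  apply/measurable_EFinP; apply: measurable_sum => k.
  by apply: measurable_funM; [exact: measurable_cst|exact: mrect].
have int_h m : (\int[mu2]_z (h m z)%:E =
    (6 * K * T ^+ 2 * ((2 `^ (alpha * q - 1)) ^+ m * (\sum_(k < 2 ^ m.+1) W m k)))%:E)%E.
  transitivity (\sum_(k < 2 ^ m.+1) (K * nu ^+ m * W m k * (6 * l m ^+ 2))%:E)%E.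
    under eq_integral do rewrite /h -sumEFin.
    rewrite ge0_integral_sum; first last.
    - by move=> k z _; rewrite lee_fin mulr_ge0// mulr_ge0// ltW.
    - move=> k; apply/measurable_EFinP.
      by apply: measurable_funM; [exact: measurable_cst|exact: mrect].
    - exact: measurableT.
    apply: eq_bigr => k _; under eq_integral do rewrite EFinM.
    rewrite ge0_integralZl_EFin; first last.
    - by rewrite mulr_ge0// ltW.
    - by apply/measurable_EFinP; exact: mrect.
    - by move=> z _; rewrite lee_fin.
    - exact: measurableT.
    by rewrite integral_rect -EFinM.
  rewrite sumEFin -mulr_suml -mulr_sumr; congr EFin.
  have -> : nu ^+ m = (2 `^ (alpha * q - 1)) ^+ m * (2 ^+ m) ^+ 2.
    rewrite -exprM mulnC exprM -exprMn; congr (_ ^+ _).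
    rewrite /nu -powR_mulrn// -powRD ?pnatr_eq0 ?implybT//; congr (_ `^ _); ring.
  by rewrite /l; field; rewrite expf_neq0.
apply: (@le_lt_trans _ _ (\int[mu2]_z (\sum_(0 <= m <oo) (h m z)%:E))%E); last first.
  rewrite integral_nneseries//; last by move=> m z _; rewrite lee_fin.
  apply: (@le_lt_trans _ _ (6 * K * T ^+ 2 * B)%:E); last exact: ltry.
  apply: lime_le; first by apply: is_cvg_nneseries => m _ _; apply: integral_ge0 => z _; rewrite lee_fin.
  apply: nearW => M; under eq_bigr do rewrite int_h.
  rewrite sumEFin lee_fin -mulr_sumr big_mkord ler_wpM2l//.
  by rewrite mulr_ge0 ?sqr_ge0// mulr_ge0.
rewrite integral_mkcond; apply: ge0_le_integral_nomeas => z _.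
  by rewrite patchE; case: ifP => // _; rewrite lee_fin divr_ge0 ?powR_ge0.
rewrite patchE; case: ifPn => [|_]; last first.
  by apply: nneseries_ge0 => m _ _; rewrite lee_fin.
case: z => s t; rewrite inE => -[] /=; rewrite !in_itv/= => sT tT.
have ser0 : (0 <= \sum_(0 <= m <oo) (h m (s, t))%:E)%E.
  by apply: nneseries_ge0 => m _ _; rewrite lee_fin.
have [tE|ts] := eqVneq t s.
  rewrite tE in ser0 *.
  have aq : alpha * q + 1 != 0 by apply/lt0r_neq0/addr_gt0 => //; exact: mulr_gt0.
  by rewrite /= subrr normr0 powR0// invr0 mulr0.
have gt0 : 0 < `|t - s| by rewrite normr_gt0 subr_eq0.
have gT : `|t - s| <= T.
  move: sT tT => /andP[s0 sT] /andP[t0 tT].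
  by rewrite ler_norml; apply/andP; split; lra.
have [m /andP[m1 m2]] := dyadic_scale gt0 gT.
have pos m' k : (0 <= (h m' (s, t))%:E)%E by rewrite lee_fin.
apply: (@le_trans _ _ (\sum_(0 <= i < m.+1) (h i (s, t))%:E)%E); last first.
  by apply: nneseries_lim_ge => n _ _; rewrite lee_fin.
rewrite sumEFin lee_fin big_nat_recr//=.
apply: (@le_trans _ _ (h m (s, t))); last first.
  by rewrite lerDr; apply: sumr_ge0.
have omq k : omega q W m k `^ q = W m k.
  by rewrite /omega -powRrM mulVf ?gt_eqF// powRr1// ltW.
have Dq : D s t `^ q <= C `^ q * 2 `^ q * (W m (dindex T m s) + W m (dindex T m t)).
  apply: (@le_trans _ _ ((C * (omega q W m (dindex T m s) + omega q W m (dindex T m t))) `^ q)).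
    apply: ge0_ler_powR; rewrite ?nnegrE ?(ltW q_gt0)//; last exact: DC.
    by rewrite mulr_ge0 ?addr_ge0 ?powR_ge0.
  rewrite powRM ?addr_ge0 ?powR_ge0// -mulrA ler_wpM2l ?powR_ge0//.
  by apply: (le_trans (powRD_le (powR_ge0 _ _) (powR_ge0 _ _))); rewrite !omq lexx.
have gapV : (`|t - s| `^ (alpha * q + 1))^-1 <= (2 / T) `^ (alpha * q + 1) * nu ^+ m.
  rewrite /nu exprn_powR// -powRM ?exprn_ge0 ?divr_ge0 ?(ltW T_gt0)//.
  rewrite -powRN -[- (_ * _ + _)]mulN1r powRrM; apply: ge0_ler_powR.
  - by rewrite addr_ge0// mulr_ge0 ?(ltW alpha_gt0) ?(ltW q_gt0).
  - by rewrite nnegrE powR_ge0.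
  - by rewrite nnegrE mulr_ge0 ?exprn_ge0 ?divr_ge0 ?(ltW T_gt0).
  rewrite powR_inv1 ?(ltW gt0)// -[leRHS]invrK lef_pV2 ?posrE ?invr_gt0//.
    by rewrite invfM invf_div -mulrA -invfM -exprS ltW.
  by rewrite mulr_gt0 ?exprn_gt0 ?divr_gt0.
apply: (@le_trans _ _ (K * nu ^+ m * W m (dindex T m s) + K * nu ^+ m * W m (dindex T m t))).
  apply: (le_trans (ler_pM _ _ Dq gapV)); rewrite ?invr_ge0 ?powR_ge0//.
  by rewrite /K le_eqVlt; apply/orP; left; apply/eqP; ring.
have dT u : 0 <= u <= T -> (dindex T m u < 2 ^ m.+1)%N.
  move=> /andP[u0 uT]; have /andP[du _] := dindex_itv T_gt0 m u0.
  have : dyadic T m (dindex T m u) <= T by exact: le_trans uT.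
  rewrite /dyadic ler_pdivrMr ?exprn_gt0// ler_pM2l// -natrX ler_nat => /leq_ltn_trans; apply.
  by rewrite ltn_exp2l.
have lm := l_gt0 m.
have near (u v : R) : 0 <= u -> 0 <= v -> `|v - u| <= T / 2 ^+ m ->
    (\1_(ditv T m (dindex T m u)) u : R) * \1_(bigitv m (dindex T m u)) v = 1 :> R.
  move=> u0 v0 uv; have /andP[du ud] := dindex_itv T_gt0 m u0.
  move: uv; rewrite ler_norml -/(l m) => /andP[uv vu].
  have uJ : ditv T m (dindex T m u) u by rewrite /ditv/= in_itv/= du.
  have vJ : bigitv m (dindex T m u) v.
    by rewrite /bigitv/= in_itv/=; apply/andP; split; lra.
  by rewrite !indicE !mem_set// mulr1.
rewrite /h; have -> : \sum_(k < 2 ^ m.+1) K * nu ^+ m * W m k * rect m k (s, t) =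
   \sum_(k < 2 ^ m.+1) K * nu ^+ m * W m k * (\1_(ditv T m k) s * \1_(bigitv m k) t) +
   \sum_(k < 2 ^ m.+1) K * nu ^+ m * W m k * (\1_(ditv T m k) t * \1_(bigitv m k) s).
  rewrite -big_split; apply: eq_bigr => k _ /=; rewrite /rect/=; ring.
have term_ge0 k (u v : R) : 0 <= K * nu ^+ m * W m k * (\1_(ditv T m k) u * \1_(bigitv m k) v).
  by apply: mulr_ge0; [apply: mulr_ge0 => //; exact: ltW|exact: mulr_ge0].
have s0 : 0 <= s by case/andP: sT.
have t0 : 0 <= t by case/andP: tT.
apply: lerD.
  rewrite (bigD1 (Ordinal (dT s sT)))//= near// mulr1 lerDl.
  by apply: sumr_ge0 => k _; exact: term_ge0.
rewrite (bigD1 (Ordinal (dT t tT)))//= near// 1?distrC// mulr1 lerDl.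
by apply: sumr_ge0 => k _; exact: term_ge0.
Qed.

End SobolevIntegral.

(** * Lifting Sobolev paths *)

Section Stopping.
Variables (R : realType) (T : R).
Hypothesis T_gt0 : 0 < T.

(** The projection on [0, T], by which paths are extended to the line. *)
Definition stop (t : R) : R := Num.min (Num.max t 0) T.

Lemma stop_itv t : 0 <= stop t <= T.
Proof. by rewrite /stop le_min le_max lexx orbT ltW//= ge_min lexx orbT. Qed.

Lemma stop_id t : 0 <= t <= T -> stop t = t.
Proof. by move=> /andP[t0 tT]; rewrite /stop max_l// min_l. Qed.

Lemma stop_ge t : T <= t -> stop t = stop T.
Proof.
move=> Tt; have T0 := ltW T_gt0.
by rewrite /stop !max_l ?min_r// (le_trans T0).
Qed.

Lemma stop_lipschitz s t : `|stop t - stop s| <= `|t - s|.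
Proof.
wlog st : s t / s <= t.
  move=> H; have [st|/ltW ts] := leP s t; first exact: H.
  by rewrite distrC [leRHS]distrC; exact: H.
have mono : stop s <= stop t.
  rewrite /stop le_min !ge_min lexx orbT andbT.
  by apply/orP; left; rewrite ge_max !le_max st lexx orbT.
rewrite !ger0_norm ?subr_ge0//.
rewrite /stop /Num.min /Num.max; have T0 := T_gt0.
by repeat case: ifPn => //; rewrite -?leNgt => *; lra.
Qed.

Lemma stop_continuous d (X : R -> 'rV[R]_d) i :
  continuous_on (@euclidean_dist R d) 0 T X -> continuous (fun t => X (stop t) 0 i).
Proof.
move=> /continuous_onP XC s; apply/cvgrPdist_lt => e e0.
have [delta d0 Hd] := XC (stop s) e (stop_itv s) e0.
apply/nbhs_ballP; exists delta => //= t; rewrite /ball/= distrC => ts.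
have := Hd (stop t) (stop_itv t) (le_lt_trans (stop_lipschitz s t) ts).
apply: le_lt_trans; apply: le_trans (ler_norm _).
by have := ler_abs_euclidean_norm (X (stop s) - X (stop t)) i; rewrite !mxE.
Qed.

End Stopping.

Section SobolevLift.
Variables (R : realType) (T : R) (d N : nat) (a b A : R) (om : nat -> nat -> R).
Variable X : R -> 'rV[R]_d.
Hypothesis T_gt0 : 0 < T.
Hypothesis N_gt0 : (0 < N)%N.
Hypothesis om_control : control a b om.
Hypothesis a_gt0 : 0 < a.
Hypothesis a_lt1 : a < 1.
Hypothesis b_gt0 : 0 < b.
Hypothesis bN : 1 < 2 * b ^+ N.
Hypothesis A_ge0 : 0 <= A.
Hypothesis X_cont : continuous_on (@euclidean_dist R d) 0 T X.
Hypothesis X_om : forall m k i,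
  `|(X (stop T (dyadic T m k.+1)) - X (stop T (dyadic T m k))) 0 i| <= A * om m k.

(** The sizes tend to zero uniformly over [0, T], which gives the continuity of the
    lift. *)
Lemma controlled_lift : exists XX : R -> free_group R d N, exists C : R,
  [/\ continuous_on (@cc_dist R d N) 0 T XX,
    forall t, t \in `[0, T] -> pi1 (val (XX t)) = X t,
    forall t, cc_dist (XX t) (XX t) = 0 &
    forall m s t, 0 <= s <= T -> 0 <= t <= T -> `|t - s| <= T / 2 ^+ m ->
      cc_dist (XX s) (XX t) <= C * (om m (dindex T m s) + om m (dindex T m t))].
Proof.
have Xc i : continuous (fun t => X (stop T t) 0 i).
  exact: stop_continuous.
have [XX [C C0 [XXG XX1 XXC]]] := lift_path N_gt0 T_gt0 om_control a_gt0 a_lt1 b_gt0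
  bN A_ge0 X_om Xc.
pose YY (t : R) : free_group R d N :=
  exist _ (XX t) (mem_set (grp_free_group (XXG t))).
have YYC m s t : 0 <= s <= T -> 0 <= t <= T -> `|t - s| <= T / 2 ^+ m ->
    cc_dist (YY s) (YY t) <= C * (om m (dindex T m s) + om m (dindex T m t)).
  by move=> /andP[s0 _] /andP[t0 _]; exact: XXC.
exists YY, C; split => //.
- apply/continuous_onP => s e; rewrite in_itv/= => sT e0.
  pose M := om 0 0 + om 0 1.
  have om0 m k : 0 <= om m k by apply: ltW; have [->] := om_control.
  have omM m t : 0 <= t <= T -> om m (dindex T m t) <= a ^+ m * M.
    move=> /andP[t0 tT].
    have := om_geometric T_gt0 om_control a_gt0 0 m t0; rewrite add0n.
    move=> /le_trans; apply; rewrite ler_wpM2l ?exprn_ge0 ?(ltW a_gt0)//.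
    have /andP[d0 _] := dindex_itv T_gt0 0 t0.
    have : dyadic T 0 (dindex T 0 t) <= T by exact: le_trans tT.
    rewrite /dyadic expr0 divr1 ger_pMr// -[1]/(1%:R) ler_nat /M.
    by case: (dindex T 0 t) => [|[|]]//= _; rewrite ?lerDl ?lerDr.
  have : (fun m => C * (a ^+ m * M + a ^+ m * M)) @ \oo --> (0 : R).
    rewrite -(mulr0 C); apply: cvgM; first exact: cvg_cst.
    rewrite -(addr0 0); apply: cvgD; rewrite -(mul0r M); apply: cvgM; try exact: cvg_cst;
      by apply: cvg_expr; rewrite ger0_norm// ltW.
  move=> /cvgrPdist_lt/(_ e e0)[m _ Hm].
  exists (T / 2 ^+ m); first by rewrite divr_gt0// exprn_gt0.
  move=> t; rewrite in_itv/= => tT ts; rewrite ger0_norm ?cc_norm_ge0//.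
  apply: (le_lt_trans (YYC m s t sT tT (ltW ts))).
  have := Hm m (leqnn m); rewrite /= sub0r normrN; apply: le_lt_trans.
  apply: le_trans (ler_norm _); rewrite ler_wpM2l//.
  by rewrite lerD ?omM.
- by move=> t; rewrite in_itv/= => tT; rewrite /= XX1 ?stop_id//; case/andP: tT.
- move=> t; have [s sE] := grp_wexpP (XXG t).
  apply/eqP; rewrite eq_le cc_norm_ge0 andbT /cc_dist /= -sE mulVr ?wexp_unit//.
  by rewrite -(wexp_nil _ _ N) (le_trans (cc_norm_wexp _ _))// wlen_nil.
Qed.

End SobolevLift.

Lemma powR2_lt1 (R : realType) (x : R) : x < 0 -> 2 `^ x < 1.
Proof.
by move=> x0; rewrite /powR gt_eqF// -[ltRHS]expR0 ltr_expR nmulr_rlt0// ln_gt0 ?ltr1n.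
Qed.

Lemma powR2_gt1 (R : realType) (x : R) : 0 < x -> 1 < 2 `^ x.
Proof.
by move=> x0; rewrite /powR gt_eqF// -[ltLHS]expR0 ltr_expR mulr_gt0// ln_gt0 ?ltr1n.
Qed.

(** The bounds [2 ^ (- beta m)] decrease slowly enough for the lift to level [N]
    when [beta N < 1]. *)
Lemma powR2_step (R : realType) (beta : R) (N : nat) : beta * N%:R < 1 ->
  1 < 2 * (2 `^ (- beta)) ^+ N.
Proof.
move=> bN; rewrite -powR_mulrn ?powR_ge0// -powRrM.
rewrite -[X in X * _](powRr1 (ler0n R 2)) -powRD ?pnatr_eq0 ?implybT//.
by apply: powR2_gt1; lra.
Qed.

Theorem corollary2p5 (R : realType) (T : R) (d : nat) (alpha : R) (p : \bar R)
    (T_gt0 : 0 < T) (alpha_gt0 : 0 < alpha) (alpha_lt1 : alpha < 1)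
    (p_ge1 : (1 <= p)%E) (alpha_p : (p^-1 < alpha%:E)%E)
    (alphaV_notin : ~ exists2 n : nat, n <> 1%N & alpha^-1 = n%:R)
    (X : R -> 'rV[R]_d)
    (X_sobolev : sobolev_path (@euclidean_dist R d) alpha p T X) :
  exists XX : R -> free_group R d (Num.truncn alpha^-1),
    sobolev_path (@cc_dist R d (Num.truncn alpha^-1)) alpha p T XX /\
    forall t, t \in `[0, T] -> pi1 (val (XX t)) = X t.
Proof.
set N := Num.truncn alpha^-1.
have V1 : 1 < alpha^-1 by rewrite invf_gt1.
have /andP[NV _] : N%:R <= alpha^-1 < N.+1%:R by apply: truncn_itv; rewrite invr_ge0 ltW.
have N_gt0 : (0 < N)%N by rewrite truncn_gt0 ltW.
have alphaN : alpha * N%:R < 1.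
  rewrite mulrC -ltr_pdivlMr// div1r lt_neqAle NV andbT.
  apply/negP => /eqP NE; apply: alphaV_notin; exists N => // N1.
  by move: V1; rewrite -NE N1 ltxx.
have [X_cont X_reg] := X_sobolev.
case: p p_ge1 alpha_p X_reg {X_sobolev} => [q| |] q1 alpha_q X_reg; last by [].
- have {}q1 : 1 <= q by rewrite -lee_fin.
  have q_gt0 : 0 < q by exact: lt_le_trans q1.
  have aq : 1 < alpha * q.
    move: alpha_q; rewrite inver gt_eqF// lte_fin -ltr_pdivrMr//; by rewrite div1r.
  pose Xs t := X (stop T t).
  have Xs_cont i : continuous (fun t => Xs t 0 i) by exact: stop_continuous.
  (* Any [0 < e < alpha * q - 1] would do here, and below any [beta] strictly
     between [alpha] and [1 / N]; there is room for [beta] because [1 / alpha] is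
     not an integer above one. *)
  pose e := (alpha * q - 1) / 2.
  have e_gt0 : 0 < e by rewrite /e; lra.
  have gam_gt0 : 0 < alpha * q - 1 - e by rewrite /e; lra.
  pose beta := (alpha + N%:R^-1) / 2.
  have NV' : alpha < N%:R^-1 by rewrite -div1r ltr_pdivlMr// ltr0n.
  have alpha_beta : alpha < beta by rewrite /beta; lra.
  have betaN : beta * N%:R < 1.
    rewrite -ltr_pdivlMr ?ltr0n// div1r /beta; lra.
  pose g := 2 `^ (- e) : R; pose bq := 2 `^ (- (beta * q)) : R.
  have H_fin : (\int[lebesgue_measure \x lebesgue_measure]_(z in
       [set` `[0%R, T]] `*` [set` `[0%R, T]])
       (euclidean_dist (Xs z.1) (Xs z.2) `^ q / `|z.2 - z.1| `^ (alpha * q + 1))%:E < +oo)%E.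
    apply: le_lt_trans X_reg; rewrite le_eqVlt; apply/orP; left; apply/eqP.
    apply: eq_integral => z; rewrite inE => -[] /=; rewrite !in_itv/= => z1 z2.
    by rewrite /Xs !stop_id.
  have [B en_sum] := energy_sum Xs_cont T_gt0 gam_gt0 H_fin.
  have bq_g : bq <= g.
    apply: ler_powR; rewrite ?ler1n// lerN2.
    have : alpha * q < beta * q by rewrite ltr_pM2r.
    rewrite /e; lra.
  have lam_b : 2 * 2 `^ (alpha * q - 1) * bq < 1.
    rewrite -[X in X * _ * _](powRr1 (ler0n R 2)) -!powRD ?pnatr_eq0 ?implybT//.
    apply: powR2_lt1; have : alpha * q < beta * q by rewrite ltr_pM2r.
    lra.
  have [W [W_gt0 W_step] [enW [B' W_sum]]] := control_majorant
    (energy_ge0 Xs T q alpha e) (energy_half Xs_cont T_gt0 gam_gt0 H_fin)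
    (powR_gt0 _ (ltr0n R 2)) bq_g (powR_gt0 _ (ltr0n R 2)) lam_b en_sum.
  pose a := 2 `^ (- (e / q)) : R; pose b := 2 `^ (- beta) : R.
  have a_gt0 : 0 < a by exact: powR_gt0.
  have a_lt1 : a < 1 by apply: powR2_lt1; rewrite oppr_lt0 divr_gt0.
  have b_gt0 : 0 < b by exact: powR_gt0.
  have ag : a `^ q = g by rewrite /a -powRrM mulNr divfK// gt_eqF.
  have W_le m k : W m.+1 k <= a `^ q * W m k./2 by rewrite ag; have [] := W_step m k.
  have W_mean m k : (k < 2 ^ m)%N ->
      (\int[lebesgue_measure]_(u in ditv T m k) \int[lebesgue_measure]_(v in ditv T m k)
        (euclidean_dist (Xs u) (Xs v) `^ q)%:E <=
       (T `^ e * (T / 2 ^+ m) ^+ 2 * W m k)%:E)%E.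
    move=> km; apply: (le_trans (integral_distance_le Xs_cont T_gt0 q_gt0 e_gt0 gam_gt0 H_fin km)).
    by rewrite lee_fin ler_wpM2l// mulr_ge0 ?powR_ge0 ?sqr_ge0.
  have om_control : control a b (omega q W).
    split=> [m k|m k]; first by rewrite powR_gt0.
    split; last exact: omega_half.
    have -> : b = bq `^ q^-1 by rewrite /b /bq -powRrM mulNr mulfK// gt_eqF.
    rewrite -powRM ?powR_ge0 ?(ltW (W_gt0 _ _))//.
    apply: ge0_ler_powR; rewrite ?nnegrE ?invr_ge0 ?mulr_ge0 ?powR_ge0 ?(ltW (W_gt0 _ _)) ?(ltW q_gt0)//.
    by have [] := W_step m k.
  have Xs_const t : T <= t -> Xs t = Xs T by move=> Tt; rewrite /Xs stop_ge.
  have [A A_ge0 X_om] := increment_bound Xs_cont T_gt0 q_gt0 (powR_gt0 e T_gt0)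
    a_gt0 a_lt1 Xs_const W_gt0 W_le W_mean.
  have [XX [C [XX_cont XX1 _ XXC]]] := controlled_lift T_gt0 N_gt0 om_control a_gt0 a_lt1
    b_gt0 (powR2_step betaN) A_ge0 X_cont X_om.
  exists XX; split; last exact: XX1.
  split; first exact: XX_cont.
  apply: (sobolev_integral_fin T_gt0 q_gt0 alpha_gt0 W_gt0 W_sum _ XXC).
  by move=> s t; exact: cc_norm_ge0.
(* Hoelder paths: the sizes are exact powers. *)
have [C0 HC0] := X_reg.
pose a := 2 `^ (- alpha) : R.
have a_gt0 : 0 < a by exact: powR_gt0.
have a_lt1 : a < 1 by apply: powR2_lt1; rewrite oppr_lt0.
pose om (m k : nat) := a ^+ m.
have om_control : control a a om.
  by split=> [m k|m k]; rewrite /om ?exprn_gt0// exprS lexx.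
have scale m : (2^-1 ^+ m) `^ alpha = a ^+ m.
  by rewrite /a exprn_powR// exprVn -powR_inv1 ?exprn_ge0// -powRrM mulN1r.
have A_ge0 : 0 <= `|C0| * T `^ alpha by rewrite mulr_ge0 ?powR_ge0.
have X_om m k i : `|(X (stop T (dyadic T m k.+1)) - X (stop T (dyadic T m k))) 0 i| <=
    `|C0| * T `^ alpha * om m k.
  set t1 := stop T (dyadic T m k); set t2 := stop T (dyadic T m k.+1).
  have -> : (X t2 - X t1) 0 i = - ((X t1 - X t2) 0 i) by rewrite !mxE opprB.
  rewrite normrN; apply: (le_trans (ler_abs_euclidean_norm _ _)).
  have H := HC0 (stop T (dyadic T m k)) (stop T (dyadic T m k.+1))
    (stop_itv T_gt0 _) (stop_itv T_gt0 _).
  apply: (le_trans H); apply: (@le_trans _ _ (`|C0| * (T * 2^-1 ^+ m) `^ alpha)).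
    apply: (@le_trans _ _ (`|C0| * `|t2 - t1| `^ alpha)).
      by apply: ler_wpM2r; [exact: powR_ge0|exact: ler_norm].
    apply: ler_wpM2l => //.
    apply: ge0_ler_powR; rewrite ?nnegrE ?(ltW alpha_gt0) ?mulr_ge0 ?exprn_ge0 ?(ltW T_gt0)//.
    apply: (le_trans (stop_lipschitz T_gt0 _ _)).
    by rewrite dyadic_step ger0_norm ?exprVn// divr_ge0 ?exprn_ge0 ?(ltW T_gt0).
  by rewrite powRM ?exprn_ge0 ?(ltW T_gt0)// scale mulrA.
have [XX [C [XX_cont XX1 XX0 XXC]]] := controlled_lift T_gt0 N_gt0 om_control a_gt0 a_lt1
  a_gt0 (powR2_step alphaN) A_ge0 X_cont X_om.
exists XX; split; last exact: XX1.
split; first exact: XX_cont.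
have D0 s t : 0 <= cc_dist (XX s) (XX t) by exact: cc_norm_ge0.
exists (`|C| * 2 * (2 / T) `^ alpha) => s t; rewrite !in_itv/= => sT tT.
have [->|ts] := eqVneq t s.
  by rewrite XX0 !mulr_ge0 ?powR_ge0.
have gt0 : 0 < `|t - s| by rewrite normr_gt0 subr_eq0.
have gT : `|t - s| <= T.
  move: sT tT => /andP[s0 sT] /andP[t0 tT].
  by rewrite ler_norml; apply/andP; split; lra.
have [m /andP[m1 m2]] := dyadic_scale gt0 gT.
apply: (le_trans (XXC m s t sT tT m2)); rewrite /om -mulr2n -[_ *+ 2]mulr_natl.
have am0 : 0 <= a ^+ m by rewrite exprn_ge0// ltW.
rewrite mulrA -[leRHS]mulrA; apply: (@le_trans _ _ (`|C| * 2 * a ^+ m)).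
  by rewrite ler_wpM2r// ler_wpM2r// ler_norm.
apply: ler_wpM2l; first by rewrite mulr_ge0.
rewrite -scale -powRM ?divr_ge0 ?(ltW T_gt0)//; apply: ge0_ler_powR.
- exact: ltW.
- by rewrite nnegrE exprn_ge0.
- by rewrite nnegrE mulr_ge0 ?divr_ge0 ?(ltW T_gt0).
rewrite exprVn mulrAC ler_pdivlMr// mulrC.
move: m1; rewrite exprS ltr_pdivrMr ?mulr_gt0 ?exprn_gt0// => /ltW.
rewrite ler_pdivrMr ?exprn_gt0//; lra.
Qed.
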